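(* Let $\varepsilon=-1$. Suppose $q_0\in H^{2,2}(\mathbb R)$ and $\alpha(\,\cdot\,;q_0)$ has exactly $n$ zeros in $\mathbb C^-$, all simple, and no zeros on $\mathbb R$. Then there is a neighborhood $\mathcal N$ of $q_0$ in $H^{2,2}(\mathbb R)$ such that for all $q\in\mathcal N$ the function $\alpha(\,\cdot\,;q)$ has the same properties (exactly $n$ zeros in $\mathbb C^-$, all simple, and no zeros on $\mathbb R$).
   Context: $H^{2,2}(\mathbb R)$ is the completion of $C_0^\infty(\mathbb R)$ in the norm $\|u\|_{H^{2,2}}=\left(\|(1+x^2)u\|_{L^2}^2+\|u''\|_{L^2}^2\right)^{1/2}$. $\mathbb C^-=\{\operatorname{Im}\lambda<0\}$, $\sigma_3=\operatorname{diag}(1,-1)$. For $q\in H^{2,2}(\mathbb R)$ and $\lambda\in\mathbb R$, let $\Psi^\pm(x;\lambda)$ be the unique matrix solutions of $$\Psi_x=\begin{pmatrix}-i\lambda+\frac i2|q|^2 & q\\ -\lambda\overline q & i\lambda-\frac i2|q|^2\end{pmatrix}\Psi ,\qquad \lim_{x\to\pm\infty}\Psi^\pm(x;\lambda)e^{i\lambda x\sigma_3}=I .$$ Define $T(\lambda)$ by $\Psi^+=\Psi^-T$; $\alpha(\lambda;q)$ is its $(1,1)$ entry, which extends continuously to $\mathbb C^-\cup\mathbb R$ and analytically to $\mathbb C^-$. *)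

(* Defs.v *)
From Stdlib Require Import Reals List ClassicalEpsilon.
From Coquelicot Require Import Coquelicot.

Open Scope R_scope.

(** * The space H^{2,2}(R) *)

Definition is_test_function (phi : R -> C) : Prop :=
  (forall n x, ex_derive_n (fun y => Re (phi y)) n x /\
               ex_derive_n (fun y => Im (phi y)) n x) /\
  (exists M : R, forall x, M < Rabs x -> phi x = RtoC 0).

Definition second_derivative (phi : R -> C) (x : R) : C :=
  (Derive_n (fun y => Re (phi y)) 2 x, Derive_n (fun y => Im (phi y)) 2 x).

(* Only applied to continuous functions with compact support, for which the
   Riemann and Lebesgue integrals coincide. *)
Definition L2_norm (f : R -> C) : R :=
  sqrt (RInt_gen (fun x => Cmod (f x) ^ 2)
          (Rbar_locally m_infty) (Rbar_locally p_infty)).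

Definition test_norm (phi : R -> C) : R :=
  sqrt (L2_norm (fun x => Cmult (RtoC (1 + x ^ 2)) (phi x)) ^ 2 +
        L2_norm (second_derivative phi) ^ 2).

(* The completion of the test functions.  As the norm dominates the sup norm, a
   Cauchy sequence of test functions converges uniformly, and the element of the
   completion it represents is identified with its pointwise limit [u] (the
   continuous representative of the L^2 class).  This identification is injective:
   a Cauchy sequence with pointwise limit 0 tends to 0 in norm.
   [is_H22_norm u r] says that [u] is in the completion and has norm [r]. *)
Definition is_H22_norm (u : R -> C) (r : R) : Prop :=
  exists phi : nat -> R -> C,
    (forall n, is_test_function (phi n)) /\
    (forall eps : posreal, exists N : nat, forall n m : nat,
       (N <= n)%nat -> (N <= m)%nat ->
       test_norm (fun x => Cminus (phi n x) (phi m x)) < eps) /\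
    (forall x, filterlim (fun n => phi n x) eventually (locally (u x))) /\
    is_lim_seq (fun n => test_norm (phi n)) r.

Record H22 := mkH22 {
  H22_fun :> R -> C;
  H22_mem : exists r : R, is_H22_norm H22_fun r
}.

Definition H22_neighborhood (q0 : H22) (N : H22 -> Prop) : Prop :=
  exists delta : posreal, forall (q : H22) (r : R),
    is_H22_norm (fun x => Cminus (q x) (q0 x)) r -> r < delta -> N q.

(** * The scattering problem *)

Definition mat2 (a b c d : C) : matrix 2 2 := [[a, b], [c, d]].

Definition entry (A : matrix 2 2) (i j : nat) : C := coeff_mat (RtoC 0) A i j.

Definition mat_mult (A B : matrix 2 2) : matrix 2 2 :=
  Mmult (T := C_Ring) A B.

Definition mat_id : matrix 2 2 := Mone (T := C_Ring).

(* The general sign epsilon enters as [epsilon * lam * Cconj q] in the (2,1)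
   entry; here epsilon = -1. *)
Definition lax_matrix (q lam : C) : matrix 2 2 :=
  let p := (Ci / RtoC 2 * RtoC (Cmod q ^ 2))%C in
  mat2 (- Ci * lam + p)%C q
       (- lam * Cconj q)%C (Ci * lam - p)%C.

(* exp (i t sigma_3) *)
Definition exp_i_sigma3 (t : R) : matrix 2 2 :=
  mat2 (cos t, sin t) (RtoC 0)
       (RtoC 0) (cos (- t), sin (- t)).

Definition is_Jost_solution (b : Rbar) (q : R -> C) (lam : R)
    (Psi : R -> matrix 2 2) : Prop :=
  (forall (x : R) (i j : nat), (i < 2)%nat -> (j < 2)%nat ->
     is_derive (K := R_AbsRing) (V := C_R_NormedModule)
       (fun y => entry (Psi y) i j) x
       (entry (mat_mult (lax_matrix (q x) (RtoC lam)) (Psi x)) i j)) /\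
  (forall i j : nat, (i < 2)%nat -> (j < 2)%nat ->
     filterlim (fun x => entry (mat_mult (Psi x) (exp_i_sigma3 (lam * x))) i j)
       (Rbar_locally b) (locally (entry mat_id i j))).

Definition is_transition_matrix (q : R -> C) (lam : R) (T : matrix 2 2) : Prop :=
  exists Psi_p Psi_m : R -> matrix 2 2,
    is_Jost_solution p_infty q lam Psi_p /\
    is_Jost_solution m_infty q lam Psi_m /\
    (forall x, Psi_p x = mat_mult (Psi_m x) T).

(* These conditions determine [a] on the closed lower half-plane; its values in
   the open upper half-plane are unconstrained and irrelevant. *)
Definition is_alpha (q : R -> C) (a : C -> C) : Prop :=
  (forall lam : R, exists T : matrix 2 2,
     is_transition_matrix q lam T /\ a (RtoC lam) = entry T 0 0) /\
  continuous_on (fun z : C => Im z <= 0) a /\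
  (forall z : C, Im z < 0 ->
     ex_derive (K := C_AbsRing) (V := C_NormedModule) a z).

Definition alpha (q : H22) : C -> C :=
  epsilon (inhabits (fun _ : C => RtoC 0)) (is_alpha q).

(** * Zeros *)

Definition is_simple_zero (a : C -> C) (z : C) : Prop :=
  a z = RtoC 0 /\
  exists l : C, is_derive (K := C_AbsRing) (V := C_NormedModule) a z l /\
                l <> RtoC 0.

Definition has_n_simple_zeros (n : nat) (a : C -> C) : Prop :=
  (exists s : list C, NoDup s /\ length s = n /\
     forall z : C, In z s <-> Im z < 0 /\ a z = RtoC 0) /\
  (forall z : C, Im z < 0 -> a z = RtoC 0 -> is_simple_zero a z) /\
  (forall lam : R, a (RtoC lam) <> RtoC 0).

(* Main.v *)
(** The substitution [u1 = e^{i lam x} psi1], [u2 = e^{i lam x} (psi2 + (i/2) conj q psi1)]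
    turns the Lax system into [u1' = q u2], [u2' = 2 i lam u2 + r u1] with
    [r = (i/2) conj q' - |q|^2 conj q / 4], in which lam no longer multiplies the potential.
    For [Im lam <= 0] the energy [|u1|^2 + |u2|^2] is controlled backwards from [+oo] by
    [exp (int |q| + |r|)], so alpha, the limit of [u1] at [-oo], depends on [q] in a Lipschitz
    way in W^{1,1}, uniformly in lam; the damping for [Im lam < 0] bounds second differences in
    lam, and alpha tends to 1 at infinity.  All this is done for test functions and passes to
    uniform limits, since the norm of H^{2,2} dominates that of W^{1,1}.

    The function alpha is determined in the lower half-plane by its values on the real line:
    if [f] is holomorphic for [Im z < 0], continuous up to the real line and zero there, then
    the product of the four functions [f (z0 + i^k z)] vanishes on the boundary of a square
    centered at 0, and Cauchy's formula at the center gives [f z0 = 0].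

    Finally, near a simple zero [z0] of the unperturbed alpha the map
    [z |-> z - alpha z / alpha0' z0] is a contraction for all nearby potentials, while
    compactness and the limit at infinity exclude zeros elsewhere. *)

Require Import Defs.
From Stdlib Require Import Reals.
From Coquelicot Require Import Coquelicot.
From Stdlib Require Import Lra Lia List ClassicalEpsilon Classical.


(** Two circumstances shape the argument. The coefficient [alpha q] is chosen by [epsilon] from a
    characterization, so it can only be reached indirectly: a candidate is built as a uniform limit,
    shown to satisfy [is_alpha], and identified with [alpha q] by uniqueness, which is where
    Cauchy's formula enters. Moreover, differentiability has to survive limits of test functions
    with growing supports. A bound of the second difference [k (A (l + h) - A l) - h (A (l + k) - A
    l)] by [Cmod h * Cmod k * Cmod (h - k)] is closed under pointwise limits, and its constant
    depends only on the W^{1,1} bound and the distance to the real line. This one inequality yields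
    the derivative and, used with a single fixed increment [k], shows that all nearby coefficients
    are almost affine on a common disc; that is what makes the contraction uniform over a
    neighborhood of potentials. Energies are followed backwards because the free factor
    [exp (2 i l t)] has modulus [exp (-2 Im l t)], which for [Im l <= 0] does not grow as [t]
    decreases. *)

Lemma im_le_Cmod (z : C) : Rabs (Im z) <= Cmod z.
Proof.
  eapply Rle_trans; [apply (Rmax_r (Rabs (fst z)))|apply Rmax_Cmod].
Qed.

Lemma Cmod_le_abs (z : C) : Cmod z <= Rabs (Re z) + Rabs (Im z).
Proof.
  apply Rsqr_incr_0_var.
  - rewrite Rsqr_pow2, Cmod2_alt.
    pose proof (Rabs_pos (Re z)); pose proof (Rabs_pos (Im z)).
    rewrite <- (pow2_abs (Re z)), <- (pow2_abs (Im z)). unfold Rsqr. nra.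
  - pose proof (Rabs_pos (Re z)); pose proof (Rabs_pos (Im z)); lra.
Qed.

Lemma Re_ge_opp_Cmod (z : C) : - Cmod z <= Re z.
Proof. pose proof (re_le_Cmod z) as H. apply Rabs_le_between in H. lra. Qed.

Lemma Cmod_sub_sym (z w : C) : Cmod (z - w) = Cmod (w - z).
Proof. rewrite <- Cmod_opp. f_equal. ring. Qed.

Lemma Cmod_sub_triangle (x y z : C) : Cmod (x - z) <= Cmod (x - y) + Cmod (y - z).
Proof.
  replace (x - z)%C with ((x - y) + (y - z))%C by ring. apply Cmod_triangle.
Qed.

Lemma Cmod_sub_triangle_l (x y z : C) : Cmod (x - z) <= Cmod (y - x) + Cmod (y - z).
Proof. rewrite (Cmod_sub_sym y x). apply Cmod_sub_triangle. Qed.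

Lemma Cmod_minus_le (x y : C) : Cmod (x - y) <= Cmod x + Cmod y.
Proof.
  unfold Cminus. eapply Rle_trans; [apply Cmod_triangle|]. rewrite Cmod_opp. lra.
Qed.

Lemma Cmod_reverse_triangle (x y : C) : Cmod x - Cmod y <= Cmod (x - y).
Proof.
  pose proof (Cmod_triangle (x - y) y) as H.
  replace (x - y + y)%C with x in H by ring. lra.
Qed.

Lemma C_eq_parts (z w : C) : Re z = Re w -> Im z = Im w -> z = w.
Proof. destruct z, w; simpl; intros; subst; reflexivity. Qed.

Lemma Re_plus (z w : C) : Re (z + w)%C = Re z + Re w. Proof. reflexivity. Qed.
Lemma Im_plus (z w : C) : Im (z + w)%C = Im z + Im w. Proof. reflexivity. Qed.
Lemma Re_minus (z w : C) : Re (z - w)%C = Re z - Re w. Proof. reflexivity. Qed.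
Lemma Im_minus (z w : C) : Im (z - w)%C = Im z - Im w. Proof. reflexivity. Qed.

(** * Complex functions of a real variable *)

Lemma cont_plus (f g : R -> R) x :
  continuous f x -> continuous g x -> continuous (fun t => f t + g t) x.
Proof. intros; apply (continuous_plus f g x); assumption. Qed.

Lemma cont_minus (f g : R -> R) x :
  continuous f x -> continuous g x -> continuous (fun t => f t - g t) x.
Proof. intros; apply (continuous_minus f g x); assumption. Qed.

Lemma cont_opp (f : R -> R) x : continuous f x -> continuous (fun t => - f t) x.
Proof. intros; apply (continuous_opp f x); assumption. Qed.

Lemma cont_mult (f g : R -> R) x :
  continuous f x -> continuous g x -> continuous (fun t => f t * g t) x.
Proof. intros; apply (continuous_mult f g x); assumption. Qed.

Lemma cont_const (c : R) x : continuous (fun _ : R => c) x.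
Proof. apply continuous_const. Qed.

Lemma cont_id x : continuous (fun t : R => t) x.
Proof. apply continuous_id. Qed.

Lemma cont_pow (f : R -> R) n x : continuous f x -> continuous (fun t => f t ^ n) x.
Proof.
  intros H. induction n as [|n IH]; simpl; [apply cont_const|apply cont_mult; assumption].
Qed.

Lemma cont_sqrt (f : R -> R) x : continuous f x -> continuous (fun t => sqrt (f t)) x.
Proof. intros; apply (continuous_comp f sqrt); [assumption|apply continuous_sqrt]. Qed.

Lemma cont_inv (f : R -> R) x :
  continuous f x -> f x <> 0 -> continuous (fun t => / f t) x.
Proof. intros; apply (continuous_comp f Rinv); [assumption|apply continuous_Rinv; assumption]. Qed.

Lemma is_derive_cont (f : R -> R) (x l : R) : is_derive f x l -> continuous f x.
Proof. intros H; apply (ex_derive_continuous f x); exists l; exact H. Qed.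

(** Stated by components so that the results on real continuous functions and real integrals apply
    to each part. *)
Definition ccont (f : R -> C) (x : R) : Prop :=
  continuous (fun t => Re (f t)) x /\ continuous (fun t => Im (f t)) x.

Lemma cont_Cmod (f : R -> C) x : ccont f x -> continuous (fun t => Cmod (f t)) x.
Proof.
  intros [H1 H2]. unfold Cmod. apply cont_sqrt, cont_plus; apply cont_pow; assumption.
Qed.

Lemma cont_Cmod2 (f : R -> C) x : ccont f x -> continuous (fun t => Cmod (f t) ^ 2) x.
Proof. intros; apply cont_pow, cont_Cmod; assumption. Qed.

Lemma ccont_plus f g x : ccont f x -> ccont g x -> ccont (fun t => f t + g t)%C x.
Proof. intros [A B] [A' B']; split; simpl; apply cont_plus; assumption. Qed.

Lemma ccont_opp f x : ccont f x -> ccont (fun t => - f t)%C x.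
Proof. intros [A B]; split; simpl; apply cont_opp; assumption. Qed.

Lemma ccont_minus f g x : ccont f x -> ccont g x -> ccont (fun t => f t - g t)%C x.
Proof. intros; apply ccont_plus; [|apply ccont_opp]; assumption. Qed.

Lemma ccont_mult f g x : ccont f x -> ccont g x -> ccont (fun t => f t * g t)%C x.
Proof.
  intros [A B] [A' B']; split; simpl; [apply cont_minus|apply cont_plus];
    apply cont_mult; assumption.
Qed.

Lemma ccont_conj f x : ccont f x -> ccont (fun t => Cconj (f t)) x.
Proof. intros [A B]; split; simpl; [|apply cont_opp]; assumption. Qed.

Lemma ccont_const c x : ccont (fun _ => c) x.
Proof. split; apply cont_const. Qed.

Lemma ccont_RtoC (f : R -> R) x : continuous f x -> ccont (fun t => RtoC (f t)) x.
Proof. split; simpl; [assumption|apply cont_const]. Qed.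

Ltac ccont_auto :=
  lazymatch goal with
  | |- ccont (fun _ => ?c) ?x => apply (ccont_const c x)
  | |- ccont (fun t => Cplus (@?f t) (@?g t)) ?x => apply (ccont_plus f g x); ccont_auto
  | |- ccont (fun t => Cminus (@?f t) (@?g t)) ?x => apply (ccont_minus f g x); ccont_auto
  | |- ccont (fun t => Cmult (@?f t) (@?g t)) ?x => apply (ccont_mult f g x); ccont_auto
  | |- ccont (fun t => Copp (@?f t)) ?x => apply (ccont_opp f x); ccont_auto
  | |- ccont (fun t => Cconj (@?f t)) ?x => apply (ccont_conj f x); ccont_auto
  | |- ccont (fun t => RtoC (@?f t)) ?x => apply (ccont_RtoC f x)
  | _ => idtac
  end.

(** Working by components gives access to the real rules of differentiation; [cder_is_derive]
    translates the notion into the normed-module derivative in which Jost solutions are defined. *)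
Definition cder (f : R -> C) (x : R) (l : C) : Prop :=
  is_derive (fun t => Re (f t)) x (Re l) /\ is_derive (fun t => Im (f t)) x (Im l).

Lemma cder_ccont f x l : cder f x l -> ccont f x.
Proof. intros [A B]; split; eapply is_derive_cont; eassumption. Qed.

Lemma cder_eq f x l l' : cder f x l -> l = l' -> cder f x l'.
Proof. intros; subst; assumption. Qed.

Lemma cder_ext (f g : R -> C) x l : (forall t, f t = g t) -> cder f x l -> cder g x l.
Proof.
  intros H [A B]; split.
  - eapply is_derive_ext; [|exact A]; intros; simpl; rewrite H; reflexivity.
  - eapply is_derive_ext; [|exact B]; intros; simpl; rewrite H; reflexivity.
Qed.

Lemma cder_const c x : cder (fun _ => c) x (RtoC 0).
Proof. split; simpl; apply (is_derive_const (K := R_AbsRing) (V := R_NormedModule)). Qed.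

Lemma cder_plus f g x l m :
  cder f x l -> cder g x m -> cder (fun t => f t + g t)%C x (l + m)%C.
Proof.
  intros [A B] [A' B']; split; simpl;
    apply (is_derive_plus (K := R_AbsRing) (V := R_NormedModule)); assumption.
Qed.

Lemma cder_opp f x l : cder f x l -> cder (fun t => - f t)%C x (- l)%C.
Proof.
  intros [A B]; split; simpl;
    apply (is_derive_opp (K := R_AbsRing) (V := R_NormedModule)); assumption.
Qed.

Lemma cder_minus f g x l m :
  cder f x l -> cder g x m -> cder (fun t => f t - g t)%C x (l - m)%C.
Proof. intros; apply cder_plus; [|apply cder_opp]; assumption. Qed.

Lemma is_derive_mult_R (f g : R -> R) (x l m : R) :
  is_derive f x l -> is_derive g x m ->
  is_derive (fun t => f t * g t) x (l * g x + f x * m).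
Proof. intros; apply (is_derive_mult f g x); auto. intros; apply Rmult_comm. Qed.

Lemma is_derive_eq (f : R -> R) (x l l' : R) : is_derive f x l -> l = l' -> is_derive f x l'.
Proof. intros; subst; assumption. Qed.

Lemma cder_mult f g x l m :
  cder f x l -> cder g x m -> cder (fun t => f t * g t)%C x (l * g x + f x * m)%C.
Proof.
  intros [A B] [A' B']; split; simpl.
  - eapply is_derive_eq.
    + apply (is_derive_minus (K := R_AbsRing) (V := R_NormedModule));
        apply is_derive_mult_R; [exact A|exact A'|exact B|exact B'].
    + unfold minus, plus, opp, Re, Im; simpl. ring.
  - eapply is_derive_eq.
    + apply (is_derive_plus (K := R_AbsRing) (V := R_NormedModule));
        apply is_derive_mult_R; [exact A|exact B'|exact B|exact A'].
    + unfold minus, plus, opp, Re, Im; simpl. ring.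
Qed.

Lemma cder_scal c f x l : cder f x l -> cder (fun t => c * f t)%C x (c * l)%C.
Proof.
  intros H. eapply cder_eq; [apply cder_mult; [apply cder_const|exact H]|].
  rewrite Cmult_0_l, Cplus_0_l. reflexivity.
Qed.

Lemma cder_conj f x l : cder f x l -> cder (fun t => Cconj (f t)) x (Cconj l).
Proof.
  intros [A B]; split; simpl; [exact A|].
  apply (is_derive_opp (K := R_AbsRing) (V := R_NormedModule)); assumption.
Qed.

Lemma is_derive_pow2 (f : R -> R) (x l : R) :
  is_derive f x l -> is_derive (fun t => f t ^ 2) x (2 * f x * l).
Proof.
  intros H. eapply is_derive_ext with (f := fun t => f t * f t).
  - intros; simpl; ring.
  - eapply is_derive_eq; [apply is_derive_mult_R; exact H|ring].
Qed.

Lemma is_derive_Cmod2 f x l :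
  cder f x l -> is_derive (fun t => Cmod (f t) ^ 2) x (2 * Re (Cconj (f x) * l)%C).
Proof.
  intros [A B].
  eapply is_derive_ext with (f := fun t => Re (f t) ^ 2 + Im (f t) ^ 2).
  - intros t; rewrite Cmod2_alt; reflexivity.
  - eapply is_derive_eq.
    + apply (is_derive_plus (K := R_AbsRing) (V := R_NormedModule));
        apply is_derive_pow2; eassumption.
    + unfold plus, Re, Im; simpl. ring.
Qed.

Lemma norm_C_R (z : C) : norm (K := R_AbsRing) (V := C_R_NormedModule) z = Cmod z.
Proof.
  destruct z as [a b]. unfold Cmod. simpl fst; simpl snd.
  rewrite <- (pow2_abs a), <- (pow2_abs b). reflexivity.
Qed.

Lemma cder_is_derive f x l :
  cder f x l <-> is_derive (K := R_AbsRing) (V := C_R_NormedModule) f x l.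
Proof.
  split.
  - intros [[LA A] [LB B]]. split; [apply is_linear_scal_l|].
    intros y Hy eps.
    assert (He : 0 < eps / 2) by (destruct eps; simpl; lra).
    specialize (A y Hy (mkposreal _ He)). specialize (B y Hy (mkposreal _ He)).
    generalize (filter_and _ _ A B). apply filter_imp. simpl. intros t [Ha Hb].
    rewrite norm_C_R. eapply Rle_trans; [apply Cmod_le_abs|].
    change (Rabs ((Re (f t) - Re (f y)) + - ((t - y) * Re l)) <= eps / 2 * norm (minus t y)) in Ha.
    change (Rabs ((Im (f t) - Im (f y)) + - ((t - y) * Im l)) <= eps / 2 * norm (minus t y)) in Hb.
    change (Rabs ((Re (f t) - Re (f y)) + - ((t - y) * Re l))
      + Rabs ((Im (f t) - Im (f y)) + - ((t - y) * Im l)) <= eps * norm (minus t y)).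
    lra.
  - intros [L H]. split; (split; [apply is_linear_scal_l|]);
      intros y Hy eps; generalize (H y Hy eps); apply filter_imp; intros t Ht;
      (eapply Rle_trans; [|exact Ht]); rewrite norm_C_R.
    + apply (re_le_Cmod (minus (minus (f t) (f y)) (scal (minus t y) l))).
    + apply (im_le_Cmod (minus (minus (f t) (f y)) (scal (minus t y) l))).
Qed.

(** Euler's formula for the exponential of [mu * x] with [x] real. *)
Definition cexp (mu : C) (x : R) : C :=
  (exp (Re mu * x) * cos (Im mu * x), exp (Re mu * x) * sin (Im mu * x)).

Lemma cder_cexp mu x : cder (cexp mu) x (mu * cexp mu x)%C.
Proof.
  destruct mu as [a b]. unfold cexp; split; simpl; auto_derive; auto; unfold Re, Im; simpl; ring.
Qed.

Lemma cexp_opp mu x : (cexp mu x * cexp (- mu) x = 1)%C.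
Proof.
  destruct mu as [a b]. unfold cexp; apply C_eq_parts; simpl;
    replace (- a * x) with (- (a * x)) by ring;
    replace (- b * x) with (- (b * x)) by ring;
    rewrite exp_Ropp, cos_neg, sin_neg.
  - pose proof (exp_pos (a * x)). pose proof (sin2_cos2 (b * x)) as S. unfold Rsqr in S.
    transitivity (sin (b * x) * sin (b * x) + cos (b * x) * cos (b * x));
      [field; lra|exact S].
  - pose proof (exp_pos (a * x)). field; lra.
Qed.

Lemma Cmod_cexp mu x : Cmod (cexp mu x) = exp (Re mu * x).
Proof.
  apply Rsqr_inj; [apply Cmod_ge_0|left; apply exp_pos|].
  rewrite !Rsqr_pow2, Cmod2_alt. unfold cexp; simpl.
  pose proof (sin2_cos2 (Im mu * x)) as S. unfold Rsqr in S.
  transitivity (exp (Re mu * x) * exp (Re mu * x) *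
    (sin (Im mu * x) * sin (Im mu * x) + cos (Im mu * x) * cos (Im mu * x))); [ring|].
  rewrite S; ring.
Qed.

(** * Differential inequalities and energy estimates *)

Lemma derive_nonneg_le (f f' : R -> R) a b :
  a <= b -> (forall t, a <= t <= b -> is_derive f t (f' t)) ->
  (forall t, a <= t <= b -> 0 <= f' t) -> f a <= f b.
Proof.
  intros Hab Hd Hp.
  destruct (MVT_gen f a b f') as [c [Hc E]].
  - intros x Hx. rewrite Rmin_left, Rmax_right in Hx by lra. apply Hd; lra.
  - intros x Hx. rewrite Rmin_left, Rmax_right in Hx by lra.
    apply derivable_continuous_pt. exists (f' x). apply is_derive_Reals, Hd; lra.
  - rewrite Rmin_left, Rmax_right in Hc by lra. specialize (Hp c Hc). nra.
Qed.

Lemma ex_RInt_cont (f : R -> R) a b : (forall t, continuous f t) -> ex_RInt f a b.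
Proof. intros H; apply (ex_RInt_continuous f); intros; apply H. Qed.

Lemma is_derive_RInt_upper (f : R -> R) a x :
  (forall t, continuous f t) -> is_derive (fun t => RInt f a t) x (f x).
Proof.
  intros H. apply (is_derive_RInt f (fun t => RInt f a t) a).
  - apply filter_forall. intros y. apply (@RInt_correct R_CompleteNormedModule), ex_RInt_cont, H.
  - apply H.
Qed.

Lemma is_derive_RInt_lower (f : R -> R) b x :
  (forall t, continuous f t) -> is_derive (fun t => RInt f t b) x (- f x).
Proof.
  intros H. apply (is_derive_RInt' f (fun t => RInt f t b) x b).
  - apply filter_forall. intros y. apply (@RInt_correct R_CompleteNormedModule), ex_RInt_cont, H.
  - apply H.
Qed.

Lemma RInt_nonneg (f : R -> R) a b :
  (forall t, continuous f t) -> (forall t, 0 <= f t) -> a <= b -> 0 <= RInt f a b.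
Proof. intros H Hp Hab. apply RInt_ge_0; auto. apply ex_RInt_cont, H. Qed.

Lemma RInt_le_cont (f g : R -> R) a b :
  (forall t, continuous f t) -> (forall t, continuous g t) ->
  (forall t, f t <= g t) -> a <= b -> RInt f a b <= RInt g a b.
Proof. intros. apply RInt_le; auto; apply ex_RInt_cont; assumption. Qed.

Lemma RInt_shrink (f : R -> R) a t b :
  (forall t, continuous f t) -> (forall t, 0 <= f t) -> a <= t <= b ->
  RInt f t b <= RInt f a b.
Proof.
  intros H Hp Ht.
  rewrite <- (RInt_Chasles f a t b) by (apply ex_RInt_cont, H).
  pose proof (RInt_nonneg f a t H Hp (proj1 Ht)). unfold plus; simpl. lra.
Qed.

Lemma is_derive_exp_comp (f : R -> R) (x l : R) :
  is_derive f x l -> is_derive (fun t => exp (f t)) x (l * exp (f x)).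
Proof.
  intros H. apply (is_derive_comp exp f x (exp (f x)) l); [|exact H].
  apply is_derive_Reals, derivable_pt_lim_exp.
Qed.

(* Integrating factor [exp (- int_t^X b)], run backwards in time from [X]. *)
Lemma backward_gronwall (E E' b d c : R -> R) (x X B : R) :
  x <= X ->
  (forall t, is_derive E t (E' t)) ->
  (forall t, continuous b t) -> (forall t, continuous d t) ->
  (forall t, continuous c t) ->
  (forall t, 0 <= b t) -> (forall t, 0 <= d t) -> (forall t, 0 <= c t) ->
  (forall t, - b t * E t + d t - c t <= E' t) ->
  RInt b x X <= B -> 0 <= E x ->
  E x + RInt d x X <= exp B * (E X + RInt c x X).
Proof.
  intros HxX HE Cb Cd Cc Pb Pd Pc HI HB HEx.
  (* [G] is nondecreasing: the integrating factor lies between [exp (- B)] and 1, so the gain [d] is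
     counted with its smallest possible weight and the source [c] with its largest. *)
  set (G := fun t => exp (- RInt b t X) * E t + (exp (- B) * RInt d t X - RInt c t X)).
  set (G' := fun t => (exp (- RInt b t X) * b t) * E t + exp (- RInt b t X) * E' t
     + (exp (- B) * - d t - - c t)).
  assert (HG : forall t, is_derive G t (G' t)).
  { intros t. unfold G, G'.
    apply (is_derive_plus (K := R_AbsRing) (V := R_NormedModule)).
    - apply (is_derive_mult_R (fun t => exp (- RInt b t X)) E); [|apply HE].
      eapply is_derive_eq.
      + apply (is_derive_exp_comp (fun t => - RInt b t X)).
        apply (is_derive_opp (K := R_AbsRing) (V := R_NormedModule)).
        apply is_derive_RInt_lower, Cb.
      + unfold opp; simpl. ring.
    - apply (is_derive_minus (K := R_AbsRing) (V := R_NormedModule)).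
      + apply (is_derive_scal (fun t => RInt d t X)). apply is_derive_RInt_lower, Cd.
      + apply is_derive_RInt_lower, Cc. }
  assert (HGle : G x <= G X).
  { apply (derive_nonneg_le G G' x X HxX); [intros; apply HG|].
    intros t Ht. unfold G'.
    assert (L1 : exp (- B) <= exp (- RInt b t X)).
    { destruct (Rle_lt_or_eq_dec (RInt b t X) B) as [h|h].
      - apply Rle_trans with (RInt b x X); [apply RInt_shrink|]; auto.
      - left; apply exp_increasing; lra.
      - rewrite h; lra. }
    assert (L2 : exp (- RInt b t X) <= 1).
    { rewrite <- exp_0. pose proof (RInt_nonneg b t X Cb Pb (proj2 Ht)) as h.
      destruct h as [h|h]; [left; apply exp_increasing; lra|].
      rewrite <- h, Ropp_0. lra. }
    set (e := exp (- RInt b t X)) in *.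
    assert (0 < e) by apply exp_pos.
    pose proof (HI t). pose proof (Pd t). pose proof (Pc t).
    assert (e * (- b t * E t + d t - c t) <= e * E' t) by (apply Rmult_le_compat_l; lra).
    assert (exp (- B) * d t <= e * d t) by (apply Rmult_le_compat_r; lra).
    assert (e * c t <= 1 * c t) by (apply Rmult_le_compat_r; lra).
    lra. }
  unfold G in HGle. rewrite (RInt_point X b), (RInt_point X c), (RInt_point X d) in HGle.
  unfold zero in HGle; simpl in HGle. rewrite Ropp_0, exp_0, Rmult_0_r in HGle.
  assert (L : exp (- B) * E x <= exp (- RInt b x X) * E x).
  { apply Rmult_le_compat_r; [exact HEx|].
    destruct HB as [h|h]; [left; apply exp_increasing; lra|rewrite h; lra]. }
  assert (K : exp (- B) * (E x + RInt d x X) <= E X + RInt c x X) by lra.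
  rewrite exp_Ropp in K. pose proof (exp_pos B).
  apply Rmult_le_reg_l with (/ exp B); [apply Rinv_0_lt_compat; assumption|].
  eapply Rle_trans; [exact K|]. right. field. lra.
Qed.

(** The diagonal term [2 * Ci * l * u2] contributes exactly [4 * - Im l * Cmod u2 ^ 2] to the
    derivative of the energy, with a favorable sign when [Im l <= 0]. Each coupling term costs at
    most its potential times the energy, because [2 |u1| |u2| <= |u1|^2 + |u2|^2]. *)
Lemma energy_lower_bound (q r l u1 u2 f1 f2 : C) :
  4 * - Im l * Cmod u2 ^ 2 - (Cmod q + Cmod r) * (Cmod u1 ^ 2 + Cmod u2 ^ 2)
    - 2 * (Cmod u1 * Cmod f1) - 2 * (Cmod u2 * Cmod f2) <=
  2 * Re (Cconj u1 * (q * u2 + f1))%C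
    + 2 * Re (Cconj u2 * (2 * Ci * l * u2 + r * u1 + f2))%C.
Proof.
  assert (A1 : - (Cmod u1 * (Cmod q * Cmod u2 + Cmod f1)) <= Re (Cconj u1 * (q * u2 + f1))%C).
  { eapply Rle_trans; [|apply Re_ge_opp_Cmod]. rewrite Cmod_mult, Cmod_conj.
    pose proof (Cmod_ge_0 u1). pose proof (Cmod_triangle (q * u2) f1) as h.
    rewrite Cmod_mult in h. nra. }
  assert (A2 : - (Cmod u2 * (Cmod r * Cmod u1 + Cmod f2)) <= Re (Cconj u2 * (r * u1 + f2))%C).
  { eapply Rle_trans; [|apply Re_ge_opp_Cmod]. rewrite Cmod_mult, Cmod_conj.
    pose proof (Cmod_ge_0 u2). pose proof (Cmod_triangle (r * u1) f2) as h.
    rewrite Cmod_mult in h. nra. }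
  assert (A3 : Re (Cconj u2 * (2 * Ci * l * u2 + r * u1 + f2))%C =
     2 * - Im l * Cmod u2 ^ 2 + Re (Cconj u2 * (r * u1 + f2))%C).
  { rewrite Cmod2_alt. destruct u2, l, r, u1, f2; simpl; ring. }
  rewrite A3.
  assert (A4 : 2 * (Cmod u1 * Cmod u2) <= Cmod u1 ^ 2 + Cmod u2 ^ 2)
    by (pose proof (Rle_0_sqr (Cmod u1 - Cmod u2)) as h; unfold Rsqr in h; nra).
  pose proof (Cmod_ge_0 q). pose proof (Cmod_ge_0 r). nra.
Qed.

(** The rate [b], the gain [d] and the source [c] are left free because the forcing is absorbed
    differently each time: by the damping below the real line, by a rate proportional to the forcing
    profile, or by a rate increased by 1. *)
Lemma akns_energy (q r u1 u2 f1 f2 : R -> C) (l : C) (b d c : R -> R) (x X B : R) :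
  x <= X ->
  (forall t, cder u1 t (q t * u2 t + f1 t)%C) ->
  (forall t, cder u2 t (2 * Ci * l * u2 t + r t * u1 t + f2 t)%C) ->
  (forall t, continuous b t) -> (forall t, continuous d t) ->
  (forall t, continuous c t) ->
  (forall t, 0 <= b t) -> (forall t, 0 <= d t) -> (forall t, 0 <= c t) ->
  (forall t, - b t * (Cmod (u1 t) ^ 2 + Cmod (u2 t) ^ 2) + d t - c t <=
     4 * - Im l * Cmod (u2 t) ^ 2
     - (Cmod (q t) + Cmod (r t)) * (Cmod (u1 t) ^ 2 + Cmod (u2 t) ^ 2)
     - 2 * (Cmod (u1 t) * Cmod (f1 t)) - 2 * (Cmod (u2 t) * Cmod (f2 t))) ->
  RInt b x X <= B ->
  Cmod (u1 x) ^ 2 + Cmod (u2 x) ^ 2 + RInt d x X <=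
  exp B * (Cmod (u1 X) ^ 2 + Cmod (u2 X) ^ 2 + RInt c x X).
Proof.
  intros HxX D1 D2 Cb Cd Cc Pb Pd Pc HI HB.
  apply (backward_gronwall (fun t => Cmod (u1 t) ^ 2 + Cmod (u2 t) ^ 2)
    (fun t => 2 * Re (Cconj (u1 t) * (q t * u2 t + f1 t))%C
       + 2 * Re (Cconj (u2 t) * (2 * Ci * l * u2 t + r t * u1 t + f2 t))%C) b d c); auto.
  - intros t. apply (is_derive_plus (K := R_AbsRing) (V := R_NormedModule));
      apply is_derive_Cmod2; auto.
  - intros t. eapply Rle_trans; [apply HI|]. apply energy_lower_bound.
  - pose proof (pow2_ge_0 (Cmod (u1 x))). pose proof (pow2_ge_0 (Cmod (u2 x))). lra.
Qed.

(* Compare [G] with the scalar function [Re (conj D * f)], where [D = f b - f a]. *)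
Lemma cder_increment_le (f f' : R -> C) (G g : R -> R) a b :
  a <= b -> (forall t, a <= t <= b -> cder f t (f' t)) ->
  (forall t, a <= t <= b -> is_derive G t (g t)) ->
  (forall t, a <= t <= b -> Cmod (f' t) <= g t) -> Cmod (f b - f a) <= G b - G a.
Proof.
  intros Hab Hf HG Hg.
  set (D := (f b - f a)%C).
  pose proof (derive_nonneg_le (fun t => Cmod D * G t - Re (Cconj D * f t)%C)
      (fun t => Cmod D * g t - Re (Cconj D * f' t)%C) a b Hab) as H.
  cbv beta in H.
  assert (H' : Cmod D * G a - Re (Cconj D * f a)%C <= Cmod D * G b - Re (Cconj D * f b)%C).
  { apply H.
    - intros t Ht. apply (is_derive_minus (K := R_AbsRing) (V := R_NormedModule)).
      + apply (is_derive_scal G). apply HG, Ht.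
      + exact (proj1 (cder_scal (Cconj D) f t (f' t) (Hf t Ht))).
    - intros t Ht. pose proof (re_le_Cmod (Cconj D * f' t)) as h.
      apply Rabs_le_between in h. rewrite Cmod_mult, Cmod_conj in h.
      pose proof (Rmult_le_compat_l _ _ _ (Cmod_ge_0 D) (Hg t Ht)). lra. }
  assert (E : Re (Cconj D * f b)%C - Re (Cconj D * f a)%C = Cmod D * Cmod D).
  { rewrite <- Re_minus.
    replace (Cconj D * f b - Cconj D * f a)%C with (D * Cconj D)%C by (unfold D; ring).
    rewrite <- Cmod2_conj. simpl. ring. }
  destruct (Cmod_ge_0 D) as [h|h].
  - apply Rmult_le_reg_l with (Cmod D); lra.
  - rewrite <- h. assert (G a <= G b); [|lra].
    apply (derive_nonneg_le G g a b Hab HG).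
    intros t Ht. eapply Rle_trans; [apply Cmod_ge_0|apply Hg, Ht].
Qed.

Lemma cder_increment_RInt (f f' : R -> C) (g : R -> R) a b :
  a <= b -> (forall t, cder f t (f' t)) -> (forall t, continuous g t) ->
  (forall t, Cmod (f' t) <= g t) -> Cmod (f b - f a) <= RInt g a b.
Proof.
  intros Hab Hf Cg Hg.
  assert (Z : RInt g a a = 0) by apply (RInt_point (V := R_CompleteNormedModule)).
  rewrite <- (Rminus_0_r (RInt g a b)), <- Z.
  apply (cder_increment_le f f' (fun t => RInt g a t) g); auto.
  intros; apply is_derive_RInt_upper, Cg.
Qed.

Lemma cder_zero_const (f : R -> C) a b :
  a <= b -> (forall t, a <= t <= b -> cder f t (RtoC 0)) -> f a = f b.
Proof.
  intros Hab H.
  assert (K : Cmod (f b - f a) <= 0 - 0).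
  { apply (cder_increment_le f (fun _ => RtoC 0) (fun _ => 0) (fun _ => 0) a b Hab H).
    - intros; apply (is_derive_const (K := R_AbsRing) (V := R_NormedModule)).
    - intros; rewrite Cmod_0; lra. }
  pose proof (Cmod_ge_0 (f b - f a)).
  assert (Z : (f b - f a)%C = RtoC 0) by (apply Cmod_eq_0; lra).
  replace (f b) with ((f b - f a) + f a)%C by ring. rewrite Z. ring.
Qed.

(** * Uniform limits and linear differential equations *)

(** An arbitrary filter allows one set of limit rules to serve sequences, the two ends of the line
    and complex neighborhoods. *)
Definition flim {T : Type} (F : (T -> Prop) -> Prop) (f : T -> C) (l : C) : Prop :=
  forall eps, 0 < eps -> F (fun x => Cmod (f x - l) < eps).

Notation ccv := (flim eventually).

Lemma ccv_exists (u : nat -> C) :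
  (forall eps, 0 < eps -> exists N : nat, forall n m, (N <= n)%nat -> (N <= m)%nat ->
     Cmod (u n - u m) < eps) ->
  exists l, ccv u l.
Proof.
  intros H.
  destruct (Rcomplete.R_complete (fun n => Re (u n))) as [a Ha].
  { intros eps He. destruct (H eps He) as [N HN]. exists N. intros n m Hn Hm.
    unfold Rdist. rewrite <- Re_minus. eapply Rle_lt_trans; [apply re_le_Cmod|]. apply HN; lia. }
  destruct (Rcomplete.R_complete (fun n => Im (u n))) as [b Hb].
  { intros eps He. destruct (H eps He) as [N HN]. exists N. intros n m Hn Hm.
    unfold Rdist. rewrite <- Im_minus. eapply Rle_lt_trans; [apply im_le_Cmod|]. apply HN; lia. }
  exists (a, b). intros eps He.
  destruct (Ha (eps / 2)) as [N1 H1]; [lra|]. destruct (Hb (eps / 2)) as [N2 H2]; [lra|].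
  exists (max N1 N2). intros n Hn.
  eapply Rle_lt_trans; [apply Cmod_le_abs|].
  specialize (H1 n ltac:(lia)). specialize (H2 n ltac:(lia)). unfold Rdist in *.
  rewrite Re_minus, Im_minus. change (Re (a, b)) with a. change (Im (a, b)) with b. lra.
Qed.

Lemma ccv_unique u l m : ccv u l -> ccv u m -> l = m.
Proof.
  intros H1 H2. assert (Z : (l - m)%C = RtoC 0).
  { apply Cmod_eq_0. apply Rle_antisym; [|apply Cmod_ge_0].
    apply le_epsilon. intros eps He.
    destruct (H1 (eps / 2)) as [N1 K1]; [lra|]. destruct (H2 (eps / 2)) as [N2 K2]; [lra|].
    specialize (K1 (max N1 N2) ltac:(lia)). specialize (K2 (max N1 N2) ltac:(lia)).
    pose proof (Cmod_sub_triangle_l l (u (max N1 N2)) m) as T. lra. }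
  replace l with ((l - m) + m)%C by ring. rewrite Z. ring.
Qed.

Lemma ccv_Cmod_le u l w B :
  ccv u l -> (exists N : nat, forall n, (N <= n)%nat -> Cmod (u n - w) <= B) -> Cmod (l - w) <= B.
Proof.
  intros H [N HN]. apply le_epsilon. intros eps He.
  destruct (H eps He) as [N1 H1]. specialize (H1 (max N N1) ltac:(lia)).
  specialize (HN (max N N1) ltac:(lia)).
  pose proof (Cmod_sub_triangle_l l (u (max N N1)) w) as T. lra.
Qed.

Section FilterLimits.
Context {T : Type} (F : (T -> Prop) -> Prop) {FF : Filter F}.

Lemma flim_ext (f g : T -> C) l : (forall x, f x = g x) -> flim F f l -> flim F g l.
Proof.
  intros E H eps He. generalize (H eps He). apply filter_imp. intros x. rewrite E. auto.
Qed.

Lemma flim_const (c : C) : flim F (fun _ => c) c.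
Proof.
  intros eps He. apply filter_forall. intros _.
  replace (c - c)%C with (RtoC 0) by ring. rewrite Cmod_0. exact He.
Qed.

Lemma flim_plus (f g : T -> C) l m :
  flim F f l -> flim F g m -> flim F (fun x => f x + g x)%C (l + m)%C.
Proof.
  intros H1 H2 eps He. assert (He2 : 0 < eps / 2) by lra.
  generalize (filter_and _ _ (H1 _ He2) (H2 _ He2)). apply filter_imp. intros x [K1 K2].
  replace (f x + g x - (l + m))%C with ((f x - l) + (g x - m))%C by ring.
  eapply Rle_lt_trans; [apply Cmod_triangle|lra].
Qed.

Lemma flim_bounded (f : T -> C) l : flim F f l -> F (fun x => Cmod (f x) <= Cmod l + 1).
Proof.
  intros H. generalize (H 1 Rlt_0_1). apply filter_imp. intros x Hx.
  pose proof (Cmod_reverse_triangle (f x) l). lra.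
Qed.

Lemma flim_mult (f g : T -> C) l m :
  flim F f l -> flim F g m -> flim F (fun x => f x * g x)%C (l * m)%C.
Proof.
  intros H1 H2 eps He.
  pose proof (Cmod_ge_0 l). pose proof (Cmod_ge_0 m).
  set (k := Cmod l + 1 + Cmod m + 1). assert (0 < k) by (unfold k; lra).
  assert (He2 : 0 < eps / (2 * k)) by (apply Rdiv_lt_0_compat; lra).
  generalize (filter_and _ _ (flim_bounded _ _ H1) (filter_and _ _ (H1 _ He2) (H2 _ He2))).
  apply filter_imp. intros x (K0 & K1 & K2).
  replace (f x * g x - l * m)%C with (f x * (g x - m) + (f x - l) * m)%C by ring.
  eapply Rle_lt_trans; [apply Cmod_triangle|]. rewrite !Cmod_mult.
  assert (E : eps = k * (eps / (2 * k)) + k * (eps / (2 * k))) by (field; lra).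
  set (e := eps / (2 * k)) in *.
  pose proof (Cmod_ge_0 (g x - m)). pose proof (Cmod_ge_0 (f x - l)).
  pose proof (Cmod_ge_0 (f x)). unfold k in *. nra.
Qed.

Lemma flim_scal c (f : T -> C) l : flim F f l -> flim F (fun x => c * f x)%C (c * l)%C.
Proof. intros H. apply (flim_mult (fun _ => c)); [apply flim_const|exact H]. Qed.

Lemma flim_minus (f g : T -> C) l m :
  flim F f l -> flim F g m -> flim F (fun x => f x - g x)%C (l - m)%C.
Proof.
  intros H1 H2.
  apply (flim_ext (fun x => f x + - (1) * g x)%C); [intros; ring|].
  replace (l - m)%C with (l + - (1) * m)%C by ring.
  apply flim_plus; [assumption|]. apply flim_scal. assumption.
Qed.

Lemma flim_conj (f : T -> C) l : flim F f l -> flim F (fun x => Cconj (f x)) (Cconj l).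
Proof.
  intros H eps He. generalize (H eps He). apply filter_imp. intros x.
  rewrite <- Cminus_conj, Cmod_conj. auto.
Qed.

(** Meant for oscillating factors of modulus one, which have no limit of their own. *)
Lemma flim_zero_mult (f g : T -> C) K :
  flim F f (RtoC 0) -> (forall x, Cmod (g x) <= K) -> flim F (fun x => f x * g x)%C (RtoC 0).
Proof.
  intros H Hg eps He.
  assert (HK : 0 < Rabs K + 1) by (pose proof (Rabs_pos K); lra).
  assert (He2 : 0 < eps / (Rabs K + 1)) by (apply Rdiv_lt_0_compat; lra).
  generalize (H _ He2). apply filter_imp. intros x Hx.
  replace (f x - 0)%C with (f x) in Hx by ring. replace (f x * g x - 0)%C with (f x * g x)%C by ring.
  rewrite Cmod_mult. specialize (Hg x). pose proof (Rle_abs K).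
  apply Rlt_div_r in Hx; [|lra]. pose proof (Cmod_ge_0 (f x)). nra.
Qed.
End FilterLimits.

Ltac filter_tc := try typeclasses eauto.

Definition ucv {I : Type} (P : I -> Prop) (u : nat -> I -> C) (f : I -> C) : Prop :=
  forall eps, 0 < eps -> exists N : nat, forall n i, (N <= n)%nat -> P i -> Cmod (u n i - f i) < eps.

Lemma ucv_exists {I : Type} (P : I -> Prop) (u : nat -> I -> C) :
  (forall eps, 0 < eps -> exists N : nat, forall n m i, (N <= n)%nat -> (N <= m)%nat -> P i ->
     Cmod (u n i - u m i) < eps) ->
  exists f, ucv P u f.
Proof.
  intros H.
  assert (Hl : forall i, exists l, P i -> ccv (fun n => u n i) l).
  { intros i. destruct (classic (P i)) as [p|np]; [|exists (RtoC 0); tauto].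
    destruct (ccv_exists (fun n => u n i)) as [l Hl]; [|exists l; auto].
    intros eps He. destruct (H eps He) as [N HN]. exists N. auto. }
  exists (fun i => proj1_sig (constructive_indefinite_description _ (Hl i))).
  intros eps He. destruct (H (eps / 2)) as [N HN]; [lra|]. exists N. intros n i Hn Pi.
  destruct (constructive_indefinite_description _ (Hl i)) as [l Li]; simpl.
  rewrite Cmod_sub_sym. apply Rle_lt_trans with (eps / 2); [|lra].
  apply (ccv_Cmod_le _ _ _ _ (Li Pi)). exists N. intros m Hm. left. apply HN; auto.
Qed.

Lemma ucv_ccv {I : Type} (P : I -> Prop) u f i : ucv P u f -> P i -> ccv (fun n => u n i) (f i).
Proof. intros H Pi eps He. destruct (H eps He) as [N HN]. exists N. auto. Qed.

Lemma cder_limit (fn fn' : nat -> R -> C) (f g : R -> C) (x r : R) :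
  0 < r -> (forall n y, cder (fn n) y (fn' n y)) ->
  (forall y, Rabs (y - x) < r -> ccv (fun n => fn n y) (f y)) ->
  ucv (fun y => Rabs (y - x) < r) fn' g -> cder f x (g x).
Proof.
  intros Hr Hd Hc Hu.
  assert (Hx : Boule x (mkposreal r Hr) x).
  { unfold Boule; simpl. rewrite Rminus_diag, Rabs_R0. exact Hr. }
  split; apply is_derive_Reals.
  - apply (CVU_derivable (fun n y => Re (fn n y)) (fun n y => Re (fn' n y))
      (fun y => Re (f y)) (fun y => Re (g y)) x (mkposreal r Hr)); auto.
    + intros eps He. destruct (Hu eps He) as [N HN]. exists N. intros n y Hn Hy.
      rewrite Rabs_minus_sym, <- Re_minus.
      eapply Rle_lt_trans; [apply re_le_Cmod|]. apply HN; auto.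
    + intros y Hy eps He. destruct (Hc y Hy eps He) as [N HN]. exists N. intros n Hn.
      unfold Rdist. rewrite <- Re_minus. eapply Rle_lt_trans; [apply re_le_Cmod|]. apply HN; lia.
    + intros n y _. apply is_derive_Reals. exact (proj1 (Hd n y)).
  - apply (CVU_derivable (fun n y => Im (fn n y)) (fun n y => Im (fn' n y))
      (fun y => Im (f y)) (fun y => Im (g y)) x (mkposreal r Hr)); auto.
    + intros eps He. destruct (Hu eps He) as [N HN]. exists N. intros n y Hn Hy.
      rewrite Rabs_minus_sym, <- Im_minus.
      eapply Rle_lt_trans; [apply im_le_Cmod|]. apply HN; auto.
    + intros y Hy eps He. destruct (Hc y Hy eps He) as [N HN]. exists N. intros n Hn.
      unfold Rdist. rewrite <- Im_minus. eapply Rle_lt_trans; [apply im_le_Cmod|]. apply HN; lia.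
    + intros n y _. apply is_derive_Reals. exact (proj2 (Hd n y)).
Qed.

Definition cint (f : R -> C) (a x : R) : C :=
  (RInt (fun t => Re (f t)) a x, RInt (fun t => Im (f t)) a x).

Lemma cder_cint f a x : (forall t, ccont f t) -> cder (cint f a) x (f x).
Proof.
  intros H. split.
  - apply (is_derive_RInt_upper (fun t => Re (f t)) a x). intros t; exact (proj1 (H t)).
  - apply (is_derive_RInt_upper (fun t => Im (f t)) a x). intros t; exact (proj2 (H t)).
Qed.

Lemma cint_point f a : cint f a a = RtoC 0.
Proof.
  unfold cint. rewrite !(RInt_point (V := R_CompleteNormedModule)). reflexivity.
Qed.

(** * Picard iteration for off-diagonal linear systems *)

(** Iterates for [y1' = b y2], [y2' = c y1]. Starting from zero makes the first iterate the constant
    initial vector, so the first increment is controlled by the data alone. *)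
Fixpoint picard (b c : R -> C) (x0 : R) (v1 v2 : C) (n : nat) : (R -> C) * (R -> C) :=
  match n with
  | O => (fun _ => RtoC 0, fun _ => RtoC 0)
  | S n => let Y := picard b c x0 v1 v2 n in
     (fun x => v1 + cint (fun t => b t * snd Y t) x0 x,
      fun x => v2 + cint (fun t => c t * fst Y t) x0 x)%C
  end.

Section Picard.
Variables (b c : R -> C) (x0 : R) (v1 v2 : C).
Hypothesis Cb : forall t, ccont b t.
Hypothesis Cc : forall t, ccont c t.
Let Y1 n := fst (picard b c x0 v1 v2 n).
Let Y2 n := snd (picard b c x0 v1 v2 n).

Lemma picard_cont n t : ccont (Y1 n) t /\ ccont (Y2 n) t.
Proof.
  revert t. induction n as [|n IH]; intros t.
  - split; apply ccont_const.
  - split; unfold Y1, Y2; simpl; (apply ccont_plus; [apply ccont_const|]).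
    + apply (cder_ccont _ _ _ (cder_cint _ x0 t (fun u => ccont_mult b (Y2 n) u (Cb u) (proj2 (IH u))))).
    + apply (cder_ccont _ _ _ (cder_cint _ x0 t (fun u => ccont_mult c (Y1 n) u (Cc u) (proj1 (IH u))))).
Qed.

Lemma picard_der n t :
  cder (Y1 (S n)) t (b t * Y2 n t)%C /\ cder (Y2 (S n)) t (c t * Y1 n t)%C.
Proof.
  split; unfold Y1, Y2; simpl.
  - eapply cder_eq; [apply cder_plus; [apply cder_const|]|].
    + exact (cder_cint _ x0 t (fun u => ccont_mult b (Y2 n) u (Cb u) (proj2 (picard_cont n u)))).
    + rewrite Cplus_0_l; reflexivity.
  - eapply cder_eq; [apply cder_plus; [apply cder_const|]|].
    + exact (cder_cint _ x0 t (fun u => ccont_mult c (Y1 n) u (Cc u) (proj1 (picard_cont n u)))).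
    + rewrite Cplus_0_l; reflexivity.
Qed.

Lemma picard_init n : Y1 (S n) x0 = v1 /\ Y2 (S n) x0 = v2.
Proof. unfold Y1, Y2; simpl. rewrite !cint_point, !Cplus_0_r. auto. Qed.

(* The weight [exp (2 K |x - x0|)] makes the Picard operator a 1/2-contraction. *)
Lemma weighted_increment (f f' : R -> C) (K A L x : R) :
  0 < K -> Rabs (x - x0) <= L -> (forall t, cder f t (f' t)) -> f x0 = RtoC 0 ->
  (forall t, Rabs (t - x0) <= L -> Cmod (f' t) <= K * (A * exp (2 * K * Rabs (t - x0)))) ->
  0 <= A -> Cmod (f x) <= A / 2 * exp (2 * K * Rabs (x - x0)).
Proof.
  intros HK Hx Hd H0 Hb HA.
  destruct (Rle_dec x0 x) as [h|h].
  - pose proof (cder_increment_le f f' (fun t => A / 2 * exp (2 * K * (t - x0)))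
      (fun t => K * (A * exp (2 * K * (t - x0)))) x0 x h) as H.
    rewrite H0, Rminus_diag, Rmult_0_r, exp_0 in H.
    replace (f x - RtoC 0)%C with (f x) in H by ring.
    rewrite Rabs_pos_eq in * by lra.
    assert (Cmod (f x) <= A / 2 * exp (2 * K * (x - x0)) - A / 2 * 1); [apply H; auto|lra].
    + intros t _. auto_derive; auto. unfold Rminus. field.
    + intros t Ht. specialize (Hb t). rewrite (Rabs_pos_eq (t - x0)) in Hb by lra.
      apply Hb; lra.
  - assert (h' : x <= x0) by lra.
    pose proof (cder_increment_le f f' (fun t => - (A / 2) * exp (2 * K * (x0 - t)))
      (fun t => K * (A * exp (2 * K * (x0 - t)))) x x0 h') as H.
    rewrite H0, Rminus_diag, Rmult_0_r, exp_0, Cmod_sub_sym in H.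
    replace (f x - RtoC 0)%C with (f x) in H by ring.
    rewrite Rabs_minus_sym, Rabs_pos_eq in * by lra.
    assert (Cmod (f x) <= - (A / 2) * 1 - - (A / 2) * exp (2 * K * (x0 - x))); [apply H; auto|lra].
    + intros t _. auto_derive; auto. unfold Rminus. field.
    + intros t Ht. specialize (Hb t). rewrite Rabs_minus_sym, (Rabs_pos_eq (x0 - t)) in Hb by lra.
      apply Hb; lra.
Qed.

Lemma picard_increment (K L : R) :
  0 < K -> (forall t, Rabs (t - x0) <= L -> Cmod (b t) <= K /\ Cmod (c t) <= K) ->
  forall n x, Rabs (x - x0) <= L ->
  Cmod (Y1 (S n) x - Y1 n x) <= (Cmod v1 + Cmod v2) / 2 ^ n * exp (2 * K * Rabs (x - x0)) /\
  Cmod (Y2 (S n) x - Y2 n x) <= (Cmod v1 + Cmod v2) / 2 ^ n * exp (2 * K * Rabs (x - x0)).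
Proof.
  intros HK Hbc n. pose proof (Cmod_ge_0 v1). pose proof (Cmod_ge_0 v2).
  induction n as [|n IH]; intros x Hx.
  (* The derivative of the first iterate involves only the zero iterate, so it is constant. *)
  - assert (E : Y1 1 x = v1 /\ Y2 1 x = v2).
    { assert (P : forall t, cder (Y1 1) t (RtoC 0) /\ cder (Y2 1) t (RtoC 0)).
      { intros t; destruct (picard_der 0 t) as [D1 D2].
        split; eapply cder_eq; [exact D1| |exact D2|]; unfold Y1, Y2; simpl; ring. }
      destruct (picard_init 0) as [I1 I2].
      destruct (Rle_dec x0 x) as [h|h].
      - rewrite <- (cder_zero_const (Y1 1) x0 x h), <- (cder_zero_const (Y2 1) x0 x h);
          auto; intros; apply P.
      - rewrite (cder_zero_const (Y1 1) x x0), (cder_zero_const (Y2 1) x x0);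
          auto; try lra; intros; apply P. }
    destruct E as [E1 E2]. rewrite E1, E2. unfold Y1, Y2; simpl.
    assert (1 <= exp (2 * K * Rabs (x - x0))).
    { pose proof (Rabs_pos (x - x0)). pose proof (exp_ineq1_le (2 * K * Rabs (x - x0))). nra. }
    replace (v1 - RtoC 0)%C with v1 by ring. replace (v2 - RtoC 0)%C with v2 by ring. nra.
  - assert (Hp : 0 < 2 ^ n) by (apply pow_lt; lra).
    replace ((Cmod v1 + Cmod v2) / 2 ^ S n) with ((Cmod v1 + Cmod v2) / 2 ^ n / 2)
      by (simpl; field; lra).
    set (A := (Cmod v1 + Cmod v2) / 2 ^ n) in *.
    assert (HA : 0 <= A) by (apply Rdiv_le_0_compat; lra).
    destruct (picard_init (S n)) as [I1 I2]. destruct (picard_init n) as [J1 J2].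
    split.
    + apply (weighted_increment (fun t => Y1 (S (S n)) t - Y1 (S n) t)%C
        (fun t => b t * Y2 (S n) t - b t * Y2 n t)%C K A L); auto.
      * intros t. apply cder_minus; [apply (picard_der (S n) t)|apply (picard_der n t)].
      * rewrite I1, J1. ring.
      * intros t Ht.
        replace (b t * Y2 (S n) t - b t * Y2 n t)%C with (b t * (Y2 (S n) t - Y2 n t))%C by ring.
        rewrite Cmod_mult. destruct (Hbc t Ht), (IH t Ht).
        apply Rmult_le_compat; try apply Cmod_ge_0; assumption.
    + apply (weighted_increment (fun t => Y2 (S (S n)) t - Y2 (S n) t)%C
        (fun t => c t * Y1 (S n) t - c t * Y1 n t)%C K A L); auto.
      * intros t. apply cder_minus; [apply (picard_der (S n) t)|apply (picard_der n t)].
      * rewrite I2, J2. ring.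
      * intros t Ht.
        replace (c t * Y1 (S n) t - c t * Y1 n t)%C with (c t * (Y1 (S n) t - Y1 n t))%C by ring.
        rewrite Cmod_mult. destruct (Hbc t Ht), (IH t Ht).
        apply Rmult_le_compat; try apply Cmod_ge_0; assumption.
Qed.
End Picard.

Lemma geometric_cauchy {I : Type} (P : I -> Prop) (u : nat -> I -> C) (A : R) :
  (forall n i, P i -> Cmod (u (S n) i - u n i) <= A / 2 ^ n) ->
  forall eps, 0 < eps -> exists N : nat, forall n m i, (N <= n)%nat -> (N <= m)%nat -> P i ->
     Cmod (u n i - u m i) < eps.
Proof.
  intros H eps He.
  (* The geometric sum is written as a difference of tails so that the induction on [k] closes. *)
  assert (B : forall i, P i -> forall n k, Cmod (u (n + k)%nat i - u n i) <= 2 * A / 2 ^ n - 2 * A / 2 ^ (n + k)).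
  { intros i Pi n k. induction k as [|k IH].
    - rewrite Nat.add_0_r. replace (u n i - u n i)%C with (RtoC 0) by ring. rewrite Cmod_0. lra.
    - rewrite Nat.add_succ_r. eapply Rle_trans; [apply (Cmod_sub_triangle _ (u (n + k)%nat i))|].
      specialize (H (n + k)%nat i Pi). assert (0 < 2 ^ (n + k)) by (apply pow_lt; lra).
      replace (2 * A / 2 ^ S (n + k)) with (A / 2 ^ (n + k)) by (simpl; field; lra).
      replace (2 * A / 2 ^ (n + k)) with (A / 2 ^ (n + k) + A / 2 ^ (n + k)) in IH by (field; lra).
      lra. }
  destruct (classic (exists i, P i)) as [[i0 P0]|np].
  2:{ exists 0%nat. intros n m i _ _ Pi. exfalso; apply np; exists i; exact Pi. }
  assert (HA : 0 <= A).
  { specialize (H 0%nat i0 P0). simpl in H. pose proof (Cmod_ge_0 (u 1%nat i0 - u 0%nat i0)). lra. }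
  destruct (pow_lt_1_zero (/ 2) ltac:(rewrite Rabs_pos_eq; lra) (eps / (4 * A + 1))
     ltac:(apply Rdiv_lt_0_compat; lra)) as [N HN].
  exists N. intros n m i Hn Hm Pi.
  assert (T : forall k, (N <= k)%nat -> Cmod (u k i - u N i) <= 2 * A * (/ 2) ^ N).
  { intros k Hk. replace k with (N + (k - N))%nat by lia. eapply Rle_trans; [apply B, Pi|].
    rewrite pow_inv. assert (0 <= 2 * A / 2 ^ (N + (k - N))).
    { apply Rdiv_le_0_compat; [lra|apply pow_lt; lra]. }
    unfold Rdiv in *. lra. }
  eapply Rle_lt_trans; [apply (Cmod_sub_triangle _ (u N i))|].
  rewrite (Cmod_sub_sym (u N i)). pose proof (T n Hn). pose proof (T m Hm).
  specialize (HN N (Nat.le_refl N)). rewrite Rabs_pos_eq in HN by (apply pow_le; lra).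
  apply Rlt_div_r in HN; [|lra]. pose proof (pow_le (/ 2) N ltac:(lra)). nra.
Qed.

Lemma cont_bounded_on (f : R -> R) a b :
  a <= b -> (forall t, continuous f t) -> exists K, forall t, a <= t <= b -> f t <= K.
Proof.
  intros Hab Hf. destruct (continuity_ab_maj f a b Hab) as [m [Hm _]].
  - intros t _. apply continuity_pt_filterlim, Hf.
  - exists (f m). exact Hm.
Qed.

(** On every bounded interval the increments are geometric, with a constant depending on the
    interval only. The iterates therefore converge locally uniformly on the whole line, and the
    limit solves the system globally without any continuation of local solutions. *)
Lemma linear_ode_exists (b c : R -> C) (x0 : R) (v1 v2 : C) :
  (forall t, ccont b t) -> (forall t, ccont c t) ->
  exists y1 y2 : R -> C, y1 x0 = v1 /\ y2 x0 = v2 /\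
    forall t, cder y1 t (b t * y2 t)%C /\ cder y2 t (c t * y1 t)%C.
Proof.
  intros Cb Cc.
  assert (HK : forall L, 0 <= L -> exists K, 0 < K /\ forall t, Rabs (t - x0) <= L ->
      Cmod (b t) <= K /\ Cmod (c t) <= K).
  { intros L HL.
    destruct (cont_bounded_on (fun t => Cmod (b t)) (x0 - L) (x0 + L)) as [K1 H1];
      [lra|intros; apply cont_Cmod, Cb|].
    destruct (cont_bounded_on (fun t => Cmod (c t)) (x0 - L) (x0 + L)) as [K2 H2];
      [lra|intros; apply cont_Cmod, Cc|].
    exists (Rmax 1 (Rmax K1 K2)). split.
    - eapply Rlt_le_trans; [apply Rlt_0_1|apply Rmax_l].
    - intros t Ht. apply Rabs_le_between in Ht.
      pose proof (H1 t ltac:(lra)). pose proof (H2 t ltac:(lra)).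
      pose proof (Rmax_r 1 (Rmax K1 K2)). pose proof (Rmax_l K1 K2). pose proof (Rmax_r K1 K2). lra. }
  set (Y1 := fun n => fst (picard b c x0 v1 v2 n)).
  set (Y2 := fun n => snd (picard b c x0 v1 v2 n)).
  assert (HC : forall L, 0 <= L -> forall eps, 0 < eps -> exists N : nat, forall n m i,
     (N <= n)%nat -> (N <= m)%nat -> Rabs (i - x0) <= L ->
     Cmod (Y1 n i - Y1 m i) < eps /\ Cmod (Y2 n i - Y2 m i) < eps).
  { intros L HL eps He. destruct (HK L HL) as [K [K0 Hbc]].
    pose proof (picard_increment b c x0 v1 v2 Cb Cc K L K0 Hbc) as Inc.
    set (A := (Cmod v1 + Cmod v2) * exp (2 * K * L)).
    assert (HA : forall n x, Rabs (x - x0) <= L ->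
      (Cmod v1 + Cmod v2) / 2 ^ n * exp (2 * K * Rabs (x - x0)) <= A / 2 ^ n).
    { intros n x Hx. unfold A.
      replace ((Cmod v1 + Cmod v2) * exp (2 * K * L) / 2 ^ n) with
        ((Cmod v1 + Cmod v2) / 2 ^ n * exp (2 * K * L)) by (unfold Rdiv; ring).
      apply Rmult_le_compat_l.
      - pose proof (Cmod_ge_0 v1). pose proof (Cmod_ge_0 v2).
        apply Rdiv_le_0_compat; [lra|apply pow_lt; lra].
      - destruct (Rle_lt_or_eq_dec _ _ Hx) as [h|h]; [|rewrite h; lra].
        left; apply exp_increasing. nra. }
    destruct (geometric_cauchy (fun x => Rabs (x - x0) <= L) Y1 A) with (eps := eps) as [N1 H1]; auto.
    { intros n i Hi. eapply Rle_trans; [apply Inc, Hi|apply HA, Hi]. }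
    destruct (geometric_cauchy (fun x => Rabs (x - x0) <= L) Y2 A) with (eps := eps) as [N2 H2]; auto.
    { intros n i Hi. eapply Rle_trans; [apply Inc, Hi|apply HA, Hi]. }
    exists (max N1 N2). intros n m i Hn Hm Hi. split; [apply H1|apply H2]; auto; lia. }
  assert (HL1 : forall x, exists l, ccv (fun n => Y1 n x) l).
  { intros x. apply ccv_exists. intros eps He.
    destruct (HC (Rabs (x - x0)) (Rabs_pos _) eps He) as [N HN]. exists N.
    intros n m Hn Hm. apply HN; auto. lra. }
  assert (HL2 : forall x, exists l, ccv (fun n => Y2 n x) l).
  { intros x. apply ccv_exists. intros eps He.
    destruct (HC (Rabs (x - x0)) (Rabs_pos _) eps He) as [N HN]. exists N.
    intros n m Hn Hm. apply HN; auto. lra. }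
  set (y1 := fun x => proj1_sig (constructive_indefinite_description _ (HL1 x))).
  set (y2 := fun x => proj1_sig (constructive_indefinite_description _ (HL2 x))).
  assert (L1 : forall x, ccv (fun n => Y1 n x) (y1 x)).
  { intros x. unfold y1. destruct (constructive_indefinite_description _ (HL1 x)); auto. }
  assert (L2 : forall x, ccv (fun n => Y2 n x) (y2 x)).
  { intros x. unfold y2. destruct (constructive_indefinite_description _ (HL2 x)); auto. }
  (* The shift is needed because the derivative of iterate [S n] is expressed through iterate
     [n]. *)
  assert (sh : forall u l, ccv u l -> ccv (fun n => u (S n)) l).
  { intros u l H eps He. destruct (H eps He) as [N HN]. exists N. intros n Hn. apply HN; lia. }
  exists y1, y2. split; [|split].
  - apply (ccv_unique _ _ _ (sh _ _ (L1 x0))). unfold Y1.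
    apply (flim_ext eventually (fun _ => v1)); [|apply flim_const; filter_tc].
    intros n; symmetry; exact (proj1 (picard_init b c x0 v1 v2 n)).
  - apply (ccv_unique _ _ _ (sh _ _ (L2 x0))). unfold Y2.
    apply (flim_ext eventually (fun _ => v2)); [|apply flim_const; filter_tc].
    intros n; symmetry; exact (proj2 (picard_init b c x0 v1 v2 n)).
  - intros x. set (L := Rabs (x - x0) + 1).
    assert (HL : 0 <= L) by (unfold L; pose proof (Rabs_pos (x - x0)); lra).
    assert (HB : forall y, Rabs (y - x) < 1 -> Rabs (y - x0) <= L).
    { intros y Hy. unfold L. pose proof (Rabs_triang (y - x) (x - x0)) as T.
      replace (y - x + (x - x0)) with (y - x0) in T by ring. lra. }
    destruct (HK L HL) as [K [K0 Hbc]].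
    split.
    + apply (cder_limit (fun n => Y1 (S n)) (fun n t => b t * Y2 n t)%C y1
        (fun t => b t * y2 t)%C x 1); [lra| | |].
      * intros n y. exact (proj1 (picard_der b c x0 v1 v2 Cb Cc n y)).
      * intros y _. apply (sh (fun n => Y1 n y)), L1.
      * intros eps He. destruct (HC L HL (eps / (2 * K))) as [N HN]; [apply Rdiv_lt_0_compat; lra|].
        exists N. intros n i Hn Hi.
        replace (b i * Y2 n i - b i * y2 i)%C with (b i * (Y2 n i - y2 i))%C by ring.
        rewrite Cmod_mult, (Cmod_sub_sym (Y2 n i)).
        assert (Q : Cmod (y2 i - Y2 n i) <= eps / (2 * K)).
        { apply (ccv_Cmod_le _ _ _ _ (L2 i)). exists N. intros m Hm. left. apply HN; auto. }
        destruct (Hbc i (HB i Hi)) as [Q1 _].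
        assert (E : eps = 2 * (K * (eps / (2 * K)))) by (field; lra).
        pose proof (Rmult_le_compat _ _ _ _ (Cmod_ge_0 _) (Cmod_ge_0 _) Q1 Q). lra.
    + apply (cder_limit (fun n => Y2 (S n)) (fun n t => c t * Y1 n t)%C y2
        (fun t => c t * y1 t)%C x 1); [lra| | |].
      * intros n y. exact (proj2 (picard_der b c x0 v1 v2 Cb Cc n y)).
      * intros y _. apply (sh (fun n => Y2 n y)), L2.
      * intros eps He. destruct (HC L HL (eps / (2 * K))) as [N HN]; [apply Rdiv_lt_0_compat; lra|].
        exists N. intros n i Hn Hi.
        replace (c i * Y1 n i - c i * y1 i)%C with (c i * (Y1 n i - y1 i))%C by ring.
        rewrite Cmod_mult, (Cmod_sub_sym (Y1 n i)).
        assert (Q : Cmod (y1 i - Y1 n i) <= eps / (2 * K)).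
        { apply (ccv_Cmod_le _ _ _ _ (L1 i)). exists N. intros m Hm. left. apply HN; auto. }
        destruct (Hbc i (HB i Hi)) as [_ Q1].
        assert (E : eps = 2 * (K * (eps / (2 * K)))) by (field; lra).
        pose proof (Rmult_le_compat _ _ _ _ (Cmod_ge_0 _) (Cmod_ge_0 _) Q1 Q). lra.
Qed.

(** * The system obtained by removing the factor lambda from the (2,1) entry *)

(** The derivatives are carried as data, which makes the class visibly stable under sums and
    differences. The second one serves for the derivative of [rpot] and for the norm of H^{2,2}. *)
Definition admissible (phi phi1 phi2 : R -> C) (M : R) : Prop :=
  0 <= M /\ (forall t, cder phi t (phi1 t)) /\ (forall t, cder phi1 t (phi2 t)) /\
  (forall t, ccont phi2 t) /\
  (forall t, M < Rabs t -> phi t = RtoC 0 /\ phi1 t = RtoC 0 /\ phi2 t = RtoC 0).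

Definition rpot (phi phi1 : R -> C) (t : R) : C :=
  (Ci / 2 * Cconj (phi1 t) - / 4 * (phi t * Cconj (phi t)) * Cconj (phi t))%C.

(** A bound over all bounded intervals expresses the W^{1,1} norm on the line without an improper
    integral. *)
Definition w11_le (phi phi1 : R -> C) (s : R) : Prop :=
  forall a b, a <= b -> RInt (fun t => Cmod (phi t) + Cmod (phi1 t)) a b <= s.

(* If [(m1, m2)] is [exp (i lam x)] times a column solution of the Lax system, then
   [u1 = m1] and [u2 = m2 + (i/2) conj q * m1]. *)
Definition akns (phi phi1 : R -> C) (M : R) (l c1 c2 : C) (u1 u2 : R -> C) : Prop :=
  (forall t, cder u1 t (phi t * u2 t)%C) /\
  (forall t, cder u2 t (2 * Ci * l * u2 t + rpot phi phi1 t * u1 t)%C) /\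
  (forall t, M < t -> u1 t = c1 /\ u2 t = (c2 * cexp (2 * Ci * l) t)%C).

(** The exponent of the growth factor: by [potentials_RInt] it dominates the integral of
    [|phi| + |rpot|] for a potential of W^{1,1} norm at most [s]. *)
Definition kap (s : R) : R := (1 + s ^ 2) * s.

Lemma RtoC_ne_0 (x : R) : x <> 0 -> RtoC x <> RtoC 0.
Proof. intros H E. apply H. injection E. auto. Qed.

Lemma pow2_le_inv (a b : R) : 0 <= b -> a ^ 2 <= b ^ 2 -> a <= b.
Proof. intros Hb H. apply Rsqr_incr_0_var; [rewrite !Rsqr_pow2; exact H|exact Hb]. Qed.

Lemma Cmod_half_Ci : Cmod (Ci / 2) = / 2.
Proof.
  rewrite Cmod_div by (apply RtoC_ne_0; lra).
  rewrite Cmod_Ci, Cmod_R, Rabs_pos_eq; lra.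
Qed.

Lemma Cmod_quarter : Cmod (/ 4) = / 4.
Proof.
  rewrite Cmod_inv by (apply RtoC_ne_0; lra). rewrite Cmod_R, Rabs_pos_eq; lra.
Qed.

Lemma Cmod_two_Ci : Cmod (2 * Ci) = 2.
Proof. rewrite Cmod_mult, Cmod_Ci, Cmod_R, Rabs_pos_eq; lra. Qed.

Lemma RInt_plus_cont (f g : R -> R) a b :
  (forall t, continuous f t) -> (forall t, continuous g t) ->
  RInt (fun t => f t + g t) a b = RInt f a b + RInt g a b.
Proof.
  intros Hf Hg. apply (RInt_plus (V := R_CompleteNormedModule)); apply ex_RInt_cont; assumption.
Qed.

Lemma RInt_scal_cont (k : R) (f : R -> R) a b :
  (forall t, continuous f t) -> RInt (fun t => k * f t) a b = k * RInt f a b.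
Proof.
  intros Hf. apply (RInt_scal (V := R_CompleteNormedModule)). apply ex_RInt_cont; assumption.
Qed.

Lemma RInt_const_R (k a b : R) : RInt (fun _ => k) a b = (b - a) * k.
Proof. apply (RInt_const (V := R_CompleteNormedModule)). Qed.

Lemma admissible_plus f f1 f2 M g g1 g2 M' :
  admissible f f1 f2 M -> admissible g g1 g2 M' ->
  admissible (fun t => f t + g t)%C (fun t => f1 t + g1 t)%C (fun t => f2 t + g2 t)%C (Rmax M M').
Proof.
  intros (A0 & A1 & A2 & A3 & A4) (B0 & B1 & B2 & B3 & B4).
  split; [|split; [|split; [|split]]].
  - eapply Rle_trans; [exact A0|apply Rmax_l].
  - intros; apply cder_plus; auto.
  - intros; apply cder_plus; auto.
  - intros; apply ccont_plus; auto.
  - intros x Hx. pose proof (Rmax_l M M'). pose proof (Rmax_r M M').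
    destruct (A4 x ltac:(lra)) as (-> & -> & ->). destruct (B4 x ltac:(lra)) as (-> & -> & ->).
    repeat split; ring.
Qed.

Lemma admissible_minus f f1 f2 M g g1 g2 M' :
  admissible f f1 f2 M -> admissible g g1 g2 M' ->
  admissible (fun t => f t - g t)%C (fun t => f1 t - g1 t)%C (fun t => f2 t - g2 t)%C (Rmax M M').
Proof.
  intros (A0 & A1 & A2 & A3 & A4) (B0 & B1 & B2 & B3 & B4).
  split; [|split; [|split; [|split]]].
  - eapply Rle_trans; [exact A0|apply Rmax_l].
  - intros; apply cder_minus; auto.
  - intros; apply cder_minus; auto.
  - intros; apply ccont_minus; auto.
  - intros x Hx. pose proof (Rmax_l M M'). pose proof (Rmax_r M M').
    destruct (A4 x ltac:(lra)) as (-> & -> & ->). destruct (B4 x ltac:(lra)) as (-> & -> & ->).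
    repeat split; ring.
Qed.

Section Admissible.
Variables (phi phi1 phi2 : R -> C) (M : R).
Hypothesis Ha : admissible phi phi1 phi2 M.

Lemma adm_phi t : ccont phi t.
Proof. exact (cder_ccont _ _ _ (proj1 (proj2 Ha) t)). Qed.

Lemma adm_phi1 t : ccont phi1 t.
Proof. exact (cder_ccont _ _ _ (proj1 (proj2 (proj2 Ha)) t)). Qed.

Lemma adm_rpot t : ccont (rpot phi phi1) t.
Proof.
  unfold rpot. ccont_auto; [apply adm_phi1|apply adm_phi|apply adm_phi|apply adm_phi].
Qed.

Lemma adm_weight t : continuous (fun t => Cmod (phi t) + Cmod (phi1 t)) t.
Proof. apply cont_plus; apply cont_Cmod; [apply adm_phi|apply adm_phi1]. Qed.

Lemma adm_out t : M < Rabs t -> phi t = RtoC 0 /\ rpot phi phi1 t = RtoC 0.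
Proof.
  intros Ht. destruct Ha as (_ & _ & _ & _ & H). destruct (H t Ht) as (E0 & E1 & _).
  unfold rpot. rewrite E0, E1. split; [reflexivity|].
  apply C_eq_parts; simpl; field.
Qed.

(** Since [phi] vanishes beyond its support, its value at [t] is recovered by integrating the
    derivative from [t] to a point outside. *)
Lemma adm_sup s t : w11_le phi phi1 s -> Cmod (phi t) <= s.
Proof.
  intros Hs. destruct Ha as (HM & D & _ & _ & Z).
  set (X := Rmax t M + 1).
  assert (HX : M < X /\ t <= X).
  { unfold X. pose proof (Rmax_l t M). pose proof (Rmax_r t M). lra. }
  destruct (Z X) as [ZX _]; [rewrite Rabs_pos_eq; lra|].
  pose proof (cder_increment_RInt phi phi1 (fun t => Cmod (phi t) + Cmod (phi1 t)) t X) as I.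
  rewrite ZX in I. rewrite Cmod_sub_sym in I.
  replace (phi t - RtoC 0)%C with (phi t) in I by ring.
  eapply Rle_trans; [apply I|apply Hs; lra]; try lra; auto.
  - apply adm_weight.
  - intros x; pose proof (Cmod_ge_0 (phi x)); lra.
Qed.

Lemma w11_nonneg s : w11_le phi phi1 s -> 0 <= s.
Proof.
  intros Hs. eapply Rle_trans; [apply Cmod_ge_0|apply (adm_sup s 0 Hs)].
Qed.

Lemma rpot_le s t : w11_le phi phi1 s ->
  Cmod (rpot phi phi1 t) <= / 2 * Cmod (phi1 t) + / 4 * s ^ 2 * Cmod (phi t).
Proof.
  intros Hs. unfold rpot. eapply Rle_trans; [apply Cmod_minus_le|].
  rewrite !Cmod_mult, !Cmod_conj, Cmod_half_Ci, Cmod_quarter.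
  pose proof (adm_sup s t Hs). pose proof (Cmod_ge_0 (phi t)).
  assert (Cmod (phi t) * Cmod (phi t) <= s ^ 2) by nra.
  apply Rplus_le_compat_l, Rmult_le_compat_r; lra.
Qed.

Lemma potentials_RInt s a b : w11_le phi phi1 s -> a <= b ->
  RInt (fun t => Cmod (phi t) + Cmod (rpot phi phi1 t)) a b <= kap s.
Proof.
  intros Hs Hab.
  apply Rle_trans with (RInt (fun t => (1 + s ^ 2) * (Cmod (phi t) + Cmod (phi1 t))) a b).
  - apply RInt_le_cont; auto.
    + intros t; apply cont_plus; apply cont_Cmod; [apply adm_phi|apply adm_rpot].
    + intros t; apply cont_mult; [apply cont_const|apply adm_weight].
    + intros t. pose proof (rpot_le s t Hs). pose proof (Cmod_ge_0 (phi t)).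
      pose proof (Cmod_ge_0 (phi1 t)). pose proof (pow2_ge_0 s). nra.
  - rewrite RInt_scal_cont by apply adm_weight. unfold kap.
    apply Rmult_le_compat_l; [pose proof (pow2_ge_0 s); lra|apply Hs, Hab].
Qed.

(** Multiplying [u2] by [exp (- 2 i l t)] removes the diagonal term and leaves an off-diagonal
    system. The initial point [M + 1] lies beyond the support, where the new unknowns are
    constant. *)
Lemma akns_exists l c1 c2 : exists u1 u2, akns phi phi1 M l c1 c2 u1 u2.
Proof.
  set (e := cexp (2 * Ci * l)). set (e' := cexp (- (2 * Ci * l))).
  assert (Ce : forall t, ccont e t) by (intros t; eapply cder_ccont, cder_cexp).
  assert (Ce' : forall t, ccont e' t) by (intros t; eapply cder_ccont, cder_cexp).
  destruct (linear_ode_exists (fun t => phi t * e t)%C (fun t => rpot phi phi1 t * e' t)%C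
    (M + 1) c1 c2) as (y1 & y2 & I1 & I2 & D).
  { intros t; apply ccont_mult; [apply adm_phi|apply Ce]. }
  { intros t; apply ccont_mult; [apply adm_rpot|apply Ce']. }
  exists y1, (fun t => y2 t * e t)%C. split; [|split].
  - intros t. eapply cder_eq; [exact (proj1 (D t))|ring].
  - intros t. eapply cder_eq; [apply cder_mult; [exact (proj2 (D t))|apply cder_cexp]|].
    cbv beta. transitivity (rpot phi phi1 t * y1 t * (e t * e' t) + 2 * Ci * l * (y2 t * e t))%C;
      [unfold e; ring|]. unfold e, e'. rewrite cexp_opp. ring.
  - assert (Z : forall t, M < t -> cder y1 t (RtoC 0) /\ cder y2 t (RtoC 0)).
    { intros t Ht. destruct Ha as (HM & _). destruct (adm_out t) as [E0 E1];
        [rewrite Rabs_pos_eq; lra|].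
      destruct (D t) as [D1 D2]. rewrite E0 in D1. rewrite E1 in D2.
      split; eapply cder_eq; [exact D1| |exact D2|]; ring. }
    assert (Q : forall t, M < t -> y1 t = c1 /\ y2 t = c2).
    { intros t Ht. destruct (Rle_dec t (M + 1)) as [h|h].
      - rewrite <- I1, <- I2. split; apply cder_zero_const; auto; intros; apply Z; lra.
      - rewrite <- I1, <- I2. split; symmetry; apply cder_zero_const; try lra; intros; apply Z; lra. }
    intros t Ht. destruct (Q t Ht) as [-> ->]. auto.
Qed.

(** Left of the support both potentials vanish and the system is free. For the data [(1, 0)] at the
    right end the constant [a1] is the scattering coefficient. *)
Lemma akns_left l c1 c2 u1 u2 : akns phi phi1 M l c1 c2 u1 u2 ->
  exists a1 a2, forall t, t < - M -> u1 t = a1 /\ u2 t = (a2 * cexp (2 * Ci * l) t)%C.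
Proof.
  intros (D1 & D2 & _).
  set (v := fun t => (u2 t * cexp (- (2 * Ci * l)) t)%C).
  assert (Z : forall t, t < - M -> cder u1 t (RtoC 0) /\ cder v t (RtoC 0)).
  { intros t Ht. destruct (adm_out t) as [E0 E1].
    { rewrite <- Rabs_Ropp. eapply Rlt_le_trans; [|apply Rle_abs]. lra. }
    split; [eapply cder_eq; [apply D1|rewrite E0; ring]|].
    eapply cder_eq; [apply cder_mult; [apply D2|apply cder_cexp]|].
    rewrite E1. ring. }
  exists (u1 (- M - 1)), (v (- M - 1)).
  assert (Q : forall t, t < - M -> u1 t = u1 (- M - 1) /\ v t = v (- M - 1)).
  { intros t Ht. destruct (Rle_dec t (- M - 1)) as [h|h].
    - split; apply cder_zero_const; auto; intros; apply Z; lra.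
    - split; symmetry; apply cder_zero_const; try lra; intros; apply Z; lra. }
  intros t Ht. destruct (Q t Ht) as [Q1 Q2]. split; [exact Q1|].
  rewrite <- Q2. unfold v.
  transitivity (u2 t * (cexp (2 * Ci * l) t * cexp (- (2 * Ci * l)) t))%C; [|ring].
  rewrite cexp_opp. ring.
Qed.

Lemma cont_potentials t : continuous (fun t => Cmod (phi t) + Cmod (rpot phi phi1 t)) t.
Proof. apply cont_plus; apply cont_Cmod; [apply adm_phi|apply adm_rpot]. Qed.

Lemma potentials_nonneg t : 0 <= Cmod (phi t) + Cmod (rpot phi phi1 t).
Proof. pose proof (Cmod_ge_0 (phi t)). pose proof (Cmod_ge_0 (rpot phi phi1 t)). lra. Qed.

(* The dissipative term [-4 Im l |u2|^2] controls [int |u2|^2] and absorbs the forcing. *)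
Lemma akns_damped s eta l (u1 u2 g : R -> C) x X :
  w11_le phi phi1 s -> 0 < eta -> Im l <= - eta ->
  (forall t, cder u1 t (phi t * u2 t)%C) ->
  (forall t, cder u2 t (2 * Ci * l * u2 t + rpot phi phi1 t * u1 t + g t)%C) ->
  (forall t, ccont g t) -> x <= X ->
  Cmod (u1 x) ^ 2 + Cmod (u2 x) ^ 2 + 2 * eta * RInt (fun t => Cmod (u2 t) ^ 2) x X <=
  exp (kap s) * (Cmod (u1 X) ^ 2 + Cmod (u2 X) ^ 2 +
    / (2 * eta) * RInt (fun t => Cmod (g t) ^ 2) x X).
Proof.
  intros Hs He Hl D1 D2 Cg HxX.
  assert (C2 : forall t, continuous (fun t => Cmod (u2 t) ^ 2) t).
  { intros t. apply cont_Cmod2. eapply cder_ccont, D2. }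
  rewrite <- (RInt_scal_cont (2 * eta)) by assumption.
  rewrite <- (RInt_scal_cont (/ (2 * eta))) by (intros; apply cont_Cmod2, Cg).
  assert (0 < / (2 * eta)) by (apply Rinv_0_lt_compat; lra).
  apply (akns_energy phi (rpot phi phi1) u1 u2 (fun _ => RtoC 0) g l
    (fun t => Cmod (phi t) + Cmod (rpot phi phi1 t))); auto.
  - intros t. eapply cder_eq; [apply D1|ring].
  - apply cont_potentials.
  - intros t. apply cont_mult; [apply cont_const|apply C2].
  - intros t. apply cont_mult; [apply cont_const|apply cont_Cmod2, Cg].
  - apply potentials_nonneg.
  - intros t. pose proof (pow2_ge_0 (Cmod (u2 t))). nra.
  - intros t. pose proof (pow2_ge_0 (Cmod (g t))). nra.
  - intros t. rewrite Cmod_0.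
    (* Young's inequality with weight [2 * eta]: half of the available damping [4 * eta * |u2|^2]
       pays for the forcing, the other half is kept as the integral on the left. *)
    assert (Y : 2 * (Cmod (u2 t) * Cmod (g t)) <=
      2 * eta * Cmod (u2 t) ^ 2 + / (2 * eta) * Cmod (g t) ^ 2).
    { pose proof (Rle_0_sqr (2 * eta * Cmod (u2 t) - Cmod (g t))) as Q. unfold Rsqr in Q.
      apply Rmult_le_reg_l with (2 * eta); [lra|].
      replace (2 * eta * (2 * eta * Cmod (u2 t) ^ 2 + / (2 * eta) * Cmod (g t) ^ 2)) with
        (4 * eta ^ 2 * Cmod (u2 t) ^ 2 + Cmod (g t) ^ 2) by (field; lra). nra. }
    pose proof (pow2_ge_0 (Cmod (u2 t))).
    assert (4 * eta * Cmod (u2 t) ^ 2 <= 4 * - Im l * Cmod (u2 t) ^ 2) by nra. nra.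
  - apply potentials_RInt; assumption.
Qed.

(** The energy estimate with no forcing, started from [M + 1]. Its constant is independent of [l]
    because [l] occurs only in the diagonal term, whose contribution has a sign. *)
Lemma akns_bound s l c1 c2 u1 u2 :
  w11_le phi phi1 s -> Im l <= 0 -> akns phi phi1 M l c1 c2 u1 u2 ->
  (forall t, M < t -> Cmod (u1 t) ^ 2 + Cmod (u2 t) ^ 2 <= 1) ->
  forall t, Cmod (u1 t) ^ 2 + Cmod (u2 t) ^ 2 <= exp (kap s).
Proof.
  intros Hs Hl (D1 & D2 & _) H1 t.
  assert (K1 : 1 <= exp (kap s)).
  { pose proof (w11_nonneg s Hs). pose proof (pow2_ge_0 s). pose proof (exp_ineq1_le (kap s)).
    assert (0 <= kap s) by (unfold kap; nra). lra. }
  destruct (Rle_dec t (M + 1)) as [h|h]; [|specialize (H1 t); lra].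
  assert (Q : Cmod (u1 t) ^ 2 + Cmod (u2 t) ^ 2 + RInt (fun _ => 0) t (M + 1) <=
    exp (kap s) * (Cmod (u1 (M + 1)) ^ 2 + Cmod (u2 (M + 1)) ^ 2 + RInt (fun _ => 0) t (M + 1))).
  { apply (akns_energy phi (rpot phi phi1) u1 u2 (fun _ => RtoC 0) (fun _ => RtoC 0) l
    (fun t => Cmod (phi t) + Cmod (rpot phi phi1 t)) (fun _ => 0) (fun _ => 0)); auto.
    - intros x. eapply cder_eq; [apply D1|ring].
    - intros x. eapply cder_eq; [apply D2|ring].
    - apply cont_potentials.
    - intros; apply cont_const.
    - intros; apply cont_const.
    - apply potentials_nonneg.
    - intros; lra.
    - intros; lra.
    - intros x. rewrite Cmod_0. pose proof (pow2_ge_0 (Cmod (u2 x))). nra.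
    - apply potentials_RInt; assumption. }
  rewrite RInt_const_R, Rmult_0_r in Q. specialize (H1 (M + 1) ltac:(lra)).
  pose proof (exp_pos (kap s)). nra.
Qed.

Lemma akns_unit_data l u1 u2 : akns phi phi1 M l (RtoC 1) (RtoC 0) u1 u2 ->
  forall t, M < t -> u1 t = RtoC 1 /\ u2 t = RtoC 0.
Proof.
  intros (_ & _ & H) t Ht. destruct (H t Ht) as [-> ->]. split; [reflexivity|ring].
Qed.

Lemma akns_unit_norm l u1 u2 : akns phi phi1 M l (RtoC 1) (RtoC 0) u1 u2 ->
  forall t, M < t -> Cmod (u1 t) ^ 2 + Cmod (u2 t) ^ 2 <= 1.
Proof.
  intros H t Ht. destruct (akns_unit_data _ _ _ H t Ht) as [-> ->].
  rewrite Cmod_0, Cmod_1. lra.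
Qed.

(* The constant does not involve [M], so the bound survives the limit of test functions. *)
Lemma akns_second_difference s eta l h k u1 u2 v1 v2 w1 w2 :
  w11_le phi phi1 s -> 0 < eta ->
  Im l <= - eta -> Im (l + h)%C <= - eta -> Im (l + k)%C <= - eta ->
  akns phi phi1 M l (RtoC 1) (RtoC 0) u1 u2 ->
  akns phi phi1 M (l + h)%C (RtoC 1) (RtoC 0) v1 v2 ->
  akns phi phi1 M (l + k)%C (RtoC 1) (RtoC 0) w1 w2 ->
  forall t, Cmod (k * (v1 t - u1 t) - h * (w1 t - u1 t)) <=
    exp (2 * kap s) / eta ^ 2 * (Cmod h * Cmod k * Cmod (h - k)).
Proof.
  intros Hs He Hl Hh Hk Au Av Aw t.
  pose proof (akns_unit_data _ _ _ Au) as Iu.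
  pose proof (akns_unit_data _ _ _ Av) as Iv.
  pose proof (akns_unit_data _ _ _ Aw) as Iw.
  destruct Au as (Du1 & Du2 & _), Av as (Dv1 & Dv2 & _), Aw as (Dw1 & Dw2 & _).
  assert (HM : 0 <= M) by apply Ha.
  set (R0 := exp (2 * kap s) / eta ^ 2 * (Cmod h * Cmod k * Cmod (h - k))).
  assert (HR0 : 0 <= R0).
  { unfold R0. repeat apply Rmult_le_pos; try apply Cmod_ge_0; [left; apply exp_pos|].
    left. apply Rinv_0_lt_compat. nra. }
  destruct (Rle_dec t (M + 1)) as [ht|ht].
  2:{ destruct (Iu t ltac:(lra)) as [-> _], (Iv t ltac:(lra)) as [-> _], (Iw t ltac:(lra)) as [-> _].
      replace (k * (1 - 1) - h * (1 - 1))%C with (RtoC 0) by ring. rewrite Cmod_0. exact HR0. }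
  destruct (Iu (M + 1) ltac:(lra)) as [u1X u2X].
  destruct (Iv (M + 1) ltac:(lra)) as [v1X v2X].
  destruct (Iw (M + 1) ltac:(lra)) as [w1X w2X].
  set (e := exp (kap s)). assert (He1 : 0 < e) by apply exp_pos.
  assert (K1 : 1 <= e).
  { pose proof (w11_nonneg s Hs). pose proof (pow2_ge_0 s). pose proof (exp_ineq1_le (kap s)).
    assert (0 <= kap s) by (unfold kap; nra). unfold e; lra. }
  assert (Cw : forall x, ccont w2 x) by (intros x; eapply cder_ccont, Dw2).
  assert (Cv : forall x, ccont v2 x) by (intros x; eapply cder_ccont, Dv2).
  assert (Nn : forall f, (forall x, ccont f x) -> 0 <= RInt (fun t => Cmod (f t) ^ 2) t (M + 1)).
  { intros f Hf. apply RInt_nonneg; auto; [intros; apply cont_Cmod2, Hf|intros; apply pow2_ge_0]. }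
  (* The damped estimate is applied three times in a chain: [w2] is bounded in L^2 by its data, it
     forces [d2 = v2 - w2] with coefficient [2 i (h - k)], and [d2] forces the second difference
     with coefficient [2 i h k]. Only L^2 norms of second components are passed on, so the length of
     the interval never appears. *)
  assert (B0 : 2 * eta * RInt (fun t => Cmod (w2 t) ^ 2) t (M + 1) <= e).
  { pose proof (akns_damped s eta (l + k)%C w1 w2 (fun _ => RtoC 0) t (M + 1) Hs He Hk) as Q.
    rewrite w1X, w2X, Cmod_0, Cmod_1, RInt_const_R in Q.
    assert (Q' : Cmod (w1 t) ^ 2 + Cmod (w2 t) ^ 2 + 2 * eta * RInt (fun t => Cmod (w2 t) ^ 2) t (M + 1)
      <= e * (1 ^ 2 + 0 ^ 2 + / (2 * eta) * ((M + 1 - t) * 0 ^ 2))).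
    { apply Q; auto; [|intros; apply ccont_const].
      intros x. eapply cder_eq; [apply Dw2|ring]. }
    pose proof (pow2_ge_0 (Cmod (w1 t))). pose proof (pow2_ge_0 (Cmod (w2 t))). lra. }
  set (d1 := fun x => (v1 x - w1 x)%C). set (d2 := fun x => (v2 x - w2 x)%C).
  assert (B1 : 2 * eta * RInt (fun t => Cmod (d2 t) ^ 2) t (M + 1) <=
    e * (/ (2 * eta) * (4 * Cmod (h - k) ^ 2 * RInt (fun t => Cmod (w2 t) ^ 2) t (M + 1)))).
  { pose proof (akns_damped s eta (l + h)%C d1 d2 (fun x => 2 * Ci * (h - k) * w2 x)%C t (M + 1) Hs He Hh) as Q.
    unfold d1, d2 in Q. rewrite w1X, w2X, v1X, v2X in Q.
    replace (1 - 1)%C with (RtoC 0) in Q by ring. replace (0 - 0)%C with (RtoC 0) in Q by ring.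
    rewrite Cmod_0 in Q. fold d1 d2 in Q.
    rewrite (RInt_ext (V := R_CompleteNormedModule) (fun x => Cmod (2 * Ci * (h - k) * w2 x) ^ 2)
      (fun x => 4 * Cmod (h - k) ^ 2 * Cmod (w2 x) ^ 2)) in Q.
    2:{ intros x _. rewrite !(Cmod_mult (2 * Ci * (h - k))), (Cmod_mult (2 * Ci)), Cmod_two_Ci.
        simpl; ring. }
    rewrite RInt_scal_cont in Q by (intros; apply cont_Cmod2, Cw).
    assert (Q' : Cmod (v1 t - w1 t) ^ 2 + Cmod (v2 t - w2 t) ^ 2 +
       2 * eta * RInt (fun t => Cmod (d2 t) ^ 2) t (M + 1) <=
       e * (0 ^ 2 + 0 ^ 2 + / (2 * eta) * (4 * Cmod (h - k) ^ 2 * RInt (fun t => Cmod (w2 t) ^ 2) t (M + 1)))).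
    { apply Q; auto.
      - intros x. eapply cder_eq; [apply cder_minus; [apply Dv1|apply Dw1]|unfold d2; ring].
      - intros x. eapply cder_eq; [apply cder_minus; [apply Dv2|apply Dw2]|unfold d1, d2; ring].
      - intros x. apply ccont_mult; [apply ccont_const|apply Cw]. }
    pose proof (pow2_ge_0 (Cmod (v1 t - w1 t))). pose proof (pow2_ge_0 (Cmod (v2 t - w2 t))). lra. }
  set (r1 := fun x => (k * (v1 x - u1 x) - h * (w1 x - u1 x))%C).
  set (r2 := fun x => (k * (v2 x - u2 x) - h * (w2 x - u2 x))%C).
  assert (Cd : forall x, ccont d2 x) by (intros x; apply ccont_minus; [apply Cv|apply Cw]).
  assert (B2 : Cmod (r1 t) ^ 2 <=
    e * (/ (2 * eta) * (4 * (Cmod h * Cmod k) ^ 2 * RInt (fun t => Cmod (d2 t) ^ 2) t (M + 1)))).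
  { pose proof (akns_damped s eta l r1 r2 (fun x => 2 * Ci * (h * k) * d2 x)%C t (M + 1) Hs He Hl) as Q.
    assert (E1 : r1 (M + 1) = RtoC 0) by (unfold r1; rewrite u1X, v1X, w1X; ring).
    assert (E2 : r2 (M + 1) = RtoC 0) by (unfold r2; rewrite u2X, v2X, w2X; ring).
    rewrite E1, E2, Cmod_0 in Q.
    rewrite (RInt_ext (V := R_CompleteNormedModule) (fun x => Cmod (2 * Ci * (h * k) * d2 x) ^ 2)
      (fun x => 4 * (Cmod h * Cmod k) ^ 2 * Cmod (d2 x) ^ 2)) in Q.
    2:{ intros x _. rewrite !(Cmod_mult (2 * Ci * (h * k))), (Cmod_mult (2 * Ci)), Cmod_two_Ci, (Cmod_mult h k).
        simpl; ring. }
    rewrite RInt_scal_cont in Q by (intros; apply cont_Cmod2, Cd).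
    assert (Q' : Cmod (r1 t) ^ 2 + Cmod (r2 t) ^ 2 +
       2 * eta * RInt (fun t => Cmod (r2 t) ^ 2) t (M + 1) <=
       e * (0 ^ 2 + 0 ^ 2 + / (2 * eta) * (4 * (Cmod h * Cmod k) ^ 2 * RInt (fun t => Cmod (d2 t) ^ 2) t (M + 1)))).
    { apply Q; auto.
      - intros x. eapply cder_eq; [apply cder_minus; apply cder_scal; apply cder_minus;
          [apply Dv1|apply Du1|apply Dw1|apply Du1]|unfold r2; ring].
      - intros x. eapply cder_eq; [apply cder_minus; apply cder_scal; apply cder_minus;
          [apply Dv2|apply Du2|apply Dw2|apply Du2]|unfold r1, r2, d2; ring].
      - intros x. apply ccont_mult; [apply ccont_const|apply Cd]. }
    assert (0 <= RInt (fun t => Cmod (r2 t) ^ 2) t (M + 1)).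
    { apply Nn. intros x. apply ccont_minus; (apply ccont_mult; [apply ccont_const|]);
        apply ccont_minus; eapply cder_ccont; [apply Dv2|apply Du2|apply Dw2|apply Du2]. }
    pose proof (pow2_ge_0 (Cmod (r2 t))).
    assert (0 <= 2 * eta * RInt (fun t => Cmod (r2 t) ^ 2) t (M + 1)) by (apply Rmult_le_pos; lra). lra. }
  set (W := RInt (fun t => Cmod (w2 t) ^ 2) t (M + 1)) in *.
  set (V := RInt (fun t => Cmod (d2 t) ^ 2) t (M + 1)) in *.
  change (Cmod (r1 t) <= R0).
  apply pow2_le_inv; [exact HR0|].
  assert (H2k : exp (2 * kap s) = e ^ 2).
  { unfold e. replace (2 * kap s) with (kap s + kap s) by ring. rewrite exp_plus. simpl; ring. }
  assert (EW : W <= e / (2 * eta)) by (apply Rle_div_r; lra).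
  assert (EV : V <= e / (2 * eta) * (/ (2 * eta) * (4 * Cmod (h - k) ^ 2 * (e / (2 * eta))))).
  { assert (T : V <= e / (2 * eta) * (/ (2 * eta) * (4 * Cmod (h - k) ^ 2 * W))).
    { replace (e / (2 * eta) * (/ (2 * eta) * (4 * Cmod (h - k) ^ 2 * W)))
        with (e * (/ (2 * eta) * (4 * Cmod (h - k) ^ 2 * W)) / (2 * eta)) by (field; lra).
      apply Rle_div_r; lra. }
    eapply Rle_trans; [exact T|].
    apply Rmult_le_compat_l; [left; apply Rdiv_lt_0_compat; lra|].
    apply Rmult_le_compat_l; [left; apply Rinv_0_lt_compat; lra|].
    apply Rmult_le_compat_l; [pose proof (pow2_ge_0 (Cmod (h - k))); lra|exact EW]. }
  eapply Rle_trans; [exact B2|].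
  apply Rle_trans with (e * (/ (2 * eta) * (4 * (Cmod h * Cmod k) ^ 2 *
     (e / (2 * eta) * (/ (2 * eta) * (4 * Cmod (h - k) ^ 2 * (e / (2 * eta)))))))).
  { apply Rmult_le_compat_l; [lra|].
    apply Rmult_le_compat_l; [left; apply Rinv_0_lt_compat; lra|].
    apply Rmult_le_compat_l; [pose proof (pow2_ge_0 (Cmod h * Cmod k)); lra|exact EV]. }
  (* The chain yields [e ^ 3 / eta ^ 4]; one more factor [e >= 1] turns it into the perfect square
     of [exp (2 * kap s) / eta ^ 2]. *)
  unfold R0. rewrite H2k.
  replace (e * (/ (2 * eta) * (4 * (Cmod h * Cmod k) ^ 2 *
     (e / (2 * eta) * (/ (2 * eta) * (4 * Cmod (h - k) ^ 2 * (e / (2 * eta))))))))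
    with (e ^ 3 * ((Cmod h * Cmod k * Cmod (h - k)) ^ 2 / eta ^ 4)) by (field; lra).
  replace ((e ^ 2 / eta ^ 2 * (Cmod h * Cmod k * Cmod (h - k))) ^ 2)
    with (e ^ 4 * ((Cmod h * Cmod k * Cmod (h - k)) ^ 2 / eta ^ 4)) by (field; lra).
  apply Rmult_le_compat_r.
  - apply Rdiv_le_0_compat; [apply pow2_ge_0|apply pow_lt, He].
  - assert (0 < e ^ 3) by (apply pow_lt, He1). replace (e ^ 4) with (e ^ 3 * e) by ring. nra.
Qed.

End Admissible.

(** * Dependence on the potential *)

Lemma two_mul_le_scaled (a b k : R) : 0 < k -> 2 * (a * b) <= a ^ 2 / k + k * b ^ 2.
Proof.
  intros Hk. pose proof (Rle_0_sqr (a - k * b)) as Q. unfold Rsqr in Q.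
  apply Rmult_le_reg_l with k; [lra|].
  replace (k * (a ^ 2 / k + k * b ^ 2)) with (a ^ 2 + k ^ 2 * b ^ 2) by (field; lra). nra.
Qed.

Lemma bounded_of_support (f : R -> C) M :
  0 <= M -> (forall t, ccont f t) -> (forall t, M < Rabs t -> f t = RtoC 0) ->
  exists N, 0 <= N /\ forall t, Cmod (f t) <= N.
Proof.
  intros HM Cf Z.
  destruct (cont_bounded_on (fun t => Cmod (f t)) (- M) M) as [K HK];
    [lra|intros; apply cont_Cmod, Cf|].
  exists (Rmax 0 K). split; [apply Rmax_l|]. intros t.
  destruct (Rle_dec (Rabs t) M) as [h|h].
  - eapply Rle_trans; [|apply Rmax_r]. apply HK. apply Rabs_le_between, h.
  - rewrite Z by lra. rewrite Cmod_0. apply Rmax_l.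
Qed.

Lemma cont_divr (f : R -> R) (k : R) t : continuous f t -> continuous (fun t => f t / k) t.
Proof. intros. unfold Rdiv. apply cont_mult; [assumption|apply cont_const]. Qed.

Lemma RInt_divr (f : R -> R) k a b :
  (forall t, continuous f t) -> RInt (fun t => f t / k) a b = RInt f a b / k.
Proof.
  intros Hf. transitivity (RInt (fun t => / k * f t) a b).
  - apply (RInt_ext (V := R_CompleteNormedModule)). intros x _. apply Rmult_comm.
  - rewrite RInt_scal_cont by assumption. apply Rmult_comm.
Qed.

(** The difference of the cubic terms telescopes into three products, each with one factor [a - b]
    or its conjugate and two factors of modulus at most [R0]; with the coefficient 1/4 this gives
    3/4. *)
Lemma rpot_diff_le (a b a1 b1 : C) (R0 : R) :
  Cmod a <= R0 -> Cmod b <= R0 ->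
  Cmod ((Ci / 2 * Cconj a1 - / 4 * (a * Cconj a) * Cconj a)
      - (Ci / 2 * Cconj b1 - / 4 * (b * Cconj b) * Cconj b)) <=
  / 2 * Cmod (a1 - b1) + 3 / 4 * R0 ^ 2 * Cmod (a - b).
Proof.
  intros Ha Hb.
  replace ((Ci / 2 * Cconj a1 - / 4 * (a * Cconj a) * Cconj a)
      - (Ci / 2 * Cconj b1 - / 4 * (b * Cconj b) * Cconj b))%C with
    (Ci / 2 * Cconj (a1 - b1) - / 4 * (a * Cconj a * Cconj (a - b) + a * Cconj (a - b) * Cconj b
      + (a - b) * Cconj b * Cconj b))%C by (rewrite !Cminus_conj; ring).
  eapply Rle_trans; [apply Cmod_minus_le|]. rewrite !Cmod_mult, Cmod_half_Ci, Cmod_quarter, Cmod_conj.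
  apply Rplus_le_compat_l.
  replace (3 / 4 * R0 ^ 2 * Cmod (a - b)) with (/ 4 * (R0 ^ 2 * Cmod (a - b) + R0 ^ 2 * Cmod (a - b) + R0 ^ 2 * Cmod (a - b))) by field.
  apply Rmult_le_compat_l; [lra|].
  pose proof (Cmod_ge_0 a). pose proof (Cmod_ge_0 b). pose proof (Cmod_ge_0 (a - b)).
  eapply Rle_trans; [apply Cmod_triangle|].
  apply Rplus_le_compat; [eapply Rle_trans; [apply Cmod_triangle|]; apply Rplus_le_compat|];
    rewrite !Cmod_mult, !Cmod_conj.
  - apply Rmult_le_compat_r; nra.
  - rewrite Rmult_assoc, (Rmult_comm (Cmod (a - b))), <- Rmult_assoc. apply Rmult_le_compat_r; nra.
  - rewrite Rmult_assoc, Rmult_comm. apply Rmult_le_compat_r; nra.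
Qed.

(** The difference of the solutions obeys the system of [phi], forced by the difference of the
    potentials times the bounded solution [v]. No damping can be used, since [l] may be real; the
    forcing is absorbed through its own integrability in [t]. *)
Lemma akns_potential_lipschitz phi phi1 phi2 M psi psi1 psi2 M' R0 s l c1 c2 u1 u2 v1 v2 :
  admissible phi phi1 phi2 M -> admissible psi psi1 psi2 M' ->
  w11_le phi phi1 R0 -> w11_le psi psi1 R0 -> 0 < s ->
  w11_le (fun t => phi t - psi t)%C (fun t => phi1 t - psi1 t)%C s -> Im l <= 0 ->
  akns phi phi1 M l c1 c2 u1 u2 -> akns psi psi1 M' l c1 c2 v1 v2 ->
  (forall t, M' < t -> Cmod (v1 t) ^ 2 + Cmod (v2 t) ^ 2 <= 1) ->
  forall t, Cmod (u1 t - v1 t) <= exp (kap R0 + 1) * (1 + R0 ^ 2) * s /\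
            Cmod (u2 t - v2 t) <= exp (kap R0 + 1) * (1 + R0 ^ 2) * s.
Proof.
  intros Ha Ha' Hw Hw' Hs Hd Hl Au Av Hn t.
  pose proof (akns_bound _ _ _ _ Ha' _ _ _ _ _ _ Hw' Hl Av Hn) as Bv.
  destruct Au as (Du1 & Du2 & Iu), Av as (Dv1 & Dv2 & Iv).
  pose proof (w11_nonneg _ _ _ _ Ha _ Hw) as HR.
  pose proof (pow2_ge_0 R0) as HR2.
  assert (Hk : 0 <= kap R0) by (unfold kap; nra).
  set (K := exp (kap R0)) in *. assert (K0 : 0 < K) by apply exp_pos.
  set (B := exp (kap R0 + 1) * (1 + R0 ^ 2) * s).
  assert (HB : 0 <= B).
  { unfold B. pose proof (exp_pos (kap R0 + 1)).
    apply Rmult_le_pos; [|lra]. apply Rmult_le_pos; lra. }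
  assert (main : Cmod (u1 t - v1 t) ^ 2 + Cmod (u2 t - v2 t) ^ 2 <= B ^ 2).
  2:{ split; apply pow2_le_inv; auto.
      - pose proof (pow2_ge_0 (Cmod (u2 t - v2 t))). lra.
      - pose proof (pow2_ge_0 (Cmod (u1 t - v1 t))). lra. }
  set (X := Rmax M M' + 1).
  assert (HX : M < X /\ M' < X).
  { unfold X. pose proof (Rmax_l M M'). pose proof (Rmax_r M M'). lra. }
  assert (HE : forall x, X <= x -> u1 x = v1 x /\ u2 x = v2 x).
  { intros x Hx. destruct (Iu x ltac:(lra)) as [-> ->], (Iv x ltac:(lra)) as [-> ->]. auto. }
  destruct (Rle_dec t X) as [ht|ht].
  2:{ destruct (HE t ltac:(lra)) as [-> ->].
      replace (v1 t - v1 t)%C with (RtoC 0) by ring. replace (v2 t - v2 t)%C with (RtoC 0) by ring.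
      rewrite Cmod_0. pose proof (pow2_ge_0 B). lra. }
  set (f := fun x => Cmod (phi x - psi x) + Cmod (rpot phi phi1 x - rpot psi psi1 x)).
  assert (Cphi : forall x, ccont phi x) by apply (adm_phi _ _ _ _ Ha).
  assert (Cpsi : forall x, ccont psi x) by apply (adm_phi _ _ _ _ Ha').
  assert (Cr : forall x, ccont (rpot phi phi1) x) by apply (adm_rpot _ _ _ _ Ha).
  assert (Cr' : forall x, ccont (rpot psi psi1) x) by apply (adm_rpot _ _ _ _ Ha').
  assert (Cphi1 : forall x, ccont phi1 x) by apply (adm_phi1 _ _ _ _ Ha).
  assert (Cpsi1 : forall x, ccont psi1 x) by apply (adm_phi1 _ _ _ _ Ha').
  assert (Cf : forall x, continuous f x).
  { intros x. apply cont_plus; apply cont_Cmod; apply ccont_minus; auto. }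
  assert (Pf : forall x, 0 <= f x).
  { intros x. unfold f. pose proof (Cmod_ge_0 (phi x - psi x)).
    pose proof (Cmod_ge_0 (rpot phi phi1 x - rpot psi psi1 x)). lra. }
  set (s' := (1 + R0 ^ 2) * s). assert (Hs' : 0 < s') by (unfold s'; nra).
  assert (If : RInt f t X <= s').
  { apply Rle_trans with (RInt (fun x => (1 + R0 ^ 2) * (Cmod (phi x - psi x) + Cmod (phi1 x - psi1 x))) t X).
    - apply RInt_le_cont; auto.
      + intros x. apply cont_mult; [apply cont_const|]. apply cont_plus; apply cont_Cmod, ccont_minus; auto.
      + intros x. unfold f.
        pose proof (rpot_diff_le (phi x) (psi x) (phi1 x) (psi1 x) R0
          (adm_sup _ _ _ _ Ha _ x Hw) (adm_sup _ _ _ _ Ha' _ x Hw')) as Q.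
        unfold rpot. pose proof (Cmod_ge_0 (phi x - psi x)). pose proof (Cmod_ge_0 (phi1 x - psi1 x)).
        eapply Rle_trans; [apply Rplus_le_compat_l, Q|]. nra.
    - rewrite RInt_scal_cont.
      + unfold s'. apply Rmult_le_compat_l; [lra|]. apply Hd, ht.
      + intros x. apply cont_plus; apply cont_Cmod, ccont_minus; auto. }
  destruct (HE X (Rle_refl X)) as [EX1 EX2].
  (* The additional rate [f / s'] has integral at most 1, whence [kap R0 + 1] in the exponent. As
     [K] bounds the energy of [v], the source [s' * K * f] has integral at most [K * s' ^ 2],
     quadratic in [s]; the square root is then linear in [s]. *)
  pose proof (akns_energy phi (rpot phi phi1) (fun x => u1 x - v1 x)%C (fun x => u2 x - v2 x)%C
    (fun x => (phi x - psi x) * v2 x)%C (fun x => (rpot phi phi1 x - rpot psi psi1 x) * v1 x)%C l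
    (fun x => Cmod (phi x) + Cmod (rpot phi phi1 x) + f x / s') (fun _ => 0)
    (fun x => s' * K * f x) t X (kap R0 + 1) ht) as E.
  cbv beta in E. rewrite EX1, EX2 in E.
  replace (v1 X - v1 X)%C with (RtoC 0) in E by ring.
  replace (v2 X - v2 X)%C with (RtoC 0) in E by ring.
  rewrite Cmod_0, RInt_scal_cont, RInt_const_R in E by exact Cf.
  assert (E' : Cmod (u1 t - v1 t) ^ 2 + Cmod (u2 t - v2 t) ^ 2 + (X - t) * 0 <=
     exp (kap R0 + 1) * (0 ^ 2 + 0 ^ 2 + s' * K * RInt f t X)).
  { apply E; clear E.
    - intros x. eapply cder_eq; [apply cder_minus; [apply Du1|apply Dv1]|ring].
    - intros x. eapply cder_eq; [apply cder_minus; [apply Du2|apply Dv2]|ring].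
    - intros x. apply cont_plus; [apply (cont_potentials _ _ _ _ Ha)|apply cont_divr, Cf].
    - intros; apply cont_const.
    - intros; apply cont_mult; [apply cont_const|apply Cf].
    - intros x. pose proof (potentials_nonneg phi phi1 x).
      pose proof (Rdiv_le_0_compat _ _ (Pf x) Hs'). lra.
    - intros; lra.
    - intros x. specialize (Pf x). assert (0 < s' * K) by nra. nra.
    - intros x. rewrite !Cmod_mult.
      set (p := Cmod (phi x - psi x)). set (r := Cmod (rpot phi phi1 x - rpot psi psi1 x)).
      assert (Hp : 0 <= p) by apply Cmod_ge_0. assert (Hr : 0 <= r) by apply Cmod_ge_0.
      specialize (Bv x).
      pose proof (two_mul_le_scaled (Cmod (u1 x - v1 x)) (Cmod (v2 x)) s' Hs') as T1.
      pose proof (two_mul_le_scaled (Cmod (u2 x - v2 x)) (Cmod (v1 x)) s' Hs') as T2.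
      pose proof (pow2_ge_0 (Cmod (v1 x))) as P1. pose proof (pow2_ge_0 (Cmod (v2 x))) as P2.
      pose proof (pow2_ge_0 (Cmod (u1 x - v1 x))) as P3. pose proof (pow2_ge_0 (Cmod (u2 x - v2 x))) as P4.
      set (e1 := Cmod (u1 x - v1 x)) in *. set (e2 := Cmod (u2 x - v2 x)) in *.
      assert (Z1 : 0 <= e1 ^ 2 / s') by (apply Rdiv_le_0_compat; lra).
      assert (Z2 : 0 <= e2 ^ 2 / s') by (apply Rdiv_le_0_compat; lra).
      assert (ZZ : (e1 ^ 2 + e2 ^ 2) / s' = e1 ^ 2 / s' + e2 ^ 2 / s') by (field; lra).
      set (Q := (e1 ^ 2 + e2 ^ 2) / s') in *.
      assert (U1 : 2 * (e1 * Cmod (v2 x)) <= Q + s' * K) by nra.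
      assert (U2 : 2 * (e2 * Cmod (v1 x)) <= Q + s' * K) by nra.
      replace (f x / s' ) with ((p + r) / s') by reflexivity.
      assert (W : (p + r) / s' * (e1 ^ 2 + e2 ^ 2) = (p + r) * Q) by (unfold Q; field; lra).
      replace (f x) with (p + r) by reflexivity.
      assert (V1 : p * (2 * (e1 * Cmod (v2 x))) <= p * (Q + s' * K)) by (apply Rmult_le_compat_l; lra).
      assert (V2 : r * (2 * (e2 * Cmod (v1 x))) <= r * (Q + s' * K)) by (apply Rmult_le_compat_l; lra).
      assert (0 <= 4 * - Im l * e2 ^ 2) by (apply Rmult_le_pos; lra).
      rewrite Ropp_mult_distr_l_reverse, Rmult_plus_distr_r, W. lra.
    - rewrite RInt_plus_cont, RInt_divr; auto.
      + pose proof (potentials_RInt _ _ _ _ Ha R0 t X Hw ht).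
        assert (RInt f t X / s' <= 1) by (apply Rle_div_l; lra). lra.
      + apply (cont_potentials _ _ _ _ Ha).
      + intros; apply cont_divr, Cf. }
  assert (Y : s' * K * RInt f t X <= s' * K * s') by (apply Rmult_le_compat_l; [nra|exact If]).
  assert (HKe : K <= exp (kap R0 + 1)) by (left; apply exp_increasing; lra).
  set (e := exp (kap R0 + 1)) in *.
  assert (e * (s' * K * s') <= B ^ 2).
  { unfold B. replace ((e * (1 + R0 ^ 2) * s) ^ 2) with (e * (s' * e * s')) by (unfold s'; ring).
    apply Rmult_le_compat_l; [lra|]. apply Rmult_le_compat_r; [lra|]. apply Rmult_le_compat_l; lra. }
  assert (e * (0 ^ 2 + 0 ^ 2 + s' * K * RInt f t X) <= e * (s' * K * s')).
  { apply Rmult_le_compat_l; lra. }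
  lra.
Qed.

(** * Dependence on the spectral parameter for one test function *)

Section FixedPotential.
Variables (phi phi1 phi2 : R -> C) (M s : R).
Hypothesis Ha : admissible phi phi1 phi2 M.
Hypothesis Hw : w11_le phi phi1 s.

(** The forcing is absorbed by raising the rate by 1 on an interval of length [2 * M + 2]. The
    constant depends on [M], which is harmless as long as the potential is fixed, and the estimate
    holds up to the real line. The coefficients [q], [r] are free because the asymptotics in [l] use
    it with [r = 0]. *)
Lemma akns_crude q r u1 u2 f1 f2 l (N : R) :
  (forall t, ccont q t) -> (forall t, ccont r t) ->
  (forall t, Cmod (q t) + Cmod (r t) <= Cmod (phi t) + Cmod (rpot phi phi1 t)) ->
  Im l <= 0 ->
  (forall t, cder u1 t (q t * u2 t + f1 t)%C) ->
  (forall t, cder u2 t (2 * Ci * l * u2 t + r t * u1 t + f2 t)%C) ->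
  u1 (M + 1) = RtoC 0 -> u2 (M + 1) = RtoC 0 ->
  (forall t, Cmod (f1 t) ^ 2 + Cmod (f2 t) ^ 2 <= N) ->
  Cmod (u1 (- M - 1)) ^ 2 <= exp (kap s + (2 * M + 2)) * ((2 * M + 2) * N).
Proof.
  intros Cq Cr Hqr Hl D1 D2 I1 I2 Hf.
  assert (HM : 0 <= M) by apply Ha.
  assert (HN : 0 <= N).
  { specialize (Hf 0). pose proof (pow2_ge_0 (Cmod (f1 0))). pose proof (pow2_ge_0 (Cmod (f2 0))). lra. }
  assert (E : Cmod (u1 (- M - 1)) ^ 2 + Cmod (u2 (- M - 1)) ^ 2 + RInt (fun _ => 0) (- M - 1) (M + 1) <=
    exp (kap s + (2 * M + 2)) * (Cmod (u1 (M + 1)) ^ 2 + Cmod (u2 (M + 1)) ^ 2 + RInt (fun _ => N) (- M - 1) (M + 1))).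
  { apply (akns_energy q r u1 u2 f1 f2 l (fun x => Cmod (phi x) + Cmod (rpot phi phi1 x) + 1)); auto.
    - lra.
    - intros x. apply cont_plus; [apply (cont_potentials _ _ _ _ Ha)|apply cont_const].
    - intros; apply cont_const.
    - intros; apply cont_const.
    - intros x. pose proof (potentials_nonneg phi phi1 x). lra.
    - intros; lra.
    - intros x. specialize (Hf x). specialize (Hqr x).
      pose proof (two_mul_le_scaled (Cmod (u1 x)) (Cmod (f1 x)) 1 Rlt_0_1) as T1.
      pose proof (two_mul_le_scaled (Cmod (u2 x)) (Cmod (f2 x)) 1 Rlt_0_1) as T2.
      pose proof (pow2_ge_0 (Cmod (u1 x))) as P1. pose proof (pow2_ge_0 (Cmod (u2 x))) as P2.
      assert (0 <= 4 * - Im l * Cmod (u2 x) ^ 2) by (apply Rmult_le_pos; lra).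
      rewrite Rdiv_1_r in T1, T2.
      set (e := Cmod (u1 x) ^ 2 + Cmod (u2 x) ^ 2) in *.
      assert ((Cmod (q x) + Cmod (r x)) * e <= (Cmod (phi x) + Cmod (rpot phi phi1 x)) * e)
        by (apply Rmult_le_compat_r; [unfold e|]; lra).
      unfold e in *. lra.
    - rewrite RInt_plus_cont, RInt_const_R.
      + pose proof (potentials_RInt _ _ _ _ Ha s (- M - 1) (M + 1) Hw ltac:(lra)). lra.
      + apply (cont_potentials _ _ _ _ Ha).
      + intros; apply cont_const. }
  rewrite I1, I2, Cmod_0, !RInt_const_R in E.
  pose proof (pow2_ge_0 (Cmod (u2 (- M - 1)))).
  replace (0 ^ 2 + 0 ^ 2 + (M + 1 - (- M - 1)) * N) with ((2 * M + 2) * N) in E by ring. lra.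
Qed.

(** The difference of two solutions is forced by [2 i (l - m) v2], and [v2] is bounded uniformly in
    [m]. The point [- M - 1] lies left of the support, where the first components equal the
    coefficients. *)
Lemma akns_spectral_lipschitz :
  exists K, forall l m u1 u2 v1 v2, Im l <= 0 -> Im m <= 0 ->
  akns phi phi1 M l (RtoC 1) (RtoC 0) u1 u2 -> akns phi phi1 M m (RtoC 1) (RtoC 0) v1 v2 ->
  Cmod (u1 (- M - 1) - v1 (- M - 1)) <= K * Cmod (l - m).
Proof.
  set (A := exp (kap s + (2 * M + 2)) * ((2 * M + 2) * (4 * exp (kap s)))).
  (* The energy estimate bounds the square by [A], and [A <= (A + 1) ^ 2] avoids a square root. *)
  exists (A + 1). intros l m u1 u2 v1 v2 Hl Hm Au Av.
  pose proof (akns_bound _ _ _ _ Ha _ _ _ _ _ _ Hw Hm Av (akns_unit_norm _ _ _ _ _ _ Av)) as Bv.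
  assert (HM : 0 <= M) by apply Ha.
  assert (HA : 0 <= A).
  { unfold A. pose proof (exp_pos (kap s + (2 * M + 2))). pose proof (exp_pos (kap s)).
    apply Rmult_le_pos; [lra|]. apply Rmult_le_pos; lra. }
  destruct (akns_unit_data _ _ _ _ _ _ Au (M + 1) ltac:(lra)) as [Iu1 Iu2].
  destruct (akns_unit_data _ _ _ _ _ _ Av (M + 1) ltac:(lra)) as [Iv1 Iv2].
  destruct Au as (Du1 & Du2 & _), Av as (Dv1 & Dv2 & _).
  pose proof (Cmod_ge_0 (l - m)) as Hlm.
  apply pow2_le_inv; [apply Rmult_le_pos; lra|].
  eapply Rle_trans.
  - apply (akns_crude phi (rpot phi phi1) (fun t => u1 t - v1 t)%C (fun t => u2 t - v2 t)%C
     (fun _ => RtoC 0) (fun t => 2 * Ci * (l - m) * v2 t)%C l (4 * Cmod (l - m) ^ 2 * exp (kap s))).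
    + apply (adm_phi _ _ _ _ Ha).
    + apply (adm_rpot _ _ _ _ Ha).
    + intros; lra.
    + exact Hl.
    + intros x. eapply cder_eq; [apply cder_minus; [apply Du1|apply Dv1]|ring].
    + intros x. eapply cder_eq; [apply cder_minus; [apply Du2|apply Dv2]|ring].
    + rewrite Iu1, Iv1. ring.
    + rewrite Iu2, Iv2. ring.
    + intros t. rewrite Cmod_0, (Cmod_mult (2 * Ci * (l - m))), (Cmod_mult (2 * Ci)), Cmod_two_Ci.
      specialize (Bv t). pose proof (pow2_ge_0 (Cmod (v1 t))). pose proof (pow2_ge_0 (Cmod (l - m))). nra.
  - replace (exp (kap s + (2 * M + 2)) * ((2 * M + 2) * (4 * Cmod (l - m) ^ 2 * exp (kap s))))
      with (A * Cmod (l - m) ^ 2) by (unfold A; ring).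
    rewrite Rpow_mult_distr. apply Rmult_le_compat_r; [apply pow2_ge_0|]. nra.
Qed.

(** Prepares the large-[l] substitution, which differentiates [rpot]; this is where the second
    derivative of the potential is needed. *)
Lemma rpot_derivative : exists r1, (forall t, cder (rpot phi phi1) t (r1 t)) /\
  exists N, 0 <= N /\ forall t, Cmod (r1 t) <= N.
Proof.
  pose proof Ha as (HM & D0 & D1 & C2 & Z).
  set (p := fun t => (phi t * Cconj (phi t))%C).
  set (p1 := fun t => (phi1 t * Cconj (phi t) + phi t * Cconj (phi1 t))%C).
  exists (fun t => Ci / 2 * Cconj (phi2 t) - (/ 4 * p1 t * Cconj (phi t) + / 4 * p t * Cconj (phi1 t)))%C.
  split.
  - intros t. apply cder_minus.
    + apply cder_scal, cder_conj, D1.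
    + apply (cder_mult (fun t => / 4 * p t)%C (fun t => Cconj (phi t))); [|apply cder_conj, D0].
      apply cder_scal. apply cder_mult; [apply D0|apply cder_conj, D0].
  - apply bounded_of_support with M; auto.
    + intros t. pose proof (adm_phi _ _ _ _ Ha t) as Q0. pose proof (adm_phi1 _ _ _ _ Ha t) as Q1.
      unfold p, p1. ccont_auto;
        [exact (C2 t)|exact Q1|exact Q0|exact Q0|exact Q1|exact Q0|exact Q0|exact Q0|exact Q1].
    + intros t Ht. destruct (Z t Ht) as (E0 & E1 & E2). unfold p, p1. rewrite E0, E1, E2.
      apply C_eq_parts; simpl; field.
Qed.

(* Large [l]: with [z = u2 + rpot * u1 / (2 i l)] the equation for [z] has a forcing of
   size [1 / |l|] instead of the term [rpot * u1]. *)
Lemma akns_at_infinity :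
  exists K, forall l u1 u2, l <> RtoC 0 -> Im l <= 0 ->
  akns phi phi1 M l (RtoC 1) (RtoC 0) u1 u2 ->
  Cmod (u1 (- M - 1) - 1) <= K / Cmod l.
Proof.
  destruct rpot_derivative as (r1 & Dr & N1 & HN1 & Br1).
  assert (HM : 0 <= M) by apply Ha.
  destruct (bounded_of_support phi M HM (adm_phi _ _ _ _ Ha)) as (N2 & HN2 & Bp).
  { intros t Ht. apply (adm_out _ _ _ _ Ha t Ht). }
  destruct (bounded_of_support (rpot phi phi1) M HM (adm_rpot _ _ _ _ Ha)) as (N3 & HN3 & Br).
  { intros t Ht. apply (adm_out _ _ _ _ Ha t Ht). }
  set (e := exp (kap s)). assert (He : 0 < e) by apply exp_pos.
  (* [N1 + N2 * N3] bounds the coefficients of both forcing terms; the factor 3 bounds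
     [x1 ^ 2 + (x1 + x2) ^ 2] by a multiple of the energy, with room to spare. *)
  set (N := (N1 + N2 * N3) ^ 2 * 3).
  set (A := exp (kap s + (2 * M + 2)) * ((2 * M + 2) * (N * e))).
  assert (HN23 : 0 <= N2 * N3) by (apply Rmult_le_pos; assumption).
  assert (HN : 0 <= N) by (unfold N; pose proof (pow2_ge_0 (N1 + N2 * N3)); lra).
  assert (HA : 0 <= A).
  { unfold A. pose proof (exp_pos (kap s + (2 * M + 2))).
    apply Rmult_le_pos; [lra|]. apply Rmult_le_pos; [lra|]. apply Rmult_le_pos; lra. }
  exists (A + 1). intros l u1 u2 Hl0 Hl Au.
  pose proof (akns_bound _ _ _ _ Ha _ _ _ _ _ _ Hw Hl Au (akns_unit_norm _ _ _ _ _ _ Au)) as Bu.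
  fold e in Bu.
  destruct (akns_unit_data _ _ _ _ _ _ Au (M + 1) ltac:(lra)) as [Iu1 Iu2].
  destruct Au as (Du1 & Du2 & _).
  assert (Hlp : 0 < Cmod l) by (apply Cmod_gt_0; exact Hl0).
  set (k := (/ (2 * Ci * l))%C).
  assert (Hci : (2 * Ci)%C <> RtoC 0).
  { intros E. pose proof Cmod_two_Ci as Q. rewrite E, Cmod_0 in Q. lra. }
  assert (H2 : (2 * Ci * l)%C <> RtoC 0) by (apply Cmult_neq_0; assumption).
  assert (Hk : Cmod k = / (2 * Cmod l)).
  { unfold k. rewrite Cmod_inv by exact H2. rewrite Cmod_mult, Cmod_two_Ci. reflexivity. }
  assert (Hkl : (2 * Ci * l * k = 1)%C) by (unfold k; field; split; [exact Hl0|]; intros E;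
    injection E; lra).
  apply pow2_le_inv; [apply Rdiv_le_0_compat; lra|].
  eapply Rle_trans.
  - apply (akns_crude phi (fun _ => RtoC 0) (fun t => u1 t - 1)%C
      (fun t => u2 t + k * (rpot phi phi1 t * u1 t))%C
      (fun t => - (phi t * (k * (rpot phi phi1 t * u1 t))))%C
      (fun t => k * (r1 t * u1 t + rpot phi phi1 t * (phi t * u2 t)))%C l (N * e / Cmod l ^ 2)).
    + apply (adm_phi _ _ _ _ Ha).
    + intros; apply ccont_const.
    + intros t. rewrite Cmod_0. pose proof (Cmod_ge_0 (rpot phi phi1 t)). lra.
    + exact Hl.
    + intros x. eapply cder_eq; [apply cder_minus; [apply Du1|apply cder_const]|ring].
    + intros x. eapply cder_eq; [apply cder_plus; [apply Du2|apply cder_scal, cder_mult; [apply Dr|apply Du1]]|].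
      transitivity (2 * Ci * l * u2 x + 1 * (rpot phi phi1 x * u1 x)
        + k * (r1 x * u1 x + rpot phi phi1 x * (phi x * u2 x)))%C; [ring|].
      rewrite <- Hkl. ring.
    + rewrite Iu1. ring.
    + destruct (adm_out _ _ _ _ Ha (M + 1)) as [_ E]; [rewrite Rabs_pos_eq; lra|].
      rewrite Iu2, E. ring.
    + intros t. rewrite Cmod_opp.
      assert (F1 : Cmod (phi t * (k * (rpot phi phi1 t * u1 t))) <= / (2 * Cmod l) * ((N1 + N2 * N3) * Cmod (u1 t))).
      { rewrite !Cmod_mult, Hk.
        replace (Cmod (phi t) * (/ (2 * Cmod l) * (Cmod (rpot phi phi1 t) * Cmod (u1 t))))
          with (/ (2 * Cmod l) * (Cmod (phi t) * Cmod (rpot phi phi1 t) * Cmod (u1 t))) by ring.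
        apply Rmult_le_compat_l; [left; apply Rinv_0_lt_compat; lra|].
        apply Rmult_le_compat_r; [apply Cmod_ge_0|].
        pose proof (Rmult_le_compat _ _ _ _ (Cmod_ge_0 _) (Cmod_ge_0 _) (Bp t) (Br t)). lra. }
      assert (F2 : Cmod (k * (r1 t * u1 t + rpot phi phi1 t * (phi t * u2 t))) <=
         / (2 * Cmod l) * ((N1 + N2 * N3) * (Cmod (u1 t) + Cmod (u2 t)))).
      { rewrite (Cmod_mult k), Hk.
        apply Rmult_le_compat_l; [left; apply Rinv_0_lt_compat; lra|].
        eapply Rle_trans; [apply Cmod_triangle|]. rewrite !Cmod_mult.
        pose proof (Rmult_le_compat _ _ _ _ (Cmod_ge_0 _) (Cmod_ge_0 _) (Bp t) (Br t)) as Q.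
        pose proof (Rmult_le_compat_r _ _ _ (Cmod_ge_0 (u2 t)) Q) as Q2.
        pose proof (Rmult_le_compat_r _ _ _ (Cmod_ge_0 (u1 t)) (Br1 t)) as Q3.
        pose proof (Cmod_ge_0 (u1 t)). pose proof (Cmod_ge_0 (u2 t)).
        assert (0 <= N2 * N3 * Cmod (u1 t)) by (apply Rmult_le_pos; assumption).
        assert (0 <= N1 * Cmod (u2 t)) by (apply Rmult_le_pos; assumption). lra. }
      specialize (Bu t).
      set (n := N1 + N2 * N3) in *. assert (Hn : 0 <= n) by (unfold n; lra).
      set (x1 := Cmod (u1 t)) in *. set (x2 := Cmod (u2 t)) in *.
      assert (P1 : 0 <= x1) by apply Cmod_ge_0. assert (P2 : 0 <= x2) by apply Cmod_ge_0.
      pose proof (pow_incr _ _ 2 (conj (Cmod_ge_0 _) F1)) as G1.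
      pose proof (pow_incr _ _ 2 (conj (Cmod_ge_0 _) F2)) as G2.
      eapply Rle_trans; [apply Rplus_le_compat; [exact G1|exact G2]|].
      replace ((/ (2 * Cmod l) * (n * x1)) ^ 2 + (/ (2 * Cmod l) * (n * (x1 + x2))) ^ 2)
        with ((n ^ 2 * / 4 * (x1 ^ 2 + (x1 + x2) ^ 2)) / Cmod l ^ 2) by (field; lra).
      unfold Rdiv. apply Rmult_le_compat_r; [left; apply Rinv_0_lt_compat, pow_lt, Hlp|].
      unfold N. fold n. pose proof (pow2_ge_0 n).
      assert (/ 4 * (x1 ^ 2 + (x1 + x2) ^ 2) <= 3 * e).
      { pose proof (Rle_0_sqr (x1 - x2)) as Q. unfold Rsqr in Q. nra. }
      nra.
  - replace (exp (kap s + (2 * M + 2)) * ((2 * M + 2) * (N * e / Cmod l ^ 2)))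
      with (A / Cmod l ^ 2) by (unfold A; field; lra).
    replace (((A + 1) / Cmod l) ^ 2) with ((A + 1) ^ 2 / Cmod l ^ 2) by (field; lra).
    unfold Rdiv. apply Rmult_le_compat_r; [left; apply Rinv_0_lt_compat, pow_lt, Hlp|]. nra.
Qed.
End FixedPotential.

(** * The coefficient alpha as a uniform limit *)

(** Solutions are known only to exist, hence the choice operator. At [- M - 1] the first component
    has reached its constant value on the left. *)
Definition test_alpha (phi phi1 : R -> C) (M : R) (l : C) : C :=
  fst (epsilon (inhabits (fun _ : R => RtoC 0, fun _ : R => RtoC 0))
     (fun u => akns phi phi1 M l (RtoC 1) (RtoC 0) (fst u) (snd u))) (- M - 1).

Section TestAlpha.
Variables (phi phi1 phi2 : R -> C) (M s : R).
Hypothesis Ha : admissible phi phi1 phi2 M.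

Lemma test_alpha_spec l : exists u1 u2, akns phi phi1 M l (RtoC 1) (RtoC 0) u1 u2 /\
  (forall t, t < - M -> u1 t = test_alpha phi phi1 M l).
Proof.
  unfold test_alpha.
  set (P := fun u : (R -> C) * (R -> C) => akns phi phi1 M l (RtoC 1) (RtoC 0) (fst u) (snd u)).
  assert (H : P (epsilon (inhabits (fun _ : R => RtoC 0, fun _ : R => RtoC 0)) P)).
  { apply epsilon_spec. destruct (akns_exists _ _ _ _ Ha l (RtoC 1) (RtoC 0)) as (u1 & u2 & Hu).
    exists (u1, u2). exact Hu. }
  set (u := epsilon (inhabits (fun _ : R => RtoC 0, fun _ : R => RtoC 0)) P) in *.
  exists (fst u), (snd u). split; [exact H|].
  destruct (akns_left _ _ _ _ Ha _ _ _ _ _ H) as (a1 & a2 & L).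
  intros t Ht. rewrite (proj1 (L t Ht)), (proj1 (L (- M - 1) ltac:(lra))). reflexivity.
Qed.

Hypothesis Hw : w11_le phi phi1 s.

Lemma test_alpha_second_difference eta l h k : 0 < eta ->
  Im l <= - eta -> Im (l + h)%C <= - eta -> Im (l + k)%C <= - eta ->
  let A := test_alpha phi phi1 M in
  Cmod (k * (A (l + h)%C - A l) - h * (A (l + k)%C - A l)) <=
    exp (2 * kap s) / eta ^ 2 * (Cmod h * Cmod k * Cmod (h - k)).
Proof.
  intros He Hl Hh Hk A.
  destruct (test_alpha_spec l) as (u1 & u2 & Au & Lu).
  destruct (test_alpha_spec (l + h)%C) as (v1 & v2 & Av & Lv).
  destruct (test_alpha_spec (l + k)%C) as (w1 & w2 & Aw & Lw).
  unfold A. assert (HM : - M - 1 < - M) by lra.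
  rewrite <- (Lu (- M - 1) HM), <- (Lv (- M - 1) HM), <- (Lw (- M - 1) HM).
  exact (akns_second_difference _ _ _ _ Ha s eta l h k u1 u2 v1 v2 w1 w2 Hw He Hl Hh Hk Au Av Aw (- M - 1)).
Qed.

Lemma test_alpha_lipschitz : exists K, forall l m, Im l <= 0 -> Im m <= 0 ->
  Cmod (test_alpha phi phi1 M l - test_alpha phi phi1 M m) <= K * Cmod (l - m).
Proof.
  destruct (akns_spectral_lipschitz _ _ _ _ s Ha Hw) as [K HK]. exists K.
  intros l m Hl Hm.
  destruct (test_alpha_spec l) as (u1 & u2 & Au & Lu).
  destruct (test_alpha_spec m) as (v1 & v2 & Av & Lv).
  assert (HM : - M - 1 < - M) by lra.
  rewrite <- (Lu (- M - 1) HM), <- (Lv (- M - 1) HM).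
  exact (HK l m u1 u2 v1 v2 Hl Hm Au Av).
Qed.

Lemma test_alpha_at_infinity : exists K, forall l, l <> RtoC 0 -> Im l <= 0 ->
  Cmod (test_alpha phi phi1 M l - 1) <= K / Cmod l.
Proof.
  destruct (akns_at_infinity _ _ _ _ s Ha Hw) as [K HK]. exists K.
  intros l Hl0 Hl. destruct (test_alpha_spec l) as (u1 & u2 & Au & Lu).
  rewrite <- (Lu (- M - 1) ltac:(lra)). exact (HK l u1 u2 Hl0 Hl Au).
Qed.
End TestAlpha.

Definition lip_const (s : R) : R := exp (kap s + 1) * (1 + s ^ 2).

Lemma lip_const_pos s : 0 < lip_const s.
Proof.
  unfold lip_const. pose proof (exp_pos (kap s + 1)). pose proof (pow2_ge_0 s).
  apply Rmult_lt_0_compat; lra.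
Qed.

Lemma test_alpha_potential phi phi1 phi2 M psi psi1 psi2 M' R0 s l :
  admissible phi phi1 phi2 M -> admissible psi psi1 psi2 M' ->
  w11_le phi phi1 R0 -> w11_le psi psi1 R0 -> 0 < s ->
  w11_le (fun t => phi t - psi t)%C (fun t => phi1 t - psi1 t)%C s -> Im l <= 0 ->
  Cmod (test_alpha phi phi1 M l - test_alpha psi psi1 M' l) <= lip_const R0 * s.
Proof.
  intros Ha Ha' Hw Hw' Hs Hd Hl.
  destruct (test_alpha_spec _ _ _ _ Ha l) as (u1 & u2 & Au & Lu).
  destruct (test_alpha_spec _ _ _ _ Ha' l) as (v1 & v2 & Av & Lv).
  (* The two coefficients are read off at a common point left of both supports. *)
  pose proof (Rmin_l (- M) (- M')). pose proof (Rmin_r (- M) (- M')).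
  rewrite <- (Lu (Rmin (- M) (- M') - 1) ltac:(lra)), <- (Lv (Rmin (- M) (- M') - 1) ltac:(lra)).
  apply (akns_potential_lipschitz _ _ _ _ _ _ _ _ R0 s l _ _ _ _ _ _ Ha Ha' Hw Hw' Hs Hd Hl Au Av).
  exact (akns_unit_norm _ _ _ _ _ _ Av).
Qed.

(** All that is retained of membership in the completion: a bounded W^{1,1} Cauchy sequence with
    pointwise limit [q]. The support radii [Mn] may grow without bound. *)
Definition approximates (q : R -> C) (f f1 f2 : nat -> R -> C) (Mn : nat -> R) (R0 : R) : Prop :=
  (forall n, admissible (f n) (f1 n) (f2 n) (Mn n)) /\
  (forall n, w11_le (f n) (f1 n) R0) /\
  (forall eps, 0 < eps -> exists N : nat, forall n m, (N <= n)%nat -> (N <= m)%nat ->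
     w11_le (fun t => f n t - f m t)%C (fun t => f1 n t - f1 m t)%C eps) /\
  (forall x, ccv (fun n => f n x) (q x)).

Definition lower (l : C) : Prop := Im l <= 0.

Section UniformConvergence.
Context {I : Type} (P : I -> Prop).

Lemma ucv_plus (u v : nat -> I -> C) f g :
  ucv P u f -> ucv P v g -> ucv P (fun n i => u n i + v n i)%C (fun i => f i + g i)%C.
Proof.
  intros H1 H2 eps He.
  destruct (H1 (eps / 2)) as [N1 K1]; [lra|]. destruct (H2 (eps / 2)) as [N2 K2]; [lra|].
  exists (max N1 N2). intros n i Hn Pi.
  specialize (K1 n i ltac:(lia) Pi). specialize (K2 n i ltac:(lia) Pi).
  replace (u n i + v n i - (f i + g i))%C with ((u n i - f i) + (v n i - g i))%C by ring.
  eapply Rle_lt_trans; [apply Cmod_triangle|lra].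
Qed.

Lemma ucv_mult (u v : nat -> I -> C) f g K : 0 <= K ->
  (forall i, P i -> Cmod (f i) <= K) -> (forall i, P i -> Cmod (g i) <= K) ->
  ucv P u f -> ucv P v g -> ucv P (fun n i => u n i * v n i)%C (fun i => f i * g i)%C.
Proof.
  intros HK Bf Bg H1 H2 eps He.
  set (k := K + 1). assert (0 < k) by (unfold k; lra).
  assert (He2 : 0 < eps / (2 * k)) by (apply Rdiv_lt_0_compat; lra).
  destruct (H1 _ He2) as [N1 K1]. destruct (H2 _ He2) as [N2 K2]. destruct (H1 1 Rlt_0_1) as [N0 K0].
  exists (max N0 (max N1 N2)). intros n i Hn Pi.
  specialize (K0 n i ltac:(lia) Pi). specialize (K1 n i ltac:(lia) Pi). specialize (K2 n i ltac:(lia) Pi).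
  specialize (Bf i Pi). specialize (Bg i Pi).
  replace (u n i * v n i - f i * g i)%C with (u n i * (v n i - g i) + (u n i - f i) * g i)%C by ring.
  eapply Rle_lt_trans; [apply Cmod_triangle|]. rewrite !Cmod_mult.
  pose proof (Cmod_reverse_triangle (u n i) (f i)).
  assert (E : eps = k * (eps / (2 * k)) + k * (eps / (2 * k))) by (field; lra).
  set (e := eps / (2 * k)) in *.
  pose proof (Cmod_ge_0 (v n i - g i)). pose proof (Cmod_ge_0 (u n i - f i)).
  pose proof (Cmod_ge_0 (u n i)). pose proof (Cmod_ge_0 (g i)). unfold k in *. nra.
Qed.

Lemma ucv_scal (c : C) (u : nat -> I -> C) f :
  ucv P u f -> ucv P (fun n i => c * u n i)%C (fun i => c * f i)%C.
Proof.
  intros H eps He. pose proof (Cmod_ge_0 c).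
  destruct (H (eps / (Cmod c + 1))) as [N K]; [apply Rdiv_lt_0_compat; lra|].
  exists N. intros n i Hn Pi. specialize (K n i Hn Pi).
  replace (c * u n i - c * f i)%C with (c * (u n i - f i))%C by ring. rewrite Cmod_mult.
  apply Rlt_div_r in K; [|lra]. pose proof (Cmod_ge_0 (u n i - f i)). nra.
Qed.

Lemma ucv_minus (u v : nat -> I -> C) f g :
  ucv P u f -> ucv P v g -> ucv P (fun n i => u n i - v n i)%C (fun i => f i - g i)%C.
Proof.
  intros H1 H2 eps He. destruct (ucv_plus _ _ _ _ H1 (ucv_scal (- (1))%C _ _ H2) eps He) as [N HN].
  exists N. intros n i Hn Pi. specialize (HN n i Hn Pi).
  replace (u n i - v n i - (f i - g i))%C with
    (u n i + - (1) * v n i - (f i + - (1) * g i))%C by ring. exact HN.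
Qed.

Lemma ucv_conj (u : nat -> I -> C) f :
  ucv P u f -> ucv P (fun n i => Cconj (u n i)) (fun i => Cconj (f i)).
Proof.
  intros H eps He. destruct (H eps He) as [N K]. exists N. intros n i Hn Pi.
  rewrite <- Cminus_conj, Cmod_conj. auto.
Qed.

Lemma ucv_subset (Q : I -> Prop) (u : nat -> I -> C) f :
  (forall i, Q i -> P i) -> ucv P u f -> ucv Q u f.
Proof. intros S H eps He. destruct (H eps He) as [N K]. exists N. auto. Qed.

Lemma ucv_bound (u : nat -> I -> C) f B :
  (forall n i, P i -> Cmod (u n i) <= B) -> ucv P u f -> forall i, P i -> Cmod (f i) <= B.
Proof.
  intros Hu H i Pi. replace (f i) with (f i - 0)%C by ring.
  apply (ccv_Cmod_le _ _ _ _ (ucv_ccv P u f i H Pi)). exists 0%nat. intros n _.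
  replace (u n i - 0)%C with (u n i) by ring. apply Hu, Pi.
Qed.
End UniformConvergence.

(** An exchange of limits. Each term is eventually constant along [F], because test functions have
    compact support, and uniform convergence makes these constants a Cauchy sequence. *)
Lemma ucv_flim (F : (R -> Prop) -> Prop) {FF : ProperFilter F}
  (u : nat -> R -> C) (f : R -> C) (a : nat -> C) :
  ucv (fun _ => True) u f -> (forall n, F (fun t => u n t = a n)) ->
  exists l, ccv a l /\ flim F f l.
Proof.
  intros H Ha.
  destruct (ccv_exists a) as [l Hl].
  { intros eps He. destruct (H (eps / 2)) as [N HN]; [lra|]. exists N. intros n m Hn Hm.
    destruct (filter_ex _ (filter_and _ _ (Ha n) (Ha m))) as [t [E1 E2]].
    rewrite <- E1, <- E2. eapply Rle_lt_trans; [apply (Cmod_sub_triangle _ (f t))|].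
    rewrite (Cmod_sub_sym (f t)).
    pose proof (HN n t Hn Logic.I). pose proof (HN m t Hm Logic.I). lra. }
  exists l. split; [exact Hl|]. intros eps He.
  destruct (H (eps / 2)) as [N1 H1]; [lra|]. destruct (Hl (eps / 2)) as [N2 H2]; [lra|].
  set (n := max N1 N2). generalize (Ha n). apply filter_imp. intros t Et.
  eapply Rle_lt_trans; [apply (Cmod_sub_triangle_l _ (u n t))|].
  pose proof (H1 n t ltac:(lia) Logic.I).
  pose proof (H2 n ltac:(lia)) as Q. rewrite <- Et in Q. lra.
Qed.

Lemma ccv_constant_unique (a : nat -> C) l m : ccv a l -> (forall n, a n = m) -> l = m.
Proof.
  intros H E. apply (ccv_unique _ _ _ H). apply (flim_ext eventually (fun _ => m)); auto.
  apply flim_const; filter_tc.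
Qed.

Section Approximation.
Variables (q : R -> C) (f f1 f2 : nat -> R -> C) (Mn : nat -> R) (R0 : R).
Hypothesis Hap : approximates q f f1 f2 Mn R0.

Let Had n : admissible (f n) (f1 n) (f2 n) (Mn n) := proj1 Hap n.
Let Hw n : w11_le (f n) (f1 n) R0 := proj1 (proj2 Hap) n.

Definition alphas (n : nat) : C -> C := test_alpha (f n) (f1 n) (Mn n).

Lemma alphas_cauchy : forall eps, 0 < eps -> exists N : nat, forall n m l,
  (N <= n)%nat -> (N <= m)%nat -> lower l -> Cmod (alphas n l - alphas m l) < eps.
Proof.
  intros eps He. pose proof (lip_const_pos R0) as Hp.
  assert (He2 : 0 < eps / (2 * lip_const R0)) by (apply Rdiv_lt_0_compat; lra).
  destruct (proj1 (proj2 (proj2 Hap)) _ He2) as [N HN]. exists N. intros n m l Hn Hm Hl.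
  eapply Rle_lt_trans.
  - exact (test_alpha_potential _ _ _ _ _ _ _ _ R0 _ l (Had n) (Had m) (Hw n) (Hw m) He2 (HN n m Hn Hm) Hl).
  - replace (lip_const R0 * (eps / (2 * lip_const R0))) with (eps / 2) by (field; lra). lra.
Qed.

Lemma potentials_ucv : ucv (fun _ => True) f q.
Proof.
  intros eps He. assert (He2 : 0 < eps / 2) by lra.
  destruct (proj1 (proj2 (proj2 Hap)) _ He2) as [N HN]. exists N. intros n t Hn _.
  rewrite Cmod_sub_sym. apply Rle_lt_trans with (eps / 2); [|lra].
  apply (ccv_Cmod_le _ _ _ _ (proj2 (proj2 (proj2 Hap)) t)). exists N. intros m Hm.
  exact (adm_sup _ _ _ _ (admissible_minus _ _ _ _ _ _ _ _ (Had m) (Had n)) _ t (HN m n Hm Hn)).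
Qed.

Lemma potential_bound t : Cmod (q t) <= R0.
Proof.
  apply (ucv_bound (fun _ => True) f q); auto; [|apply potentials_ucv].
  intros n x _. apply (adm_sup _ _ _ _ (Had n) _ x (Hw n)).
Qed.

Lemma plus_infinity_support n : Rbar_locally p_infty (fun t => f n t = RtoC 0).
Proof.
  exists (Mn n). intros t Ht. apply (adm_out _ _ _ _ (Had n)).
  eapply Rlt_le_trans; [exact Ht|apply Rle_abs].
Qed.

Lemma minus_infinity_support n : Rbar_locally m_infty (fun t => f n t = RtoC 0).
Proof.
  exists (- Mn n). intros t Ht. apply (adm_out _ _ _ _ (Had n)).
  rewrite <- Rabs_Ropp. eapply Rlt_le_trans; [|apply Rle_abs]. lra.
Qed.

Lemma potential_decay (b : Rbar) : b = p_infty \/ b = m_infty -> flim (Rbar_locally b) q (RtoC 0).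
Proof.
  intros [-> | ->].
  - destruct (ucv_flim (Rbar_locally p_infty) f q (fun _ => RtoC 0) potentials_ucv
      plus_infinity_support) as (l & H1 & H2).
    rewrite (ccv_constant_unique _ _ _ H1 (fun _ => eq_refl)) in H2. exact H2.
  - destruct (ucv_flim (Rbar_locally m_infty) f q (fun _ => RtoC 0) potentials_ucv
      minus_infinity_support) as (l & H1 & H2).
    rewrite (ccv_constant_unique _ _ _ H1 (fun _ => eq_refl)) in H2. exact H2.
Qed.

Section Limit.
Variable A : C -> C.
Hypothesis HA : ucv lower alphas A.

(** The Lipschitz constant in [l] depends on the support of the approximant and does not pass to the
    limit; continuity is transferred through one fixed index by uniform convergence. *)
Lemma limit_alpha_continuous l : lower l -> forall eps, 0 < eps -> exists d, 0 < d /\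
  forall m, lower m -> Cmod (m - l) < d -> Cmod (A m - A l) < eps.
Proof.
  intros Hl eps He. destruct (HA (eps / 3)) as [N HN]; [lra|].
  destruct (test_alpha_lipschitz _ _ _ _ _ (Had N) (Hw N)) as [K HK].
  pose proof (Rabs_pos K) as HKp. pose proof (Rle_abs K) as HKa.
  exists (eps / 3 / (Rabs K + 1)). split; [apply Rdiv_lt_0_compat; lra|].
  intros m Hm Hd. apply Rlt_div_r in Hd; [|lra].
  pose proof (HN N m (Nat.le_refl N) Hm) as Q1. pose proof (HN N l (Nat.le_refl N) Hl) as Q2.
  pose proof (HK m l Hm Hl) as Q3. fold (alphas N) in Q3. pose proof (Cmod_ge_0 (m - l)).
  pose proof (Cmod_sub_triangle_l (A m) (alphas N m) (A l)).
  pose proof (Cmod_sub_triangle (alphas N m) (alphas N l) (A l)). nra.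
Qed.

Lemma limit_alpha_second_difference eta l h k : 0 < eta ->
  Im l <= - eta -> Im (l + h)%C <= - eta -> Im (l + k)%C <= - eta ->
  Cmod (k * (A (l + h)%C - A l) - h * (A (l + k)%C - A l)) <=
    exp (2 * kap R0) / eta ^ 2 * (Cmod h * Cmod k * Cmod (h - k)).
Proof.
  intros He Hl Hh Hk.
  assert (L : forall z, Im z <= - eta -> ccv (fun n => alphas n z) (A z)).
  { intros z Hz. apply (ucv_ccv lower alphas A z HA). unfold lower; lra. }
  replace (k * (A (l + h)%C - A l) - h * (A (l + k)%C - A l))%C with
    (k * (A (l + h)%C - A l) - h * (A (l + k)%C - A l) - 0)%C by ring.
  apply (ccv_Cmod_le (fun n => k * (alphas n (l + h)%C - alphas n l) - h * (alphas n (l + k)%C - alphas n l))%C).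
  - apply flim_minus; filter_tc; apply flim_scal; filter_tc;
      apply flim_minus; filter_tc; apply L; assumption.
  - exists 0%nat. intros n _.
    replace (k * (alphas n (l + h)%C - alphas n l) - h * (alphas n (l + k)%C - alphas n l) - 0)%C with
     (k * (alphas n (l + h)%C - alphas n l) - h * (alphas n (l + k)%C - alphas n l))%C by ring.
    exact (test_alpha_second_difference _ _ _ _ _ (Had n) (Hw n) eta l h k He Hl Hh Hk).
Qed.

Lemma limit_alpha_at_infinity : forall eps, 0 < eps -> exists B, 0 < B /\
  forall l, lower l -> B <= Cmod l -> Cmod (A l - 1) < eps.
Proof.
  intros eps He. destruct (HA (eps / 2)) as [N HN]; [lra|].
  destruct (test_alpha_at_infinity _ _ _ _ _ (Had N) (Hw N)) as [K HK].
  pose proof (Rabs_pos K) as HKp. pose proof (Rle_abs K) as HKa.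
  exists ((Rabs K + 1) / (eps / 2)). assert (HB : 0 < (Rabs K + 1) / (eps / 2)) by (apply Rdiv_lt_0_compat; lra).
  split; [exact HB|]. intros l Hl Hd.
  assert (Hlp : 0 < Cmod l) by lra.
  assert (Hl0 : l <> RtoC 0) by (apply Cmod_gt_0; exact Hlp).
  pose proof (HK l Hl0 Hl) as Q. fold (alphas N) in Q.
  assert (Q2 : K / Cmod l < eps / 2).
  { apply Rlt_div_l; [lra|]. apply Rle_div_l in Hd; [|lra]. lra. }
  pose proof (HN N l (Nat.le_refl N) Hl) as Q3.
  pose proof (Cmod_sub_triangle_l (A l) (alphas N l) 1). lra.
Qed.
End Limit.
End Approximation.

(** * Jost solutions *)

Lemma entry_mult (A B : matrix 2 2) i j : (i < 2)%nat -> (j < 2)%nat ->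
  entry (mat_mult A B) i j = (entry A i 0 * entry B 0 j + entry A i 1 * entry B 1 j)%C.
Proof.
  intros Hi Hj. unfold entry, mat_mult, Mmult.
  change (RtoC 0) with (zero (G := C_Ring)).
  rewrite coeff_mat_bij by assumption. change (Nat.pred 2) with 1%nat. rewrite sum_Sn, sum_O. reflexivity.
Qed.
Lemma entry_mat2 a b c d : entry (mat2 a b c d) 0 0 = a /\ entry (mat2 a b c d) 0 1 = b /\
  entry (mat2 a b c d) 1 0 = c /\ entry (mat2 a b c d) 1 1 = d.
Proof. repeat split. Qed.
Ltac entry_simpl := repeat match goal with
  | |- context [entry (mat2 ?a ?b ?c ?d) 0 0] => change (entry (mat2 a b c d) 0 0) with a
  | |- context [entry (mat2 ?a ?b ?c ?d) 0 1] => change (entry (mat2 a b c d) 0 1) with b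
  | |- context [entry (mat2 ?a ?b ?c ?d) 1 0] => change (entry (mat2 a b c d) 1 0) with c
  | |- context [entry (mat2 ?a ?b ?c ?d) 1 1] => change (entry (mat2 a b c d) 1 1) with d
  end.

Lemma entry_id : entry mat_id 0 0 = RtoC 1 /\ entry mat_id 0 1 = RtoC 0 /\
  entry mat_id 1 0 = RtoC 0 /\ entry mat_id 1 1 = RtoC 1.
Proof. repeat split. Qed.
Lemma mat_ext (A B : matrix 2 2) :
  (forall i j, (i < 2)%nat -> (j < 2)%nat -> entry A i j = entry B i j) -> A = B.
Proof. intros H. apply (coeff_mat_ext_aux (RtoC 0) (RtoC 0)). intros. apply H; assumption. Qed.
(** The uniform structure on [C] used by [locally] has squares as balls, so discs and squares are
    compared in both directions. *)
Lemma flim_filterlim {T} (F : (T -> Prop) -> Prop) {FF : Filter F} (f : T -> C) (l : C) :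
  flim F f l <-> filterlim f F (locally l).
Proof.
  split.
  - intros H P [e He]. unfold filtermap. generalize (H e (cond_pos e)). apply filter_imp.
    intros x Hx. apply He. split; (eapply Rle_lt_trans; [|exact Hx]).
    + apply (re_le_Cmod (f x - l)%C).
    + apply (im_le_Cmod (f x - l)%C).
  - intros H e He.
    assert (He2 : 0 < e / 2) by lra.
    assert (L : locally l (fun y => ball l (mkposreal _ He2) y)) by (exists (mkposreal _ He2); auto).
    generalize (H _ L). unfold filtermap. apply filter_imp. intros x [H1 H2].
    eapply Rle_lt_trans; [apply Cmod_le_abs|].
    assert (K1 : Rabs (Re (f x - l)%C) < e / 2) by exact H1.
    assert (K2 : Rabs (Im (f x - l)%C) < e / 2) by exact H2. lra.
Qed.
Lemma exp_i_sigma3_cexp l x : exp_i_sigma3 (l * x) =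
  mat2 (cexp (Ci * RtoC l)%C x) (RtoC 0) (RtoC 0) (cexp (- (Ci * RtoC l))%C x).
Proof.
  unfold exp_i_sigma3, cexp. f_equal; simpl.
  - replace ((0 * l - 1 * 0) * x) with 0 by ring. rewrite exp_0.
    replace ((0 * 0 + 1 * l) * x) with (l * x) by ring. f_equal; ring.
  - replace (- (0 * l - 1 * 0) * x) with 0 by ring. rewrite exp_0.
    replace (- (0 * 0 + 1 * l) * x) with (- (l * x)) by ring. f_equal; ring.
Qed.
Lemma cexp_add mu nu x : cexp (mu + nu) x = (cexp mu x * cexp nu x)%C.
Proof.
  destruct mu as [a b], nu as [c d]. unfold cexp; simpl.
  replace ((a + c) * x) with (a * x + c * x) by ring.
  replace ((b + d) * x) with (b * x + d * x) by ring.
  rewrite exp_plus, cos_plus, sin_plus. apply C_eq_parts; simpl; ring.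
Qed.

Lemma index2_cases (P : nat -> nat -> Prop) :
  P 0%nat 0%nat -> P 0%nat 1%nat -> P 1%nat 0%nat -> P 1%nat 1%nat ->
  forall i j, (i < 2)%nat -> (j < 2)%nat -> P i j.
Proof.
  intros. destruct i as [|[|i]]; [| |lia]; destruct j as [|[|j]]; try lia; assumption.
Qed.

Definition lax_column (q : R -> C) (l : R) (g1 g2 : R -> C) : Prop :=
  forall x,
  cder g1 x ((- Ci * RtoC l + Ci / 2 * RtoC (Cmod (q x) ^ 2)) * g1 x + q x * g2 x)%C /\
  cder g2 x (- RtoC l * Cconj (q x) * g1 x + (Ci * RtoC l - Ci / 2 * RtoC (Cmod (q x) ^ 2)) * g2 x)%C.

(** The system acts on columns separately, and the normalizing factor is diagonal: it multiplies the
    first column by [e] and the second by [e']. *)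
Lemma is_Jost_columns b q l (Psi : R -> matrix 2 2) :
  let g i j := fun x => entry (Psi x) i j in
  let e := cexp (Ci * RtoC l) in
  let e' := cexp (- (Ci * RtoC l)) in
  is_Jost_solution b q l Psi <->
  (lax_column q l (g 0%nat 0%nat) (g 1%nat 0%nat) /\ lax_column q l (g 0%nat 1%nat) (g 1%nat 1%nat)) /\
  (flim (Rbar_locally b) (fun x => g 0%nat 0%nat x * e x)%C (RtoC 1) /\
   flim (Rbar_locally b) (fun x => g 0%nat 1%nat x * e' x)%C (RtoC 0) /\
   flim (Rbar_locally b) (fun x => g 1%nat 0%nat x * e x)%C (RtoC 0) /\
   flim (Rbar_locally b) (fun x => g 1%nat 1%nat x * e' x)%C (RtoC 1)).
Proof.
  intros g e e'.
  assert (E : forall x i, (i < 2)%nat ->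
    entry (mat_mult (Psi x) (exp_i_sigma3 (l * x))) i 0 = (g i 0%nat x * e x)%C /\
    entry (mat_mult (Psi x) (exp_i_sigma3 (l * x))) i 1 = (g i 1%nat x * e' x)%C).
  { intros x i Hi. rewrite !entry_mult by lia. rewrite exp_i_sigma3_cexp.
    destruct (entry_mat2 (cexp (Ci * RtoC l)%C x) (RtoC 0) (RtoC 0) (cexp (- (Ci * RtoC l))%C x))
      as (-> & -> & -> & ->). unfold g, e, e'. split; ring. }
  assert (L : forall x j, (j < 2)%nat ->
    entry (mat_mult (lax_matrix (q x) (RtoC l)) (Psi x)) 0 j =
      ((- Ci * RtoC l + Ci / 2 * RtoC (Cmod (q x) ^ 2)) * g 0%nat j x + q x * g 1%nat j x)%C /\
    entry (mat_mult (lax_matrix (q x) (RtoC l)) (Psi x)) 1 j =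
      (- RtoC l * Cconj (q x) * g 0%nat j x + (Ci * RtoC l - Ci / 2 * RtoC (Cmod (q x) ^ 2)) * g 1%nat j x)%C).
  { intros x j Hj. rewrite !entry_mult by lia. split; reflexivity. }
  destruct entry_id as (I1 & I2 & I3 & I4).
  split.
  - intros [D T]. split; [split|].
    + intros x. split; apply cder_is_derive.
      * rewrite <- (proj1 (L x 0%nat ltac:(lia))). apply D; lia.
      * rewrite <- (proj2 (L x 0%nat ltac:(lia))). apply D; lia.
    + intros x. split; apply cder_is_derive.
      * rewrite <- (proj1 (L x 1%nat ltac:(lia))). apply D; lia.
      * rewrite <- (proj2 (L x 1%nat ltac:(lia))). apply D; lia.
    + assert (T' : forall i j, (i < 2)%nat -> (j < 2)%nat ->
        flim (Rbar_locally b) (fun x => entry (mat_mult (Psi x) (exp_i_sigma3 (l * x))) i j) (entry mat_id i j)).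
      { intros i j Hi Hj. apply flim_filterlim; [typeclasses eauto|]. apply T; assumption. }
      assert (lt0 : (0 < 2)%nat) by lia. assert (lt1 : (1 < 2)%nat) by lia.
      pose proof (T' _ _ lt0 lt0) as Q1. pose proof (T' _ _ lt0 lt1) as Q2.
      pose proof (T' _ _ lt1 lt0) as Q3. pose proof (T' _ _ lt1 lt1) as Q4.
      rewrite I1 in Q1. rewrite I2 in Q2. rewrite I3 in Q3. rewrite I4 in Q4.
      split; [|split; [|split]].
      * exact (flim_ext _ _ _ _ (fun x => proj1 (E x _ lt0)) Q1).
      * exact (flim_ext _ _ _ _ (fun x => proj2 (E x _ lt0)) Q2).
      * exact (flim_ext _ _ _ _ (fun x => proj1 (E x _ lt1)) Q3).
      * exact (flim_ext _ _ _ _ (fun x => proj2 (E x _ lt1)) Q4).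
  - intros [[D1 D2] (T1 & T2 & T3 & T4)]. split.
    + intros x. apply index2_cases; apply cder_is_derive.
      * rewrite (proj1 (L x 0%nat ltac:(lia))). apply (D1 x).
      * rewrite (proj1 (L x 1%nat ltac:(lia))). apply (D2 x).
      * rewrite (proj2 (L x 0%nat ltac:(lia))). apply (D1 x).
      * rewrite (proj2 (L x 1%nat ltac:(lia))). apply (D2 x).
    + apply index2_cases; (apply flim_filterlim; [typeclasses eauto|]).
      * rewrite I1. refine (flim_ext _ _ _ _ _ T1). intros x. symmetry. apply E; lia.
      * rewrite I2. refine (flim_ext _ _ _ _ _ T2). intros x. symmetry. apply E; lia.
      * rewrite I3. refine (flim_ext _ _ _ _ _ T3). intros x. symmetry. apply E; lia.
      * rewrite I4. refine (flim_ext _ _ _ _ _ T4). intros x. symmetry. apply E; lia.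
Qed.

(** The coefficient matrix has trace zero. *)
Lemma lax_wronskian q l g1 g2 h1 h2 : lax_column q l g1 g2 -> lax_column q l h1 h2 ->
  forall x y, (g1 x * h2 x - g2 x * h1 x)%C = (g1 y * h2 y - g2 y * h1 y)%C.
Proof.
  intros Dg Dh.
  assert (D : forall t, cder (fun x => g1 x * h2 x - g2 x * h1 x)%C t (RtoC 0)).
  { intros t. destruct (Dg t) as [G1 G2], (Dh t) as [H1 H2].
    eapply cder_eq; [apply cder_minus; apply cder_mult; eassumption|]. ring. }
  assert (main : forall x y, x <= y ->
    (g1 x * h2 x - g2 x * h1 x)%C = (g1 y * h2 y - g2 y * h1 y)%C).
  { intros x y Hxy. apply (cder_zero_const (fun x => g1 x * h2 x - g2 x * h1 x)%C x y Hxy). auto. }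
  intros x y. destruct (Rle_dec x y) as [h|h]; [apply main, h|symmetry; apply main; lra].
Qed.

Lemma flim_unique {T} (F : (T -> Prop) -> Prop) {FF : ProperFilter F} (f : T -> C) l m :
  flim F f l -> flim F f m -> l = m.
Proof.
  intros H1 H2. assert (Z : (l - m)%C = RtoC 0).
  { apply Cmod_eq_0. apply Rle_antisym; [|apply Cmod_ge_0].
    apply le_epsilon. intros eps He. assert (He2 : 0 < eps / 2) by lra.
    destruct (filter_ex _ (filter_and _ _ (H1 _ He2) (H2 _ He2))) as [t [K1 K2]].
    pose proof (Cmod_sub_triangle_l l (f t) m) as Tr. lra. }
  replace l with ((l - m) + m)%C by ring. rewrite Z. ring.
Qed.

Lemma flim_const_eq {T} (F : (T -> Prop) -> Prop) {FF : ProperFilter F} (f : T -> C) c l :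
  (forall x, f x = c) -> flim F f l -> c = l.
Proof.
  intros E H. apply (flim_unique F f); [|exact H].
  apply (flim_ext F (fun _ => c)); [intros; symmetry; apply E|].
  apply flim_const; filter_tc.
Qed.

(* The Wronskians of the columns of two Jost solutions at the same end are constant, so
   they can be read off from the normalization at that end. *)
Lemma jost_solution_unique b q l P P' : b = p_infty \/ b = m_infty ->
  is_Jost_solution b q l P -> is_Jost_solution b q l P' ->
  forall x i, (i < 2)%nat -> entry (P x) i 0 = entry (P' x) i 0 /\ entry (P x) i 1 = entry (P' x) i 1.
Proof.
  intros Hb HP HP'.
  assert (FF : ProperFilter (Rbar_locally b)) by apply Rbar_locally_filter.
  apply is_Jost_columns in HP. apply is_Jost_columns in HP'. cbv zeta in HP, HP'.
  destruct HP as [[D1 D2] (T1 & T2 & T3 & T4)], HP' as [[D1' D2'] (T1' & T2' & T3' & T4')].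
  set (e := cexp (Ci * RtoC l)) in *. set (e' := cexp (- (Ci * RtoC l))) in *.
  assert (Hee : forall x, (e x * e' x = 1)%C) by (intros; apply cexp_opp).
  assert (He' : forall x, Cmod (e' x) = 1).
  { intros x. unfold e'. rewrite Cmod_cexp.
    replace (Re (- (Ci * RtoC l))%C * x) with 0 by (simpl; ring). apply exp_0. }
  assert (He : forall x, Cmod (e x) = 1).
  { intros x. unfold e. rewrite Cmod_cexp.
    replace (Re (Ci * RtoC l)%C * x) with 0 by (simpl; ring). apply exp_0. }
  set (p11 := fun x => entry (P x) 0 0) in *. set (p12 := fun x => entry (P x) 0 1) in *.
  set (p21 := fun x => entry (P x) 1 0) in *. set (p22 := fun x => entry (P x) 1 1) in *.
  set (r11 := fun x => entry (P' x) 0 0) in *. set (r12 := fun x => entry (P' x) 0 1) in *.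
  set (r21 := fun x => entry (P' x) 1 0) in *. set (r22 := fun x => entry (P' x) 1 1) in *.
  
  (* For columns of opposite type the normalizing exponentials cancel in the Wronskian, so its value
     is the determinant of the limits. *)
  assert (L : forall f1 f2 g1 g2 a1 a2 c1 c2,
    flim (Rbar_locally b) (fun x => f1 x * e x)%C a1 -> flim (Rbar_locally b) (fun x => f2 x * e x)%C a2 ->
    flim (Rbar_locally b) (fun x => g1 x * e' x)%C c1 -> flim (Rbar_locally b) (fun x => g2 x * e' x)%C c2 ->
    lax_column q l f1 f2 -> lax_column q l g1 g2 ->
    forall x, (f1 x * g2 x - f2 x * g1 x)%C = (a1 * c2 - a2 * c1)%C).
  { intros f1 f2 g1 g2 a1 a2 c1 c2 A1 A2 C1 C2 Df Dg x.
    refine (flim_const_eq (Rbar_locally b) (fun y => (f1 y * e y) * (g2 y * e' y) - (f2 y * e y) * (g1 y * e' y))%C _ _ _ _).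
    - intros y. rewrite (lax_wronskian _ _ _ _ _ _ Df Dg x y).
      transitivity ((f1 y * g2 y - f2 y * g1 y) * (e y * e' y))%C; [ring|]. rewrite Hee. ring.
    - apply flim_minus; filter_tc; apply flim_mult; filter_tc; assumption. }
  (* For columns of the same type the exponentials do not cancel, but they have modulus one and the
     normalized Wronskian tends to zero. *)
  assert (L0 : forall f1 f2 g1 g2 a k e0 e1, (forall x, (e0 x * e1 x = 1)%C) -> (forall x, Cmod (e1 x) = 1) ->
    flim (Rbar_locally b) (fun x => f1 x * e0 x)%C a -> flim (Rbar_locally b) (fun x => f2 x * e0 x)%C k ->
    flim (Rbar_locally b) (fun x => g1 x * e0 x)%C a -> flim (Rbar_locally b) (fun x => g2 x * e0 x)%C k ->
    lax_column q l f1 f2 -> lax_column q l g1 g2 ->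
    forall x, (f1 x * g2 x - f2 x * g1 x)%C = RtoC 0).
  { intros f1 f2 g1 g2 a k e0 e1 He01 He1 A1 A2 C1 C2 Df Dg x.
    assert (Z : flim (Rbar_locally b) (fun y => ((f1 y * e0 y) * (g2 y * e0 y) - (f2 y * e0 y) * (g1 y * e0 y)) * (e1 y * e1 y))%C (RtoC 0)).
    { apply (flim_zero_mult _ _ _ 1).
      - replace (RtoC 0) with (a * k - k * a)%C by ring.
        apply flim_minus; filter_tc; apply flim_mult; filter_tc; assumption.
      - intros y. rewrite Cmod_mult, He1. lra. }
    refine (flim_const_eq (Rbar_locally b) _ _ _ _ Z).
    intros y. rewrite (lax_wronskian _ _ _ _ _ _ Df Dg x y).
    transitivity ((f1 y * g2 y - f2 y * g1 y) * (e0 y * e1 y) * (e0 y * e1 y))%C; [ring|]. rewrite He01. ring. }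
  assert (Hee' : forall x, (e' x * e x = 1)%C) by (intros; rewrite Cmult_comm; apply Hee).
  assert (W1 : forall x, (p11 x * r22 x - p21 x * r12 x)%C = (1 * 1 - 0 * 0)%C)
    by (apply L; assumption).
  assert (W2 : forall x, (r11 x * r22 x - r21 x * r12 x)%C = (1 * 1 - 0 * 0)%C)
    by (apply L; assumption).
  assert (W3 : forall x, (r11 x * p22 x - r21 x * p12 x)%C = (1 * 1 - 0 * 0)%C)
    by (apply L; assumption).
  assert (Z1 : forall x, (p11 x * r21 x - p21 x * r11 x)%C = RtoC 0)
    by (apply (L0 _ _ _ _ (RtoC 1) (RtoC 0) e e'); assumption).
  assert (Z2 : forall x, (p12 x * r22 x - p22 x * r12 x)%C = RtoC 0)
    by (apply (L0 _ _ _ _ (RtoC 0) (RtoC 1) e' e); assumption).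
  intros x i Hi.
  assert (K : (p11 x = r11 x /\ p12 x = r12 x) /\ (p21 x = r21 x /\ p22 x = r22 x)).
  { specialize (W1 x). specialize (W2 x). specialize (W3 x). specialize (Z1 x). specialize (Z2 x).
    assert (O : (1 * 1 - 0 * 0)%C = RtoC 1) by ring. rewrite O in *.
    split; split.
    - transitivity ((r11 x * r22 x - r21 x * r12 x) * p11 x)%C; [rewrite W2; ring|].
      transitivity (r11 x * (p11 x * r22 x - p21 x * r12 x) - r12 x * (p11 x * r21 x - p21 x * r11 x))%C; [ring|].
      rewrite W1, Z1. ring.
    (* Each column of [P] is expanded in the columns of [P'], whose determinant is 1; the
       coefficients are Wronskians already computed. *)
    - transitivity ((r11 x * r22 x - r21 x * r12 x) * p12 x)%C; [rewrite W2; ring|].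
      transitivity (r12 x * (r11 x * p22 x - r21 x * p12 x) + r11 x * (p12 x * r22 x - p22 x * r12 x))%C; [ring|].
      rewrite W3, Z2. ring.
    - transitivity ((r11 x * r22 x - r21 x * r12 x) * p21 x)%C; [rewrite W2; ring|].
      transitivity (r21 x * (p11 x * r22 x - p21 x * r12 x) - r22 x * (p11 x * r21 x - p21 x * r11 x))%C; [ring|].
      rewrite W1, Z1. ring.
    - transitivity ((r11 x * r22 x - r21 x * r12 x) * p22 x)%C; [rewrite W2; ring|].
      transitivity (r22 x * (r11 x * p22 x - r21 x * p12 x) + r21 x * (p12 x * r22 x - p22 x * r12 x))%C; [ring|].
      rewrite W3, Z2. ring. }
  destruct i as [|[|i]]; [| |lia]; tauto.
Qed.

(** By Cramer's rule the entry is the Wronskian of the first column of the solution normalized on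
    the right with the second column of the one normalized on the left. Both are unique, and the
    latter solution has determinant 1. *)
Lemma transition_entry_unique q l T T' :
  is_transition_matrix q l T -> is_transition_matrix q l T' -> entry T 0 0 = entry T' 0 0.
Proof.
  intros (P & N & HP & HN & E) (P' & N' & HP' & HN' & E').
  pose proof (jost_solution_unique _ _ _ _ _ (or_introl eq_refl) HP HP') as UP.
  pose proof (jost_solution_unique _ _ _ _ _ (or_intror eq_refl) HN HN') as UN.
  pose proof (proj1 (is_Jost_columns _ _ _ _) HN) as JN. cbv zeta in JN.
  destruct JN as [[D1 D2] (T1 & T2 & T3 & T4)].
  assert (W : forall x, (entry (N x) 0 0 * entry (N x) 1 1 - entry (N x) 1 0 * entry (N x) 0 1)%C = (1 * 1 - 0 * 0)%C).
  { intros x.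
    refine (flim_const_eq (Rbar_locally m_infty) (fun y =>
      (entry (N y) 0 0 * cexp (Ci * RtoC l) y) * (entry (N y) 1 1 * cexp (- (Ci * RtoC l)) y) -
      (entry (N y) 1 0 * cexp (Ci * RtoC l) y) * (entry (N y) 0 1 * cexp (- (Ci * RtoC l)) y))%C _ _ _ _).
    - intros y. rewrite (lax_wronskian _ _ _ _ _ _ D1 D2 x y).
      transitivity ((entry (N y) 0 0 * entry (N y) 1 1 - entry (N y) 1 0 * entry (N y) 0 1) *
        (cexp (Ci * RtoC l) y * cexp (- (Ci * RtoC l)) y))%C; [ring|]. rewrite cexp_opp. ring.
    - apply flim_minus; filter_tc; apply flim_mult; filter_tc; assumption. }
  assert (F : forall (P N : R -> matrix 2 2) T, P 0 = mat_mult (N 0) T ->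
    (entry (N 0) 0 0 * entry (N 0) 1 1 - entry (N 0) 1 0 * entry (N 0) 0 1)%C = RtoC 1 ->
    entry T 0 0 = (entry (P 0) 0 0 * entry (N 0) 1 1 - entry (P 0) 1 0 * entry (N 0) 0 1)%C).
  { intros Q S U EQ ES. rewrite EQ, !entry_mult by lia.
    transitivity (entry U 0 0 * (entry (S 0) 0 0 * entry (S 0) 1 1 - entry (S 0) 1 0 * entry (S 0) 0 1))%C;
      [rewrite ES; ring|ring]. }
  assert (W0 := W 0). replace (1 * 1 - 0 * 0)%C with (RtoC 1) in W0 by ring.
  rewrite (F P N T (E 0) W0).
  assert (W0' := W0).
  rewrite (proj1 (UN 0 0%nat ltac:(lia))), (proj2 (UN 0 0%nat ltac:(lia))),
    (proj1 (UN 0 1%nat ltac:(lia))), (proj2 (UN 0 1%nat ltac:(lia))) in W0'.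
  rewrite (F P' N' T' (E' 0) W0').
  rewrite (proj1 (UP 0 0%nat ltac:(lia))), (proj1 (UP 0 1%nat ltac:(lia))),
    (proj2 (UN 0 0%nat ltac:(lia))), (proj2 (UN 0 1%nat ltac:(lia))). reflexivity.
Qed.

Lemma choice_seq {X : Type} (P : nat -> X -> Prop) :
  (forall n, exists x, P n x) -> exists u, forall n, P n (u n).
Proof.
  intros H. exists (fun n => proj1_sig (constructive_indefinite_description _ (H n))).
  intros n. exact (proj2_sig (constructive_indefinite_description _ (H n))).
Qed.

(** * Jost solutions and the transition matrix on the real line *)

Section RealSpectrum.
Variables (q : R -> C) (f f1 f2 : nat -> R -> C) (Mn : nat -> R) (R0 : R).
Hypothesis Hap : approximates q f f1 f2 Mn R0.
Variable l : R.

Let Had n : admissible (f n) (f1 n) (f2 n) (Mn n) := proj1 Hap n.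
Let Hw n : w11_le (f n) (f1 n) R0 := proj1 (proj2 Hap) n.
Let e := cexp (Ci * RtoC l).
Let e' := cexp (- (Ci * RtoC l)).
Let E2 := cexp (2 * Ci * RtoC l).
Let E2' := cexp (- (2 * Ci * RtoC l)).

Lemma Cmod_cexp_imaginary mu x : Re mu = 0 -> Cmod (cexp mu x) = 1.
Proof. intros H. rewrite Cmod_cexp, H, Rmult_0_l. apply exp_0. Qed.

Lemma Cmod_E2 x : Cmod (E2 x) = 1.
Proof. apply Cmod_cexp_imaginary. simpl; ring. Qed.

Lemma Cmod_E2' x : Cmod (E2' x) = 1.
Proof. apply Cmod_cexp_imaginary. simpl; ring. Qed.

Lemma Im_real : Im (RtoC l) <= 0.
Proof. simpl; lra. Qed.

Lemma e_E2' x : (e x * E2' x = e' x)%C.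
Proof.
  unfold e, e', E2'. rewrite <- cexp_add. f_equal. ring.
Qed.

Section Column.
Variables (c1 c2 : C) (u1 u2 : nat -> R -> C).
Hypothesis Hc : Cmod c1 ^ 2 + Cmod c2 ^ 2 <= 1.
Hypothesis Hu : forall n, akns (f n) (f1 n) (Mn n) (RtoC l) c1 c2 (u1 n) (u2 n).

Lemma column_data n t : Mn n < t -> Cmod (u1 n t) ^ 2 + Cmod (u2 n t) ^ 2 <= 1.
Proof.
  intros Ht. destruct (Hu n) as (_ & _ & H). destruct (H t Ht) as [-> ->].
  rewrite Cmod_mult. fold E2. rewrite Cmod_E2, Rmult_1_r. exact Hc.
Qed.

Lemma column_bound n t : Cmod (u1 n t) <= exp (kap R0) /\ Cmod (u2 n t) <= exp (kap R0).
Proof.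
  pose proof (akns_bound _ _ _ _ (Had n) _ _ _ _ _ _ (Hw n) Im_real (Hu n) (column_data n) t) as B.
  assert (K1 : 1 <= exp (kap R0)).
  { pose proof (w11_nonneg _ _ _ _ (Had n) R0 (Hw n)). pose proof (pow2_ge_0 R0).
    pose proof (exp_ineq1_le (kap R0)). assert (0 <= kap R0) by (unfold kap; nra). lra. }
  pose proof (pow2_ge_0 (Cmod (u1 n t))). pose proof (pow2_ge_0 (Cmod (u2 n t))).
  split; apply pow2_le_inv; try lra; nra.
Qed.

Lemma column_cauchy : forall eps, 0 < eps -> exists N : nat, forall n m t,
  (N <= n)%nat -> (N <= m)%nat -> True ->
  Cmod (u1 n t - u1 m t) < eps /\ Cmod (u2 n t - u2 m t) < eps.
Proof.
  intros eps He. pose proof (lip_const_pos R0) as Hp.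
  assert (He2 : 0 < eps / (2 * lip_const R0)) by (apply Rdiv_lt_0_compat; lra).
  destruct (proj1 (proj2 (proj2 Hap)) _ He2) as [N HN]. exists N. intros n m t Hn Hm _.
  destruct (akns_potential_lipschitz _ _ _ _ _ _ _ _ R0 _ _ _ _ _ _ _ _
    (Had n) (Had m) (Hw n) (Hw m) He2 (HN n m Hn Hm) Im_real (Hu n) (Hu m) (column_data m) t) as [B1 B2].
  fold (lip_const R0) in B1, B2.
  replace (lip_const R0 * (eps / (2 * lip_const R0))) with (eps / 2) in * by (field; lra).
  split; lra.
Qed.

(** The limit potential has no derivative at hand, whereas [rpot] contains one. The combination
    [u2 - (i/2) conj q u1] is differentiated instead: there [conj q'] cancels, and what remains
    converges uniformly. The clause on the sequence [a] later identifies [a1] with the limit of the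
    test coefficients. *)
Lemma column_limit : exists y1 y2 a1 a2,
  flim (Rbar_locally p_infty) y1 c1 /\ flim (Rbar_locally p_infty) y2 c2 /\
  flim (Rbar_locally m_infty) y1 a1 /\ flim (Rbar_locally m_infty) y2 a2 /\
  (forall a, (forall n t, t < - Mn n -> u1 n t = a n) -> ccv a a1) /\
  lax_column q l (fun x => e' x * y1 x)%C
    (fun x => e x * y2 x - Ci / 2 * Cconj (q x) * (e' x * y1 x))%C.
Proof.
  destruct (ucv_exists (fun _ : R => True) u1) as [U1 HU1].
  { intros eps He. destruct (column_cauchy eps He) as [N HN]. exists N.
    intros n m t Hn Hm Ht. exact (proj1 (HN n m t Hn Hm Ht)). }
  destruct (ucv_exists (fun _ : R => True) u2) as [U2 HU2].
  { intros eps He. destruct (column_cauchy eps He) as [N HN]. exists N.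
    intros n m t Hn Hm Ht. exact (proj2 (HN n m t Hn Hm Ht)). }
  pose proof (potentials_ucv _ _ _ _ _ _ Hap) as Hq.
  pose proof (potential_bound _ _ _ _ _ _ Hap) as Bq.
  set (K0 := exp (kap R0)).
  assert (BU1 : forall t, Cmod (U1 t) <= K0).
  { intros t. refine (ucv_bound (fun _ => True) u1 U1 K0 _ HU1 t Logic.I). intros; apply column_bound. }
  assert (BU2 : forall t, Cmod (U2 t) <= K0).
  { intros t. refine (ucv_bound (fun _ => True) u2 U2 K0 _ HU2 t Logic.I). intros; apply column_bound. }
  assert (HK0 : 0 < K0) by apply exp_pos.
  pose proof (Rle_trans _ _ _ (Cmod_ge_0 _) (Bq 0)) as HR0.
  set (K := (1 + R0 ^ 2) * (1 + R0 + K0)).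
  pose proof (pow2_ge_0 R0) as HR2.
  assert (HK : 0 <= K) by (unfold K; apply Rmult_le_pos; lra).
  assert (HK1 : R0 <= K /\ K0 <= K /\ R0 * R0 <= K).
  { unfold K. split; [|split]; nra. }
  assert (Bconj : forall t : R, True -> Cmod (Cconj (q t)) <= K).
  { intros t _. rewrite Cmod_conj. specialize (Bq t). lra. }
  assert (Bq' : forall t : R, True -> Cmod (q t) <= K) by (intros t _; specialize (Bq t); lra).
  assert (BU1' : forall t : R, True -> Cmod (U1 t) <= K) by (intros t _; specialize (BU1 t); lra).
  assert (BU2' : forall t : R, True -> Cmod (U2 t) <= K) by (intros t _; specialize (BU2 t); lra).
  assert (Bqq : forall t : R, True -> Cmod (q t * Cconj (q t))%C <= K).
  { intros t _. rewrite Cmod_mult, Cmod_conj. specialize (Bq t). pose proof (Cmod_ge_0 (q t)). nra. }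
  pose proof (ucv_conj _ _ _ Hq) as Hqc.
  pose proof (ucv_mult _ _ _ _ _ K HK Bq' Bconj Hq Hqc) as Hqq.
  set (V := fun t => (U2 t - Ci / 2 * (Cconj (q t) * U1 t))%C).
  assert (DU1 : forall t, cder U1 t (q t * U2 t)%C).
  { intros t. apply (cder_limit u1 (fun n t => f n t * u2 n t)%C U1 (fun t => q t * U2 t)%C t 1); [lra| | |].
    - intros n y. exact (proj1 (Hu n) y).
    - intros y _. exact (ucv_ccv _ _ _ y HU1 Logic.I).
    - apply (ucv_subset (fun _ => True)); auto.
      exact (ucv_mult _ _ _ _ _ K HK Bq' BU2' Hq HU2). }
  set (W := fun (q U1 U2 : R -> C) t => (2 * Ci * RtoC l * U2 t
     - (/ 4 * ((q t * Cconj (q t)) * (Cconj (q t) * U1 t)) + Ci / 2 * ((q t * Cconj (q t)) * U2 t)))%C).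
  assert (DV : forall t, cder V t (W q U1 U2 t)).
  { intros t. apply (cder_limit (fun n t => u2 n t - Ci / 2 * (Cconj (f n t) * u1 n t))%C
      (fun n => W (f n) (u1 n) (u2 n)) V (W q U1 U2) t 1); [lra| | |].
    - intros n y. eapply cder_eq.
      + apply cder_minus; [exact (proj1 (proj2 (Hu n)) y)|].
        apply cder_scal, cder_mult; [|exact (proj1 (Hu n) y)].
        apply cder_conj. exact (proj1 (proj2 (Had n)) y).
      + unfold W, rpot. field.
    - intros y _. unfold V. pose proof (ucv_ccv _ _ _ y HU1 Logic.I) as L1.
      pose proof (ucv_ccv _ _ _ y HU2 Logic.I) as L2. pose proof (ucv_ccv _ _ _ y Hqc Logic.I) as L3.
      apply flim_minus; filter_tc; [exact L2|].
      apply flim_scal; filter_tc. apply flim_mult; filter_tc; assumption.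
    - apply (ucv_subset (fun _ => True)); auto. unfold W.
      assert (BcU : forall t : R, True -> Cmod (Cconj (q t) * U1 t)%C <= K * K).
      { intros y Hy. rewrite Cmod_mult. apply Rmult_le_compat; auto using Cmod_ge_0. }
      assert (HKK : 0 <= K + K * K) by nra.
      apply ucv_minus; [apply ucv_scal; exact HU2|]. apply ucv_plus.
      + apply ucv_scal. apply (ucv_mult _ _ _ _ _ (K + K * K) HKK).
        * intros y Hy. specialize (Bqq y Hy). nra.
        * intros y Hy. specialize (BcU y Hy). nra.
        * exact Hqq.
        * exact (ucv_mult _ _ _ _ _ K HK Bconj BU1' Hqc HU1).
      + apply ucv_scal. exact (ucv_mult _ _ _ _ _ K HK Bqq BU2' Hqq HU2). }
  (* Without the free oscillation, each approximant is constant outside its support, so limits at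
     both ends can be exchanged with the limit in [n]. *)
  set (y2 := fun t => (E2' t * U2 t)%C).
  assert (Hy2 : ucv (fun _ => True) (fun n t => E2' t * u2 n t)%C y2).
  { intros eps He. destruct (HU2 eps He) as [N HN]. exists N. intros n t Hn Ht. unfold y2.
    replace (E2' t * u2 n t - E2' t * U2 t)%C with (E2' t * (u2 n t - U2 t))%C by ring.
    rewrite Cmod_mult, Cmod_E2', Rmult_1_l. auto. }
  assert (EE : forall t, (E2' t * E2 t = 1)%C).
  { intros t. unfold E2, E2'. rewrite Cmult_comm. apply cexp_opp. }
  assert (FFp : ProperFilter (Rbar_locally p_infty)) by apply Rbar_locally_filter.
  assert (FFm : ProperFilter (Rbar_locally m_infty)) by apply Rbar_locally_filter.
  destruct (ucv_flim (Rbar_locally p_infty) u1 U1 (fun _ => c1) HU1) as (b1 & B1 & P1).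
  { intros n. exists (Mn n). intros t Ht. apply (Hu n). exact Ht. }
  destruct (ucv_flim (Rbar_locally p_infty) _ y2 (fun _ => c2) Hy2) as (b2 & B2 & P2).
  { intros n. exists (Mn n). intros t Ht. destruct (Hu n) as (_ & _ & H). rewrite (proj2 (H t Ht)).
    fold E2. transitivity (c2 * (E2' t * E2 t))%C; [ring|]. rewrite EE. ring. }
  rewrite (ccv_constant_unique _ _ _ B1 (fun _ => eq_refl)) in P1.
  rewrite (ccv_constant_unique _ _ _ B2 (fun _ => eq_refl)) in P2.
  destruct (choice_seq (fun n (a : C * C) => forall t, t < - Mn n ->
    u1 n t = fst a /\ u2 n t = (snd a * E2 t)%C)) as [a Ha].
  { intros n. destruct (akns_left _ _ _ _ (Had n) _ _ _ _ _ (Hu n)) as (a1 & a2 & H).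
    exists (a1, a2). exact H. }
  destruct (ucv_flim (Rbar_locally m_infty) u1 U1 (fun n => fst (a n)) HU1) as (a1 & A1 & Q1).
  { intros n. exists (- Mn n). intros t Ht. apply (Ha n t Ht). }
  destruct (ucv_flim (Rbar_locally m_infty) _ y2 (fun n => snd (a n)) Hy2) as (a2 & A2 & Q2).
  { intros n. exists (- Mn n). intros t Ht. rewrite (proj2 (Ha n t Ht)).
    transitivity (snd (a n) * (E2' t * E2 t))%C; [ring|]. rewrite EE. ring. }
  exists U1, y2, a1, a2. split; [exact P1|split; [exact P2|split; [exact Q1|split; [exact Q2|split]]]].
  - intros a' Ha'. refine (flim_ext _ _ _ _ _ A1). intros n.
    rewrite <- (Ha' n (- Mn n - 1)) by lra. symmetry. apply Ha. lra.
  - assert (Eg2 : forall x, (e' x * V x)%C = (e x * y2 x - Ci / 2 * Cconj (q x) * (e' x * U1 x))%C).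
    { intros x. unfold y2, V. rewrite <- e_E2'. ring. }
    intros x. split.
    + eapply cder_eq; [apply cder_mult; [apply cder_cexp|apply DU1]|].
      rewrite <- Eg2. fold e'. unfold V. rewrite Cmod2_conj. ring.
    + apply (cder_ext (fun x => e' x * V x)%C); [exact Eg2|].
      eapply cder_eq; [apply cder_mult; [apply cder_cexp|apply DV]|].
      rewrite <- Eg2. fold e'. unfold V, W. rewrite Cmod2_conj.
      assert (I2 : (Ci * Ci)%C = (- (1))%C) by (apply C_eq_parts; simpl; ring).
      (* The two sides agree only modulo [Ci * Ci = - 1], which [field] does not see; the
         appropriate multiple of [Ci * Ci + 1] is inserted by hand and then removed. *)
      match goal with |- ?L = ?M => transitivity (M + (Ci * Ci + 1) * (RtoC l * Cconj (q x) * (e' x * U1 x)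
        - / 4 * (q x * Cconj (q x) * Cconj (q x) * (e' x * U1 x))))%C end; [field|rewrite I2; ring].
Qed.
End Column.

Variable A : C -> C.
Hypothesis HA : ucv lower (alphas f f1 Mn) A.

(** Undoing the substitution introduces unimodular oscillating factors. On the diagonal they cancel
    in the leading term; off the diagonal the limit must be zero to survive. The correction with
    [conj q] disappears because [q] decays. *)
Lemma gauge_flim b (z1 z2 : R -> C) a1 a2 : b = p_infty \/ b = m_infty ->
  flim (Rbar_locally b) z1 a1 -> flim (Rbar_locally b) z2 a2 ->
  flim (Rbar_locally b) (fun x => e' x * z1 x * e x)%C a1 /\
  (a1 = RtoC 0 -> flim (Rbar_locally b) (fun x => e' x * z1 x * e' x)%C (RtoC 0)) /\
  (a2 = RtoC 0 -> flim (Rbar_locally b)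
     (fun x => (e x * z2 x - Ci / 2 * Cconj (q x) * (e' x * z1 x)) * e x)%C (RtoC 0)) /\
  flim (Rbar_locally b) (fun x => (e x * z2 x - Ci / 2 * Cconj (q x) * (e' x * z1 x)) * e' x)%C a2.
Proof.
  intros Hb H1 H2.
  assert (FF : ProperFilter (Rbar_locally b)) by apply Rbar_locally_filter.
  assert (Hee : forall x, (e x * e' x = 1)%C) by (intros; apply cexp_opp).
  assert (Me : forall x, Cmod (e x) = 1).
  { intros x. apply Cmod_cexp_imaginary. simpl; ring. }
  assert (Me' : forall x, Cmod (e' x) = 1).
  { intros x. apply Cmod_cexp_imaginary. simpl; ring. }
  pose proof (potential_decay _ _ _ _ _ _ Hap b Hb) as Hq.
  assert (Hq1 : flim (Rbar_locally b) (fun x => Ci / 2 * Cconj (q x) * z1 x)%C (RtoC 0)).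
  { replace (RtoC 0) with (Ci / 2 * Cconj (RtoC 0) * a1)%C.
    - apply flim_mult; filter_tc; [|exact H1].
      apply flim_scal; filter_tc. apply flim_conj; filter_tc. exact Hq.
    - apply C_eq_parts; simpl; ring. }
  split; [|split; [|split]].
  - refine (flim_ext _ _ _ _ _ H1). intros x.
    transitivity (z1 x * (e x * e' x))%C; [rewrite Hee; ring|ring].
  - intros ->. refine (flim_ext _ _ _ _ _ (flim_zero_mult _ _ (fun x => e' x * e' x)%C 1 H1 _)).
    + intros x. ring.
    + intros x. rewrite Cmod_mult, Me'. lra.
  - intros ->.
    assert (Z : flim (Rbar_locally b) (fun x => z2 x * (e x * e x) - Ci / 2 * Cconj (q x) * z1 x)%C (0 - 0)%C).
    { apply flim_minus; filter_tc; [|exact Hq1].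
      apply (flim_zero_mult _ _ _ 1 H2). intros x. rewrite Cmod_mult, Me. lra. }
    replace (0 - 0)%C with (RtoC 0) in Z by ring. refine (flim_ext _ _ _ _ _ Z). intros x.
    transitivity (z2 x * (e x * e x) - Ci / 2 * Cconj (q x) * z1 x * (e x * e' x))%C;
      [rewrite Hee; ring|ring].
  - assert (Z : flim (Rbar_locally b) (fun x => z2 x - Ci / 2 * Cconj (q x) * z1 x * (e' x * e' x))%C (a2 - 0)%C).
    { apply flim_minus; filter_tc; [exact H2|].
      apply (flim_zero_mult _ _ _ 1 Hq1). intros x. rewrite Cmod_mult, Me'. lra. }
    replace (a2 - 0)%C with a2 in Z by ring. refine (flim_ext _ _ _ _ _ Z). intros x.
    transitivity (z2 x * (e x * e' x) - Ci / 2 * Cconj (q x) * z1 x * (e' x * e' x))%C;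
      [rewrite Hee; ring|ring].
Qed.

Lemma lax_column_combine (g1 g2 h1 h2 : R -> C) a b :
  lax_column q l g1 g2 -> lax_column q l h1 h2 ->
  lax_column q l (fun x => a * g1 x + b * h1 x)%C (fun x => a * g2 x + b * h2 x)%C.
Proof.
  intros Dg Dh x. destruct (Dg x) as [G1 G2], (Dh x) as [H1 H2]. split.
  - eapply cder_eq; [apply cder_plus; apply cder_scal; eassumption|ring].
  - eapply cder_eq; [apply cder_plus; apply cder_scal; eassumption|ring].
Qed.

Lemma lax_column_ext (g1 g2 h1 h2 : R -> C) :
  (forall x, g1 x = h1 x) -> (forall x, g2 x = h2 x) ->
  lax_column q l g1 g2 -> lax_column q l h1 h2.
Proof.
  intros E1 E3 D x. destruct (D x) as [D1 D2]. rewrite <- E1, <- E3. split.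
  - exact (cder_ext g1 h1 x _ E1 D1).
  - exact (cder_ext g2 h2 x _ E3 D2).
Qed.

(** The limit columns with data [(1, 0)] and [(0, 1)] on the right form one Jost solution. Their
    limits on the left are the entries of [T], whose determinant is 1 because the Wronskian is
    constant; multiplying by the inverse of [T] gives the solution normalized on the left. *)
Lemma limit_alpha_transition :
  exists T, is_transition_matrix q l T /\ A (RtoC l) = entry T 0 0.
Proof.
  destruct (choice_seq (fun n (u : (R -> C) * (R -> C)) =>
    akns (f n) (f1 n) (Mn n) (RtoC l) (RtoC 1) (RtoC 0) (fst u) (snd u) /\
    forall t, t < - Mn n -> fst u t = alphas f f1 Mn n (RtoC l))) as [u Hu].
  { intros n. destruct (test_alpha_spec _ _ _ _ (Had n) (RtoC l)) as (u1 & u2 & H). exists (u1, u2). exact H. }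
  destruct (choice_seq (fun n (u : (R -> C) * (R -> C)) =>
    akns (f n) (f1 n) (Mn n) (RtoC l) (RtoC 0) (RtoC 1) (fst u) (snd u))) as [v Hv].
  { intros n. destruct (akns_exists _ _ _ _ (Had n) (RtoC l) (RtoC 0) (RtoC 1)) as (u1 & u2 & H).
    exists (u1, u2). exact H. }
  destruct (column_limit (RtoC 1) (RtoC 0) (fun n => fst (u n)) (fun n => snd (u n)))
    as (y1 & y2 & a1 & a2 & P1 & P2 & N1 & N2 & Q & D); [rewrite Cmod_0, Cmod_1; lra|intros n; apply Hu|].
  destruct (column_limit (RtoC 0) (RtoC 1) (fun n => fst (v n)) (fun n => snd (v n)))
    as (z1 & z2 & b1 & b2 & P1' & P2' & N1' & N2' & _ & D'); [rewrite Cmod_0, Cmod_1; lra|exact Hv|].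
  assert (EA : A (RtoC l) = a1).
  { apply (ccv_unique (fun n => alphas f f1 Mn n (RtoC l))).
    - apply (ucv_ccv lower _ A (RtoC l) HA Im_real).
    - apply Q. intros n t Ht. apply Hu, Ht. }
  assert (FFp : ProperFilter (Rbar_locally p_infty)) by apply Rbar_locally_filter.
  assert (FFm : ProperFilter (Rbar_locally m_infty)) by apply Rbar_locally_filter.
  assert (Hee : forall x, (e x * e' x = 1)%C) by (intros; apply cexp_opp).
  assert (W0 : forall x, (y1 x * z2 x - y2 x * z1 x)%C = (y1 0 * z2 0 - y2 0 * z1 0)%C).
  { intros x. pose proof (lax_wronskian _ _ _ _ _ _ D D' x 0) as L. cbv beta in L.
    assert (S : forall t, ((e' t * y1 t) * (e t * z2 t - Ci / 2 * Cconj (q t) * (e' t * z1 t)) -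
       (e t * y2 t - Ci / 2 * Cconj (q t) * (e' t * y1 t)) * (e' t * z1 t))%C = (y1 t * z2 t - y2 t * z1 t)%C).
    { intros t. transitivity ((e t * e' t) * (y1 t * z2 t - y2 t * z1 t))%C; [ring|]. rewrite Hee. ring. }
    rewrite !S in L. exact L. }
  assert (det0 : (y1 0 * z2 0 - y2 0 * z1 0)%C = (1 * 1 - 0 * 0)%C).
  { apply (flim_const_eq (Rbar_locally p_infty) _ _ _ W0).
    apply flim_minus; filter_tc; apply flim_mult; filter_tc; assumption. }
  assert (deta : (y1 0 * z2 0 - y2 0 * z1 0)%C = (a1 * b2 - a2 * b1)%C).
  { apply (flim_const_eq (Rbar_locally m_infty) _ _ _ W0).
    apply flim_minus; filter_tc; apply flim_mult; filter_tc; assumption. }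
  assert (det : (a1 * b2 - a2 * b1)%C = RtoC 1).
  { rewrite <- deta, det0. ring. }
  set (G := fun (y1 y2 : R -> C) x => (e x * y2 x - Ci / 2 * Cconj (q x) * (e' x * y1 x))%C).
  set (Pp := fun x => mat2 (e' x * y1 x)%C (e' x * z1 x)%C (G y1 y2 x) (G z1 z2 x)).
  (* Right multiplication by the adjugate of [T], which is its inverse since the determinant is
     1. *)
  set (m11 := fun x => (b2 * y1 x + - a2 * z1 x)%C). set (m21 := fun x => (b2 * y2 x + - a2 * z2 x)%C).
  set (m12 := fun x => (- b1 * y1 x + a1 * z1 x)%C). set (m22 := fun x => (- b1 * y2 x + a1 * z2 x)%C).
  set (Pm := fun x => mat2 (e' x * m11 x)%C (e' x * m12 x)%C (G m11 m21 x) (G m12 m22 x)).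
  exists (mat2 a1 b1 a2 b2). split; [|exact EA].
  exists Pp, Pm. split; [|split].
  - apply is_Jost_columns. cbv zeta. split; [split|].
    + exact D.
    + exact D'.
    + destruct (gauge_flim p_infty y1 y2 _ _ (or_introl eq_refl) P1 P2) as (F1 & _ & F3 & _).
      destruct (gauge_flim p_infty z1 z2 _ _ (or_introl eq_refl) P1' P2') as (_ & F2 & _ & F4).
      split; [exact F1|split; [exact (F2 eq_refl)|split; [exact (F3 eq_refl)|exact F4]]].
  - apply is_Jost_columns. cbv zeta. split; [split|].
    + refine (lax_column_ext _ _ _ _ _ _ (lax_column_combine _ _ _ _ b2 (- a2) D D'));
        intros x; unfold Pm; entry_simpl; unfold G, m11, m21; ring.
    + refine (lax_column_ext _ _ _ _ _ _ (lax_column_combine _ _ _ _ (- b1) a1 D D'));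
        intros x; unfold Pm; entry_simpl; unfold G, m12, m22; ring.
    + assert (L : forall c d (w : R -> C) (w' : R -> C) r r', flim (Rbar_locally m_infty) w r ->
        flim (Rbar_locally m_infty) w' r' -> flim (Rbar_locally m_infty) (fun x => c * w x + d * w' x)%C (c * r + d * r')%C).
      { intros. apply flim_plus; filter_tc; apply flim_scal; filter_tc; assumption. }
      assert (L11 : flim (Rbar_locally m_infty) m11 (RtoC 1)).
      { rewrite <- det. replace (a1 * b2 - a2 * b1)%C with (b2 * a1 + - a2 * b1)%C by ring. apply L; assumption. }
      assert (L21 : flim (Rbar_locally m_infty) m21 (RtoC 0)).
      { replace (RtoC 0) with (b2 * a2 + - a2 * b2)%C by ring. apply L; assumption. }
      assert (L12 : flim (Rbar_locally m_infty) m12 (RtoC 0)).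
      { replace (RtoC 0) with (- b1 * a1 + a1 * b1)%C by ring. apply L; assumption. }
      assert (L22 : flim (Rbar_locally m_infty) m22 (RtoC 1)).
      { rewrite <- det. replace (a1 * b2 - a2 * b1)%C with (- b1 * a2 + a1 * b2)%C by ring. apply L; assumption. }
      destruct (gauge_flim m_infty m11 m21 _ _ (or_intror eq_refl) L11 L21) as (F1 & _ & F3 & _).
      destruct (gauge_flim m_infty m12 m22 _ _ (or_intror eq_refl) L12 L22) as (_ & F2 & _ & F4).
      split; [exact F1|split; [exact (F2 eq_refl)|split; [exact (F3 eq_refl)|exact F4]]].
  - intros x. apply mat_ext. apply index2_cases; rewrite entry_mult by lia;
      unfold Pm, Pp; entry_simpl; unfold G, m11, m12, m21, m22.
    + transitivity ((a1 * b2 - a2 * b1) * (e' x * y1 x))%C; [rewrite det; ring|ring].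
    + transitivity ((a1 * b2 - a2 * b1) * (e' x * z1 x))%C; [rewrite det; ring|ring].
    + transitivity ((a1 * b2 - a2 * b1) * (e x * y2 x - Ci / 2 * Cconj (q x) * (e' x * y1 x)))%C; [rewrite det; ring|ring].
    + transitivity ((a1 * b2 - a2 * b1) * (e x * z2 x - Ci / 2 * Cconj (q x) * (e' x * z1 x)))%C; [rewrite det; ring|ring].
Qed.
End RealSpectrum.

(** * Complex differentiability through second differences *)

Lemma is_derive_C_eps (a : C -> C) (z l : C) :
  is_derive (K := C_AbsRing) (V := C_NormedModule) a z l <->
  forall eps, 0 < eps -> exists d, 0 < d /\
    forall h, Cmod h < d -> Cmod (a (z + h)%C - a z - l * h) <= eps * Cmod h.
Proof.
  split.
  - intros [_ D] eps He.
    destruct (D z (fun P HP => HP) (mkposreal _ He)) as [d Hd]. exists d. split; [apply cond_pos|].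
    intros h Hh. specialize (Hd (z + h)%C).
    assert (B : @ball (AbsRing_UniformSpace C_AbsRing) z d (z + h)%C).
    { change (Cmod (z + h - z)%C < d).
      replace (z + h - z)%C with h by ring. exact Hh. }
    specialize (Hd B).
    change (Cmod ((a (z + h)%C - a z) - (z + h - z) * l) <= eps * Cmod (z + h - z)%C) in Hd.
    replace (z + h - z)%C with h in Hd by ring.
    replace (a (z + h)%C - a z - l * h)%C with ((a (z + h)%C - a z) - h * l)%C by ring. exact Hd.
  - intros H. split; [apply is_linear_scal_l|].
    intros y Hy eps. assert (Ey : z = y) by (apply (is_filter_lim_locally_unique (V := AbsRing_NormedModule C_AbsRing) z y Hy)).
    subst y. destruct (H eps (cond_pos eps)) as (d & Hd & Q).
    assert (G : forall w : C, Cmod (w - z) < d -> Cmod ((a w - a z) - (w - z) * l) <= eps * Cmod (w - z)).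
    { intros w Hw. specialize (Q (w - z)%C Hw). replace (z + (w - z))%C with w in Q by ring.
      replace ((a w - a z) - (w - z) * l)%C with (a w - a z - l * (w - z))%C by ring. exact Q. }
    exists (mkposreal d Hd). exact G.
Qed.

Lemma continuous_on_eps (D : C -> Prop) (a : C -> C) :
  continuous_on D a <->
  forall z, D z -> forall eps, 0 < eps -> exists d, 0 < d /\
    forall w, D w -> Cmod (w - z) < d -> Cmod (a w - a z) < eps.
Proof.
  split.
  - intros H z Hz eps He.
    assert (Q : flim (within D (locally z)) a (a z)).
    { apply flim_filterlim; [typeclasses eauto|]. apply H, Hz. }
    destruct (Q eps He) as [d Hd]. exists d. split; [apply cond_pos|].
    intros w Dw Hw. apply Hd; [|exact Dw].
    split; (eapply Rle_lt_trans; [|exact Hw]).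
    + apply (re_le_Cmod (w - z)%C).
    + apply (im_le_Cmod (w - z)%C).
  - intros H z Hz. apply flim_filterlim; [typeclasses eauto|].
    intros eps He. destruct (H z Hz eps He) as (d & Hd & Q).
    assert (Hd2 : 0 < d / 2) by lra. exists (mkposreal _ Hd2). intros w [B1 B2] Dw.
    apply Q; [exact Dw|]. eapply Rle_lt_trans; [apply Cmod_le_abs|].
    assert (K1 : Rabs (Re (w - z)%C) < d / 2) by exact B1.
    assert (K2 : Rabs (Im (w - z)%C) < d / 2) by exact B2. lra.
Qed.

(** A bound on the second divided difference at [l], [l + h], [l + k], cleared of denominators so
    that degenerate increments are harmless and pointwise limits preserve it. *)
Definition second_difference_bound (A : C -> C) (K : R) : Prop :=
  forall eta l h k, 0 < eta ->
  Im l <= - eta -> Im (l + h)%C <= - eta -> Im (l + k)%C <= - eta ->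
  Cmod (k * (A (l + h)%C - A l) - h * (A (l + k)%C - A l)) <=
    K / eta ^ 2 * (Cmod h * Cmod k * Cmod (h - k)).

Lemma Im_plus_le (l h : C) : Im (l + h)%C <= Im l + Cmod h.
Proof.
  rewrite Im_plus. pose proof (im_le_Cmod h) as Q. apply Rabs_le_between in Q. lra.
Qed.

(* The difference quotients are Cauchy as the increment tends to 0. *)
Lemma second_difference_derivable A K : second_difference_bound A K ->
  forall l, Im l < 0 -> ex_derive (K := C_AbsRing) (V := C_NormedModule) A l.
Proof.
  intros HK l Hl.
  (* Half the distance to the real line: increments up to [eta] keep the points at depth at least
     [eta]. *)
  set (eta := - Im l / 2). assert (He : 0 < eta) by (unfold eta; lra).
  assert (Hin : forall h, Cmod h <= eta -> Im (l + h)%C <= - eta).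
  { intros h Hh. pose proof (Im_plus_le l h). unfold eta in *. lra. }
  set (B := Rabs (K / eta ^ 2) + 1).
  assert (HB : 0 < B /\ K / eta ^ 2 <= B).
  { unfold B. pose proof (Rabs_pos (K / eta ^ 2)). pose proof (Rle_abs (K / eta ^ 2)). lra. }
  assert (Q : forall h k, Cmod h <= eta -> Cmod k <= eta ->
    Cmod (k * (A (l + h)%C - A l) - h * (A (l + k)%C - A l)) <= B * (Cmod h * Cmod k * Cmod (h - k))).
  { intros h k Hh Hk. eapply Rle_trans; [apply (HK eta); auto; unfold eta; lra|].
    apply Rmult_le_compat_r; [|apply HB]. repeat apply Rmult_le_pos; apply Cmod_ge_0. }
  set (k := fun n => RtoC (eta / (INR n + 1))).
  assert (Hn : forall n, 0 < INR n + 1) by (intros n; pose proof (pos_INR n); lra).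
  assert (Mk : forall n, Cmod (k n) = eta / (INR n + 1)).
  { intros n. unfold k. rewrite Cmod_R, Rabs_pos_eq; [reflexivity|].
    left. apply Rdiv_lt_0_compat; auto. }
  assert (Pk : forall n, 0 < Cmod (k n)) by (intros n; rewrite Mk; apply Rdiv_lt_0_compat; auto).
  assert (Lk : forall n, Cmod (k n) <= eta).
  { intros n. rewrite Mk. apply Rle_div_l; [apply Hn|]. pose proof (pos_INR n). nra. }
  assert (Nk : forall n, k n <> RtoC 0) by (intros n; apply Cmod_gt_0, Pk).
  assert (Zk : ccv k (RtoC 0)).
  { intros eps Heps. destruct (nfloor_ex (eta / eps)) as [N [_ HN]].
    { apply Rdiv_le_0_compat; lra. }
    exists N. intros n Hnn. replace (k n - 0)%C with (k n) by ring. rewrite Mk.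
    apply Rlt_div_l; [apply Hn|]. apply Rlt_div_l in HN; [|lra].
    apply le_INR in Hnn. nra. }
  set (q := fun n => ((A (l + k n)%C - A l) / k n)%C).
  assert (Qh : forall h n, Cmod h <= eta ->
     Cmod (A (l + h)%C - A l - h * q n) <= B * Cmod h * Cmod (h - k n)).
  { intros h n Hh. specialize (Q h (k n) Hh (Lk n)).
    apply Rmult_le_reg_l with (Cmod (k n)); [apply Pk|]. rewrite <- Cmod_mult.
    replace (k n * (A (l + h)%C - A l - h * q n))%C with
      (k n * (A (l + h)%C - A l) - h * (A (l + k n)%C - A l))%C by (unfold q; field; apply Nk).
    eapply Rle_trans; [exact Q|]. right; ring. }
  destruct (ccv_exists q) as [D HD].
  { intros eps Heps.
    destruct (Zk (eps / (2 * B) / 2)) as [N HN]; [apply Rdiv_lt_0_compat; [apply Rdiv_lt_0_compat|]; lra|].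
    exists N. intros n m Hnn Hmm.
    (* Taking the increment [k m] itself turns the bound into a comparison of two difference
       quotients. *)
    pose proof (Qh (k m) n (Lk m)) as T.
    replace (A (l + k m)%C - A l - k m * q n)%C with (k m * (q m - q n))%C in T
      by (unfold q; field; split; apply Nk).
    rewrite Cmod_mult in T.
    assert (T2 : Cmod (q m - q n) <= B * Cmod (k m - k n)).
    { apply Rmult_le_reg_l with (Cmod (k m)); [apply Pk|]. lra. }
    pose proof (HN n Hnn) as E1. pose proof (HN m Hmm) as E2.
    pose proof (Cmod_sub_triangle (k m) 0 (k n)) as E3.
    rewrite (Cmod_sub_sym 0 (k n)) in E3. rewrite Cmod_sub_sym.
    replace (eps / (2 * B) / 2) with (eps / (4 * B)) in * by (field; lra).
    assert (E4 : B * (eps / (4 * B) + eps / (4 * B)) = eps / 2) by (field; lra). nra. }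
  exists D. apply is_derive_C_eps. intros eps Heps.
  set (d := Rmin eta (eps / B)).
  assert (Hd : 0 < d) by (apply Rmin_pos; [exact He|apply Rdiv_lt_0_compat; lra]).
  exists d. split; [exact Hd|]. intros h Hh.
  assert (H1 : Cmod h <= eta) by (left; eapply Rlt_le_trans; [exact Hh|apply Rmin_l]).
  assert (H2 : Cmod h <= eps / B) by (left; eapply Rlt_le_trans; [exact Hh|apply Rmin_r]).
  apply Rle_div_r in H2; [|lra].
  apply Rle_trans with (B * Cmod h * Cmod h); [|pose proof (Cmod_ge_0 h); nra].
  replace (A (l + h)%C - A l - D * h)%C with ((A (l + h)%C - A l - h * D) - 0)%C by ring.
  apply le_epsilon. intros r Hr.
  assert (L : ccv (fun n => A (l + h)%C - A l - h * q n)%C (A (l + h)%C - A l - h * D)%C).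
  { apply flim_minus; filter_tc; [apply flim_const; filter_tc|].
    apply flim_scal; filter_tc. exact HD. }
  pose proof (Cmod_ge_0 h) as Hh0.
  apply (ccv_Cmod_le _ _ _ _ L).
  destruct (Zk (r / (B * Cmod h + 1))) as [N HN]; [apply Rdiv_lt_0_compat; nra|].
  exists N. intros n Hnn. specialize (HN n Hnn).
  replace (A (l + h)%C - A l - h * q n - 0)%C with (A (l + h)%C - A l - h * q n)%C by ring.
  eapply Rle_trans; [apply Qh, H1|].
  pose proof (Cmod_minus_le h (k n)) as T. replace (k n - 0)%C with (k n) in HN by ring.
  apply Rlt_div_r in HN; [|nra].
  assert (0 <= B * Cmod h) by nra.
  apply Rle_trans with (B * Cmod h * (Cmod h + Cmod (k n))); [apply Rmult_le_compat_l; lra|].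
  pose proof (Cmod_ge_0 (k n)). nra.
Qed.

Lemma limit_is_alpha q f f1 f2 Mn R0 A :
  approximates q f f1 f2 Mn R0 -> ucv lower (alphas f f1 Mn) A -> is_alpha q A.
Proof.
  intros Hap HA. split; [|split].
  - intros l. exact (limit_alpha_transition q f f1 f2 Mn R0 Hap l A HA).
  - apply continuous_on_eps. intros z Hz. exact (limit_alpha_continuous _ _ _ _ _ _ Hap A HA z Hz).
  - apply (second_difference_derivable A (exp (2 * kap R0))).
    intros eta l h k. exact (limit_alpha_second_difference _ _ _ _ _ _ Hap A HA eta l h k).
Qed.

(** * Control by the norm of H^{2,2} *)

Lemma w11_le_ext f f1 g g1 s : (forall t, f t = g t) -> (forall t, f1 t = g1 t) ->
  w11_le f f1 s -> w11_le g g1 s.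
Proof.
  intros E E1 H a b Hab. specialize (H a b Hab).
  erewrite (RInt_ext (V := R_CompleteNormedModule)); [exact H|].
  intros x _. simpl. rewrite E, E1. reflexivity.
Qed.

Lemma w11_le_mono f f1 s s' : s <= s' -> w11_le f f1 s -> w11_le f f1 s'.
Proof. intros Hs H a b Hab. specialize (H a b Hab). lra. Qed.

Lemma w11_le_plus f f1 f2 M g g1 g2 M' s s' :
  admissible f f1 f2 M -> admissible g g1 g2 M' -> w11_le f f1 s -> w11_le g g1 s' ->
  w11_le (fun t => f t + g t)%C (fun t => f1 t + g1 t)%C (s + s').
Proof.
  intros Ha Ha' Hw Hw' a b Hab.
  apply Rle_trans with (RInt (fun t => (Cmod (f t) + Cmod (f1 t)) + (Cmod (g t) + Cmod (g1 t))) a b).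
  - apply RInt_le_cont; auto.
    + apply (adm_weight _ _ _ _ (admissible_plus _ _ _ _ _ _ _ _ Ha Ha')).
    + intros t; apply cont_plus; [apply (adm_weight _ _ _ _ Ha)|apply (adm_weight _ _ _ _ Ha')].
    + intros t. pose proof (Cmod_triangle (f t) (g t)). pose proof (Cmod_triangle (f1 t) (g1 t)). lra.
  - rewrite RInt_plus_cont.
    + specialize (Hw a b Hab). specialize (Hw' a b Hab). lra.
    + apply (adm_weight _ _ _ _ Ha).
    + apply (adm_weight _ _ _ _ Ha').
Qed.

Lemma RInt_zero_on (g : R -> R) a b :
  a <= b -> (forall t, a < t < b -> g t = 0) -> RInt g a b = 0.
Proof.
  intros Hab Hz. rewrite (RInt_ext (V := R_CompleteNormedModule) g (fun _ => 0)).
  - rewrite RInt_const_R. apply Rmult_0_r.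
  - intros x Hx. rewrite Rmin_left, Rmax_right in Hx by lra. apply Hz, Hx.
Qed.

Lemma RInt_extend_support (g : R -> R) M L a b :
  (forall t, continuous g t) -> (forall t, M < Rabs t -> g t = 0) ->
  0 <= M <= L -> a <= - L -> L <= b -> RInt g a b = RInt g (- L) L.
Proof.
  intros Cg Z HL Ha Hb.
  rewrite <- (RInt_Chasles (V := R_CompleteNormedModule) g a (- L) b) by (apply ex_RInt_cont, Cg).
  rewrite <- (RInt_Chasles (V := R_CompleteNormedModule) g (- L) L b) by (apply ex_RInt_cont, Cg).
  rewrite (RInt_zero_on g a (- L)), (RInt_zero_on g L b); auto.
  - unfold plus; simpl. ring.
  - intros t Ht. apply Z. rewrite Rabs_pos_eq; lra.
  - intros t Ht. apply Z. rewrite <- Rabs_Ropp, Rabs_pos_eq; lra.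
Qed.

Lemma RInt_gen_compact_support (g : R -> R) M L :
  (forall t, continuous g t) -> (forall t, M < Rabs t -> g t = 0) -> 0 <= M <= L ->
  RInt_gen g (Rbar_locally m_infty) (Rbar_locally p_infty) = RInt g (- L) L.
Proof.
  intros Cg Z HL.
  apply (is_RInt_gen_unique (V := R_CompleteNormedModule)).
  intros P HP. apply (Filter_prod _ _ _ (fun a => a < - L) (fun b => L < b)).
  - exists (- L). auto.
  - exists L. auto.
  - intros a b Ha Hb. exists (RInt g (- L) L). split.
    + simpl. rewrite <- (RInt_extend_support g M L a b); auto; try lra.
      apply (RInt_correct (V := R_CompleteNormedModule)), ex_RInt_cont, Cg.
    + apply (locally_singleton _ _ HP).
Qed.

Lemma L2_norm_sq (f : R -> C) M L :
  (forall t, ccont f t) -> (forall t, M < Rabs t -> f t = RtoC 0) -> 0 <= M <= L ->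
  L2_norm f ^ 2 = RInt (fun t => Cmod (f t) ^ 2) (- L) L.
Proof.
  intros Cf Z HL. unfold L2_norm.
  rewrite (RInt_gen_compact_support (fun t => Cmod (f t) ^ 2) M L); auto.
  - apply pow2_sqrt. apply RInt_nonneg; [intros; apply cont_Cmod2, Cf|intros; apply pow2_ge_0|lra].
  - intros; apply cont_Cmod2, Cf.
  - intros t Ht. rewrite Z by exact Ht. rewrite Cmod_0. ring.
Qed.

(** The integral is a difference of arctangents, hence less than pi, rounded up to 4. *)
Lemma RInt_inv_1_sq_le a b : a <= b -> RInt (fun t => / (1 + t ^ 2)) a b <= 4.
Proof.
  intros Hab.
  assert (E : RInt (fun t => / (1 + t ^ 2)) a b = atan b - atan a).
  { apply (is_RInt_unique (V := R_CompleteNormedModule)).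
    apply (is_RInt_derive (V := R_CompleteNormedModule) atan (fun t => / (1 + t ^ 2))).
    - intros x _. apply is_derive_Reals.
      apply derivable_pt_lim_atan.
    - intros x _. apply cont_inv; [apply cont_plus; [apply cont_const|apply cont_pow, cont_id]|].
      pose proof (pow2_ge_0 x). lra. }
  rewrite E. pose proof (atan_bound a). pose proof (atan_bound b). pose proof PI_4. lra.
Qed.

Section NormBound.
Variables (f f1 f2 : R -> C) (M N : R).
Hypothesis Ha : admissible f f1 f2 M.

Lemma second_derivative_eq t : second_derivative f t = f2 t.
Proof.
  destruct Ha as (_ & D0 & D1 & _ & _). unfold second_derivative.
  apply C_eq_parts; simpl.
  - rewrite (Derive_ext _ (fun x => Re (f1 x))) by (intros x; apply is_derive_unique, D0).
    apply is_derive_unique, D1.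
  - rewrite (Derive_ext _ (fun x => Im (f1 x))) by (intros x; apply is_derive_unique, D0).
    apply is_derive_unique, D1.
Qed.

Hypothesis HN : test_norm f < N.

Lemma test_norm_integrals : 0 < N /\ forall L, M <= L ->
  RInt (fun t => (1 + t ^ 2) ^ 2 * Cmod (f t) ^ 2) (- L) L <= N ^ 2 /\
  RInt (fun t => Cmod (f2 t) ^ 2) (- L) L <= N ^ 2.
Proof.
  pose proof Ha as (HM & D0 & D1 & C2 & Z).
  assert (N0 : 0 < N) by (eapply Rle_lt_trans; [apply sqrt_pos|exact HN]).
  split; [exact N0|]. intros L HL.
  assert (Q : L2_norm (fun x => RtoC (1 + x ^ 2) * f x)%C ^ 2 + L2_norm (second_derivative f) ^ 2 <= N ^ 2).
  { rewrite <- (pow2_sqrt (_ + _)).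
    - apply pow_incr. split; [apply sqrt_pos|left; exact HN].
    - pose proof (pow2_ge_0 (L2_norm (fun x => RtoC (1 + x ^ 2) * f x)%C)).
      pose proof (pow2_ge_0 (L2_norm (second_derivative f))). lra. }
  assert (E1 : L2_norm (second_derivative f) = L2_norm f2).
  { unfold L2_norm. f_equal. f_equal. apply FunctionalExtensionality.functional_extensionality.
    intros x. rewrite second_derivative_eq. reflexivity. }
  rewrite E1 in Q.
  rewrite (L2_norm_sq _ M L), (L2_norm_sq f2 M L) in Q; auto.
  - assert (E2 : RInt (fun t => Cmod (RtoC (1 + t ^ 2) * f t) ^ 2) (- L) L =
       RInt (fun t => (1 + t ^ 2) ^ 2 * Cmod (f t) ^ 2) (- L) L).
    { apply (RInt_ext (V := R_CompleteNormedModule)). intros x _.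
      rewrite Cmod_mult, Cmod_R, Rpow_mult_distr, pow2_abs. reflexivity. }
    rewrite E2 in Q.
    assert (0 <= RInt (fun t => (1 + t ^ 2) ^ 2 * Cmod (f t) ^ 2) (- L) L).
    { apply RInt_nonneg; try lra.
      - intros t. apply cont_mult; [|apply cont_Cmod2, (adm_phi _ _ _ _ Ha)].
        apply cont_pow, cont_plus; [apply cont_const|apply cont_pow, cont_id].
      - intros t. apply Rmult_le_pos; apply pow2_ge_0. }
    assert (0 <= RInt (fun t => Cmod (f2 t) ^ 2) (- L) L).
    { apply RInt_nonneg; try lra; [intros; apply cont_Cmod2, C2|intros; apply pow2_ge_0]. }
    lra.
  - intros t Ht. apply Z, Ht.
  - intros t. apply ccont_mult; [|apply (adm_phi _ _ _ _ Ha)].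
    apply ccont_RtoC, cont_plus; [apply cont_const|apply cont_pow, cont_id].
  - intros t Ht. destruct (Z t Ht) as (-> & _). ring.
Qed.

(* Integration by parts: [F = (1 + x^2) Re (conj f * f')] vanishes at both ends. *)
Lemma weighted_derivative_integral L : M < L ->
  RInt (fun t => (1 + t ^ 2) * Cmod (f1 t) ^ 2) (- L) L <= 6 * N ^ 2.
Proof.
  intros HL. destruct test_norm_integrals as [N0 I]. destruct (I L ltac:(lra)) as [I0 I2].
  pose proof Ha as (HM & D0 & D1 & C2 & Z).
  assert (Cw : forall t, continuous (fun t : R => 1 + t ^ 2) t).
  { intros t. apply cont_plus; [apply cont_const|apply cont_pow, cont_id]. }
  assert (Cp : forall t, continuous (fun t => (1 + t ^ 2) * Cmod (f1 t) ^ 2) t).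
  { intros t. apply cont_mult; [apply Cw|apply cont_Cmod2, (adm_phi1 _ _ _ _ Ha)]. }
  assert (Cf : forall t, continuous (fun t => (1 + t ^ 2) ^ 2 * Cmod (f t) ^ 2) t).
  { intros t. apply cont_mult; [apply cont_pow, Cw|apply cont_Cmod2, (adm_phi _ _ _ _ Ha)]. }
  assert (Cf2 : forall t, continuous (fun t => Cmod (f2 t) ^ 2) t) by (intros; apply cont_Cmod2, C2).
  set (p := fun t => (Cconj (f t) * f1 t)%C).
  set (p' := fun t => (Cconj (f1 t) * f1 t + Cconj (f t) * f2 t)%C).
  assert (Dp : forall t, cder p t (p' t)) by (intros t; apply cder_mult; [apply cder_conj, D0|apply D1]).
  (* The weights make [G] nondecreasing: the derivative of the weight [1 + t ^ 2] costs [2 |f|^2],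
     the term with [f2] costs half of each square, and half of the weighted [|f1|^2] is retained.
     Comparing the ends gives [6 = 2 * (5/2 + 1/2)]. *)
  set (G := fun t => (1 + t ^ 2) * Re (p t) + (5 / 2 * RInt (fun t => (1 + t ^ 2) ^ 2 * Cmod (f t) ^ 2) (- L) t
    + (/ 2 * RInt (fun t => Cmod (f2 t) ^ 2) (- L) t - / 2 * RInt (fun t => (1 + t ^ 2) * Cmod (f1 t) ^ 2) (- L) t))).
  set (G' := fun t => (2 * t * Re (p t) + (1 + t ^ 2) * Re (p' t)) + (5 / 2 * ((1 + t ^ 2) ^ 2 * Cmod (f t) ^ 2)
    + (/ 2 * Cmod (f2 t) ^ 2 - / 2 * ((1 + t ^ 2) * Cmod (f1 t) ^ 2)))).
  assert (HG : G (- L) <= G L).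
  { apply (derive_nonneg_le G G'); [lra| |].
    - intros t _.
      apply (is_derive_plus (K := R_AbsRing) (V := R_NormedModule)).
      { apply (is_derive_mult_R (fun t => 1 + t ^ 2) (fun t => Re (p t))).
        - auto_derive; auto. ring.
        - exact (proj1 (Dp t)). }
      apply (is_derive_plus (K := R_AbsRing) (V := R_NormedModule)).
      { apply (is_derive_scal (fun x => RInt (fun t => (1 + t ^ 2) ^ 2 * Cmod (f t) ^ 2) (- L) x)). exact (is_derive_RInt_upper _ (- L) t Cf). }
      apply (is_derive_minus (K := R_AbsRing) (V := R_NormedModule)).
      { apply (is_derive_scal (fun x => RInt (fun t => Cmod (f2 t) ^ 2) (- L) x)). exact (is_derive_RInt_upper _ (- L) t Cf2). }
      { apply (is_derive_scal (fun x => RInt (fun t => (1 + t ^ 2) * Cmod (f1 t) ^ 2) (- L) x)). exact (is_derive_RInt_upper _ (- L) t Cp). }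
    - intros t _. unfold G', p, p'.
      pose proof (re_le_Cmod (Cconj (f t) * f1 t)) as R1. apply Rabs_le_between in R1.
      rewrite Cmod_mult, Cmod_conj in R1.
      pose proof (Re_ge_opp_Cmod (Cconj (f t) * f2 t)) as R2. rewrite Cmod_mult, Cmod_conj in R2.
      assert (R3 : Re (Cconj (f1 t) * f1 t)%C = Cmod (f1 t) ^ 2).
      { rewrite Cmult_comm, <- Cmod2_conj. reflexivity. }
      rewrite Re_plus, R3.
      set (a := Cmod (f t)) in *. set (b := Cmod (f1 t)) in *. set (c := Cmod (f2 t)) in *.
      set (r := Re (Cconj (f t) * f1 t)%C) in *. set (r2 := Re (Cconj (f t) * f2 t)%C) in *.
      assert (A0 : 0 <= a) by apply Cmod_ge_0. assert (B0 : 0 <= b) by apply Cmod_ge_0.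
      assert (C0 : 0 <= c) by apply Cmod_ge_0.
      set (w := 1 + t ^ 2). pose proof (pow2_ge_0 t) as T2. assert (W1 : 1 <= w) by (unfold w; lra).
      assert (S1 : - (/ 2 * t ^ 2 * b ^ 2 + 2 * a ^ 2) <= 2 * t * r).
      { assert (- (2 * (Rabs t * (a * b))) <= 2 * t * r).
        { assert (Rabs (t * r) <= Rabs t * (a * b)).
          { rewrite Rabs_mult. apply Rmult_le_compat_l; [apply Rabs_pos|]. apply Rabs_le; lra. }
          pose proof (Rle_abs (- (t * r))) as Q. rewrite Rabs_Ropp in Q. lra. }
        pose proof (Rle_0_sqr (Rabs t * b - 2 * a)) as Q. unfold Rsqr in Q.
        rewrite <- (pow2_abs t). nra. }
      assert (S2 : - (/ 2 * w ^ 2 * a ^ 2 + / 2 * c ^ 2) <= w * r2).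
      { pose proof (Rle_0_sqr (w * a - c)) as Q. unfold Rsqr in Q.
        assert (- (w * (a * c)) <= w * r2) by nra. nra. }
      assert (S3 : a ^ 2 <= w ^ 2 * a ^ 2).
      { assert (1 <= w ^ 2) by nra. pose proof (pow2_ge_0 a). nra. }
      replace (w * (b ^ 2 + r2)) with (w * b ^ 2 + w * r2) by ring.
      assert (S4 : w * b ^ 2 = b ^ 2 + t ^ 2 * b ^ 2) by (unfold w; ring).
      pose proof (pow2_ge_0 b). lra. }
  assert (ZL : forall x, Rabs x = L -> Re (p x) = 0).
  { intros x Hx. unfold p. destruct (Z x) as (E0 & _); [lra|]. rewrite E0. simpl. ring. }
  unfold G in HG. rewrite (ZL L), (ZL (- L)) in HG.
  - rewrite !(RInt_point (V := R_CompleteNormedModule)) in HG. unfold zero in HG; simpl in HG. simpl in I0, I2 |- *. lra.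
  - rewrite Rabs_Ropp, Rabs_pos_eq; lra.
  - rewrite Rabs_pos_eq; lra.
Qed.

(** Cauchy-Schwarz against the integrable weight [1 / (1 + t ^ 2)], in Young's form scaled by [N].
    The three integrals contribute at most [4 N], [N / 2] and [3 N], which 8 covers. *)
Lemma test_norm_w11 : w11_le f f1 (8 * N).
Proof.
  intros a b Hab. destruct test_norm_integrals as [N0 I].
  pose proof Ha as (HM & _).
  set (L := Rmax (M + 1) (Rmax (- a) b)).
  assert (HL : M < L /\ - L <= a /\ b <= L).
  { unfold L. pose proof (Rmax_l (M + 1) (Rmax (- a) b)). pose proof (Rmax_r (M + 1) (Rmax (- a) b)).
    pose proof (Rmax_l (- a) b). pose proof (Rmax_r (- a) b). lra. }
  destruct HL as (HL & HLa & HLb). destruct (I L ltac:(lra)) as [I0 _].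
  pose proof (weighted_derivative_integral L HL) as I1.
  assert (Cw : forall t, continuous (fun t : R => 1 + t ^ 2) t).
  { intros t. apply cont_plus; [apply cont_const|apply cont_pow, cont_id]. }
  assert (Ci' : forall t, continuous (fun t : R => / (1 + t ^ 2)) t).
  { intros t. apply cont_inv; [apply Cw|]. pose proof (pow2_ge_0 t). lra. }
  assert (Cp : forall t, continuous (fun t => (1 + t ^ 2) * Cmod (f1 t) ^ 2) t).
  { intros t. apply cont_mult; [apply Cw|apply cont_Cmod2, (adm_phi1 _ _ _ _ Ha)]. }
  assert (Cf : forall t, continuous (fun t => (1 + t ^ 2) ^ 2 * Cmod (f t) ^ 2) t).
  { intros t. apply cont_mult; [apply cont_pow, Cw|apply cont_Cmod2, (adm_phi _ _ _ _ Ha)]. }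
  assert (Sh : forall g, (forall t, continuous g t) -> (forall t, 0 <= g t) -> RInt g a b <= RInt g (- L) L).
  { intros g Cg Pg.
    rewrite <- (RInt_Chasles (V := R_CompleteNormedModule) g (- L) a L) by (apply ex_RInt_cont, Cg).
    rewrite <- (RInt_Chasles (V := R_CompleteNormedModule) g a b L) by (apply ex_RInt_cont, Cg).
    pose proof (RInt_nonneg g (- L) a Cg Pg HLa). pose proof (RInt_nonneg g b L Cg Pg HLb).
    unfold plus; simpl. lra. }
  pose proof (Sh _ Cf (fun t => Rmult_le_pos _ _ (pow2_ge_0 _) (pow2_ge_0 _))) as J0.
  assert (J1 : RInt (fun t => (1 + t ^ 2) * Cmod (f1 t) ^ 2) a b <= 6 * N ^ 2).
  { eapply Rle_trans; [apply Sh; [exact Cp|]|exact I1].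
    intros t. pose proof (pow2_ge_0 t). apply Rmult_le_pos; [lra|apply pow2_ge_0]. }
  pose proof (RInt_inv_1_sq_le a b Hab) as J2.
  apply Rle_trans with (RInt (fun t => N * / (1 + t ^ 2) + (/ (2 * N) * ((1 + t ^ 2) ^ 2 * Cmod (f t) ^ 2)
     + / (2 * N) * ((1 + t ^ 2) * Cmod (f1 t) ^ 2))) a b).
  - apply RInt_le_cont; auto.
    + apply (adm_weight _ _ _ _ Ha).
    + intros t. apply cont_plus; [apply cont_mult; [apply cont_const|apply Ci']|].
      apply cont_plus; (apply cont_mult; [apply cont_const|]); [apply Cf|apply Cp].
    + intros t. pose proof (pow2_ge_0 t) as T2. set (w := 1 + t ^ 2). assert (W : 1 <= w) by (unfold w; lra).
      assert (Q : forall x, 0 <= x -> x <= / 2 * (N * / w) + / (2 * N) * (w * x ^ 2)).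
      { intros x Hx. pose proof (two_mul_le_scaled 1 x (w / N) ltac:(apply Rdiv_lt_0_compat; lra)) as T.
        replace (1 ^ 2 / (w / N) + w / N * x ^ 2) with (2 * (/ 2 * (N * / w) + / (2 * N) * (w * x ^ 2))) in T by (field; lra).
        lra. }
      pose proof (Q _ (Cmod_ge_0 (f t))) as Q0. pose proof (Q _ (Cmod_ge_0 (f1 t))) as Q1.
      assert (/ (2 * N) * (w * Cmod (f t) ^ 2) <= / (2 * N) * (w ^ 2 * Cmod (f t) ^ 2)).
      { apply Rmult_le_compat_l; [left; apply Rinv_0_lt_compat; lra|].
        apply Rmult_le_compat_r; [apply pow2_ge_0|nra]. }
      lra.
  - rewrite RInt_plus_cont, RInt_plus_cont, !RInt_scal_cont; auto.
    + assert (K : forall y c, y <= c * N ^ 2 -> / (2 * N) * y <= c / 2 * N).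
      { intros y c Hy. replace (c / 2 * N) with (/ (2 * N) * (c * N ^ 2)) by (field; lra).
        apply Rmult_le_compat_l; [left; apply Rinv_0_lt_compat; lra|exact Hy]. }
      pose proof (K _ 6 J1) as K1. pose proof (K _ 1 ltac:(rewrite Rmult_1_l; eapply Rle_trans; [exact J0|exact I0])) as K0.
      assert (N * RInt (fun t => / (1 + t ^ 2)) a b <= N * 4) by (apply Rmult_le_compat_l; lra). simpl in *. lra.
    + intros t. apply cont_mult; [apply cont_const|apply Cf].
    + intros t. apply cont_mult; [apply cont_const|apply Cp].
    + intros t. apply cont_mult; [apply cont_const|apply Ci'].
    + intros t. apply cont_plus; (apply cont_mult; [apply cont_const|]); [apply Cf|apply Cp].
Qed.
End NormBound.

(** * Cauchy's theorem on squares and boundary uniqueness *)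

(** Continuity is asked on the whole plane because the integration lemmas want integrands continuous
    on whole lines; a function on a half-plane has to be extended first. *)
Definition continuous_C (f : C -> C) : Prop :=
  forall z eps, 0 < eps -> exists d, 0 < d /\ forall w, Cmod (w - z) < d -> Cmod (f w - f z) < eps.

Definition deriv_C (f : C -> C) (z l : C) : Prop :=
  forall eps, 0 < eps -> exists d, 0 < d /\
    forall h, Cmod h < d -> Cmod (f (z + h)%C - f z - l * h) <= eps * Cmod h.

Lemma continuous_C_lines f : continuous_C f ->
  (forall y t, ccont (fun t => f (t, y)) t) /\ (forall x t, ccont (fun t => f (x, t)) t).
Proof.
  intros H.
  assert (S : forall (g : R -> C) (p : R -> C) t, (forall u, g u = f (p u)) ->
     (forall u, Cmod (p u - p t) = Rabs (u - t)) -> ccont g t).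
  { intros g p t E Ep. split.
    - intros P [e He]. destruct (H (p t) e (cond_pos e)) as (d & Hd & K).
      exists (mkposreal d Hd). intros u Hu. apply He.
      change (Rabs (Re (g u) - Re (g t)) < e). rewrite <- Re_minus, !E.
      eapply Rle_lt_trans; [apply re_le_Cmod|]. apply K. rewrite Ep. exact Hu.
    - intros P [e He]. destruct (H (p t) e (cond_pos e)) as (d & Hd & K).
      exists (mkposreal d Hd). intros u Hu. apply He.
      change (Rabs (Im (g u) - Im (g t)) < e). rewrite <- Im_minus, !E.
      eapply Rle_lt_trans; [apply im_le_Cmod|]. apply K. rewrite Ep. exact Hu. }
  split.
  - intros y t. apply (S _ (fun u => (u, y))); [reflexivity|].
    intros u. rewrite <- Cmod_R. f_equal. apply C_eq_parts; simpl; ring.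
  - intros x t. apply (S _ (fun u => (x, u))); [reflexivity|].
    intros u. transitivity (Cmod (Ci * RtoC (u - t))).
    + f_equal. apply C_eq_parts; simpl; ring.
    + rewrite Cmod_mult, Cmod_Ci, Cmod_R. ring.
Qed.

Lemma deriv_C_bounded_quotient f z l : deriv_C f z l -> exists d, 0 < d /\
  forall h, Cmod h < d -> Cmod (f (z + h)%C - f z) <= (Cmod l + 1) * Cmod h.
Proof.
  intros H. destruct (H 1 Rlt_0_1) as (d & Hd & K). exists d. split; [exact Hd|].
  intros h Hh. specialize (K h Hh).
  replace (f (z + h)%C - f z)%C with ((f (z + h)%C - f z - l * h) + l * h)%C by ring.
  eapply Rle_trans; [apply Cmod_triangle|]. rewrite Cmod_mult. lra.
Qed.

Lemma deriv_C_mult f g z l m : deriv_C f z l -> deriv_C g z m ->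
  deriv_C (fun w => f w * g w)%C z (l * g z + f z * m)%C.
Proof.
  intros Hf Hg eps He.
  destruct (deriv_C_bounded_quotient _ _ _ Hg) as (d0 & Hd0 & Q).
  pose proof (Cmod_ge_0 (g z)) as G0. pose proof (Cmod_ge_0 (f z)) as F0.
  pose proof (Cmod_ge_0 l) as L0. pose proof (Cmod_ge_0 m) as M0.
  set (k := Cmod (g z) + (Cmod m + 1) + Cmod (f z) + 1). assert (Hk : 0 < k) by (unfold k; lra).
  assert (He3 : 0 < eps / (3 * k)) by (apply Rdiv_lt_0_compat; lra).
  destruct (Hf _ He3) as (d1 & Hd1 & K1). destruct (Hg _ He3) as (d2 & Hd2 & K2).
  set (d3 := eps / (3 * ((Cmod l + 1) * (Cmod m + 1)))).
  assert (Hlm : 0 < (Cmod l + 1) * (Cmod m + 1)) by (apply Rmult_lt_0_compat; lra).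
  assert (Hd3 : 0 < d3) by (apply Rdiv_lt_0_compat; lra).
  exists (Rmin (Rmin d0 d1) (Rmin d2 (Rmin d3 1))). split; [repeat apply Rmin_pos; lra|].
  intros h Hh.
  assert (B : Cmod h < d0 /\ Cmod h < d1 /\ Cmod h < d2 /\ Cmod h < d3 /\ Cmod h < 1).
  { pose proof (Rmin_l (Rmin d0 d1) (Rmin d2 (Rmin d3 1))). pose proof (Rmin_r (Rmin d0 d1) (Rmin d2 (Rmin d3 1))).
    pose proof (Rmin_l d0 d1). pose proof (Rmin_r d0 d1). pose proof (Rmin_l d2 (Rmin d3 1)).
    pose proof (Rmin_r d2 (Rmin d3 1)). pose proof (Rmin_l d3 1). pose proof (Rmin_r d3 1).
    repeat split; lra. }
  destruct B as (B0 & B1 & B2 & B3 & B4).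
  specialize (Q h B0). specialize (K1 h B1). specialize (K2 h B2).
  replace (f (z + h)%C * g (z + h)%C - f z * g z - (l * g z + f z * m) * h)%C with
    ((f (z + h)%C - f z - l * h) * g (z + h)%C + l * h * (g (z + h)%C - g z) + f z * (g (z + h)%C - g z - m * h))%C by ring.
  pose proof (Cmod_ge_0 h) as H0.
  assert (Gz : Cmod (g (z + h)%C) <= Cmod (g z) + (Cmod m + 1)).
  { pose proof (Cmod_reverse_triangle (g (z + h)%C) (g z)). nra. }
  eapply Rle_trans; [apply Cmod_triangle|].
  eapply Rle_trans; [apply Rplus_le_compat_r, Cmod_triangle|]. rewrite !Cmod_mult.
  set (A := Cmod (f (z + h)%C - f z - l * h)) in *. set (D := Cmod (g (z + h)%C - g z)) in *.
  set (E := Cmod (g (z + h)%C - g z - m * h)) in *. set (X := Cmod (g (z + h)%C)) in *.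
  assert (A0 : 0 <= A) by apply Cmod_ge_0. assert (X0 : 0 <= X) by apply Cmod_ge_0.
  assert (E0 : 0 <= E) by apply Cmod_ge_0.
  assert (T : k * (eps / (3 * k)) = eps / 3) by (field; lra). set (e3 := eps / (3 * k)) in *.
  assert (T1 : A * X <= eps / 3 * Cmod h).
  { rewrite <- T. apply Rle_trans with (e3 * Cmod h * k).
    - apply Rmult_le_compat; try assumption. unfold k; lra.
    - right; ring. }
  assert (T3 : Cmod (f z) * E <= eps / 3 * Cmod h).
  { rewrite <- T. apply Rle_trans with (k * (e3 * Cmod h)).
    - apply Rmult_le_compat; try assumption. unfold k; lra.
    - right; ring. }
  assert (T2 : Cmod l * Cmod h * D <= eps / 3 * Cmod h).
  { apply Rle_trans with (Cmod l * Cmod h * ((Cmod m + 1) * Cmod h)).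
    - apply Rmult_le_compat_l; [apply Rmult_le_pos; assumption|exact Q].
    - assert (T4 : (Cmod l + 1) * (Cmod m + 1) * d3 = eps / 3) by (unfold d3; field; lra).
      rewrite <- T4. apply Rle_trans with ((Cmod l * (Cmod m + 1) * d3) * Cmod h).
      + replace (Cmod l * Cmod h * ((Cmod m + 1) * Cmod h)) with ((Cmod l * (Cmod m + 1) * Cmod h) * Cmod h) by ring.
        apply Rmult_le_compat_r; [exact H0|]. apply Rmult_le_compat_l; [apply Rmult_le_pos; lra|lra].
      + apply Rmult_le_compat_r; [exact H0|]. apply Rmult_le_compat_r; [lra|]. apply Rmult_le_compat_r; lra. }
  lra.
Qed.

Lemma deriv_C_affine_comp f a b z l : deriv_C f (a + b * z)%C l -> Cmod b = 1 ->
  deriv_C (fun w => f (a + b * w)%C) z (l * b)%C.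
Proof.
  intros H Hb eps He. destruct (H eps He) as (d & Hd & K). exists d. split; [exact Hd|].
  intros h Hh. specialize (K (b * h)%C). rewrite Cmod_mult, Hb, Rmult_1_l in K. specialize (K Hh).
  replace (a + b * (z + h))%C with (a + b * z + b * h)%C by ring.
  replace (l * b * h)%C with (l * (b * h))%C by ring. exact K.
Qed.

Lemma deriv_C_ext_loc f g z l r : 0 < r -> (forall w, Cmod (w - z) < r -> f w = g w) ->
  deriv_C f z l -> deriv_C g z l.
Proof.
  intros Hr E H eps He. destruct (H eps He) as (d & Hd & K).
  exists (Rmin d r). split; [apply Rmin_pos; assumption|].
  intros h Hh. pose proof (Rmin_l d r). pose proof (Rmin_r d r).
  rewrite <- !E.
  - apply K. lra.
  - replace (z - z)%C with (RtoC 0) by ring. rewrite Cmod_0. exact Hr.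
  - replace (z + h - z)%C with h by ring. lra.
Qed.

Lemma deriv_C_inv z : z <> RtoC 0 -> deriv_C Cinv z (- (/ z * / z))%C.
Proof.
  intros Hz eps He. pose proof (proj1 (Cmod_gt_0 z) Hz) as Hm.
  set (c := Cmod z) in *.
  exists (Rmin (c / 2) (eps * c ^ 3 / 2)).
  assert (Hc3 : 0 < c ^ 3) by (apply pow_lt; exact Hm).
  split; [apply Rmin_pos; nra|].
  intros h Hh. pose proof (Rmin_l (c / 2) (eps * c ^ 3 / 2)). pose proof (Rmin_r (c / 2) (eps * c ^ 3 / 2)).
  pose proof (Cmod_reverse_triangle z (- h)) as Q. rewrite Cmod_opp in Q.
  replace (z - - h)%C with (z + h)%C in Q by ring. fold c in Q.
  assert (Hzh : (z + h)%C <> RtoC 0) by (apply Cmod_gt_0; lra).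
  replace (/ (z + h) - / z - - (/ z * / z) * h)%C with (h * h / (z * z * (z + h)))%C by (field; split; assumption).
  rewrite Cmod_div by (repeat apply Cmult_neq_0; assumption).
  rewrite !Cmod_mult. fold c. pose proof (Cmod_ge_0 h) as H0'.
  assert (0 < c * c * Cmod (z + h)) by (repeat apply Rmult_lt_0_compat; lra).
  apply Rle_div_l; [assumption|].
  replace (eps * Cmod h * (c * c * Cmod (z + h))) with (Cmod h * (eps * (c * c * Cmod (z + h)))) by ring.
  apply Rmult_le_compat_l; [exact H0'|].
  apply Rle_trans with (eps * (c * c * (c / 2))); [simpl in *; lra|].
  apply Rmult_le_compat_l; [lra|]. apply Rmult_le_compat_l; nra.
Qed.

Lemma deriv_C_continuous f z l : deriv_C f z l -> forall eps, 0 < eps -> exists d, 0 < d /\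
  forall w, Cmod (w - z) < d -> Cmod (f w - f z) < eps.
Proof.
  intros H eps He. destruct (deriv_C_bounded_quotient _ _ _ H) as (d & Hd & Q).
  pose proof (Cmod_ge_0 l).
  exists (Rmin d (eps / (Cmod l + 1))). split; [apply Rmin_pos; [exact Hd|apply Rdiv_lt_0_compat; lra]|].
  intros w Hw. pose proof (Rmin_l d (eps / (Cmod l + 1))). pose proof (Rmin_r d (eps / (Cmod l + 1))).
  specialize (Q (w - z)%C ltac:(lra)). replace (z + (w - z))%C with w in Q by ring.
  eapply Rle_lt_trans; [exact Q|]. rewrite Rmult_comm. apply Rlt_div_r; lra.
Qed.

Lemma cint_FTC (P g : R -> C) a b :
  a <= b -> (forall t, ccont g t) -> (forall t, cder P t (g t)) -> cint g a b = (P b - P a)%C.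
Proof.
  intros Hab Cg D.
  pose proof (cder_zero_const (fun t => cint g a t - P t)%C a b Hab) as Z. cbv beta in Z.
  rewrite cint_point in Z.
  assert (E : (0 - P a)%C = (cint g a b - P b)%C).
  { apply Z. intros t _. eapply cder_eq; [apply cder_minus; [apply (cder_cint g a t Cg)|apply D]|ring]. }
  replace (cint g a b) with ((cint g a b - P b) + P b)%C by ring. rewrite <- E. ring.
Qed.

Lemma cint_bound (g : R -> C) a b m :
  a <= b -> (forall t, ccont g t) -> (forall t, a <= t <= b -> Cmod (g t) <= m) ->
  Cmod (cint g a b) <= m * (b - a).
Proof.
  intros Hab Cg Hm.
  replace (cint g a b) with (cint g a b - cint g a a)%C by (rewrite cint_point; ring).
  replace (m * (b - a)) with (m * b - m * a) by ring.
  apply (cder_increment_le (cint g a) g (fun t => m * t) (fun _ => m)); auto.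
  - intros t _. apply (cder_cint g a t Cg).
  - intros t _. auto_derive; auto. ring.
Qed.

Lemma cint_Chasles (g : R -> C) a b c : (forall t, ccont g t) ->
  (cint g a b + cint g b c)%C = cint g a c.
Proof.
  intros Cg. apply C_eq_parts; simpl.
  - apply (RInt_Chasles (V := R_CompleteNormedModule) (fun t => Re (g t)));
      apply ex_RInt_cont; intros t; exact (proj1 (Cg t)).
  - apply (RInt_Chasles (V := R_CompleteNormedModule) (fun t => Im (g t)));
      apply ex_RInt_cont; intros t; exact (proj2 (Cg t)).
Qed.

Lemma cint_minus (g h : R -> C) a b : (forall t, ccont g t) -> (forall t, ccont h t) ->
  cint (fun t => g t - h t)%C a b = (cint g a b - cint h a b)%C.
Proof.
  intros Cg Ch. apply C_eq_parts; simpl.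
  - apply (RInt_minus (V := R_CompleteNormedModule) (fun t => Re (g t)) (fun t => Re (h t)));
      apply ex_RInt_cont; intros t; [exact (proj1 (Cg t))|exact (proj1 (Ch t))].
  - apply (RInt_minus (V := R_CompleteNormedModule) (fun t => Im (g t)) (fun t => Im (h t)));
      apply ex_RInt_cont; intros t; [exact (proj2 (Cg t))|exact (proj2 (Ch t))].
Qed.

Lemma cint_ext (g h : R -> C) a b : (forall t, g t = h t) -> cint g a b = cint h a b.
Proof.
  intros E. unfold cint. f_equal; apply (RInt_ext (V := R_CompleteNormedModule));
    intros t _; rewrite E; reflexivity.
Qed.

(* Contour integral over the boundary of the square with lower left corner [(x, y)] and side [s]. *)
Definition sq (f : C -> C) (x y s : R) : C :=
  (cint (fun t => f (t, y)) x (x + s) - cint (fun t => f (t, y + s)%R) x (x + s)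
   + Ci * (cint (fun t => f (x + s, t)%R) y (y + s) - cint (fun t => f (x, t)) y (y + s)))%C.

(** Only the four lines carrying the sides matter, which admits [Cinv] on a square around its
    pole. *)
Definition edges (f : C -> C) (x y s : R) : Prop :=
  (forall t, ccont (fun t => f (t, y)) t) /\ (forall t, ccont (fun t => f (t, y + s)%R) t) /\
  (forall t, ccont (fun t => f (x + s, t)%R) t) /\ (forall t, ccont (fun t => f (x, t)) t).

Lemma continuous_edges f x y s : continuous_C f -> edges f x y s.
Proof.
  intros H. destruct (continuous_C_lines f H) as [A B].
  exact (conj (A y) (conj (A (y + s)) (conj (B (x + s)) (B x)))).
Qed.

Lemma sq_minus f g x y s : edges f x y s -> edges g x y s ->
  sq (fun z => f z - g z)%C x y s = (sq f x y s - sq g x y s)%C.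
Proof.
  intros (F1 & F2 & F3 & F4) (G1 & G2 & G3 & G4). unfold sq.
  rewrite (cint_minus (fun t => f (t, y)) (fun t => g (t, y))) by assumption.
  rewrite (cint_minus (fun t => f (t, y + s)%R) (fun t => g (t, y + s)%R)) by assumption.
  rewrite (cint_minus (fun t => f (x + s, t)%R) (fun t => g (x + s, t)%R)) by assumption.
  rewrite (cint_minus (fun t => f (x, t)) (fun t => g (x, t))) by assumption.
  ring.
Qed.

Lemma sq_bound f x y s m : 0 <= s -> edges f x y s ->
  (forall a b, x <= a <= x + s -> y <= b <= y + s -> (a = x \/ a = x + s \/ b = y \/ b = y + s) ->
     Cmod (f (a, b)) <= m) ->
  Cmod (sq f x y s) <= 4 * (m * s).
Proof.
  intros Hs (F1 & F2 & F3 & F4) Hm. unfold sq.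
  pose proof (cint_bound (fun t => f (t, y)) x (x + s) m ltac:(lra) F1) as B1.
  pose proof (cint_bound (fun t => f (t, y + s)%R) x (x + s) m ltac:(lra) F2) as B2.
  pose proof (cint_bound (fun t => f (x + s, t)%R) y (y + s) m ltac:(lra) F3) as B3.
  pose proof (cint_bound (fun t => f (x, t)) y (y + s) m ltac:(lra) F4) as B4.
  eapply Rle_trans; [apply Cmod_triangle|]. rewrite Cmod_mult, Cmod_Ci, Rmult_1_l.
  eapply Rle_trans; [apply Rplus_le_compat; apply Cmod_minus_le|].
  replace (x + s - x) with s in * by ring. replace (y + s - y) with s in * by ring.
  assert (C1 := B1 ltac:(intros; apply Hm; auto; lra)).
  assert (C2 := B2 ltac:(intros; apply Hm; auto; lra)).
  assert (C3 := B3 ltac:(intros; apply Hm; auto; lra)).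
  assert (C4 := B4 ltac:(intros; apply Hm; auto; lra)). lra.
Qed.

Lemma sq_split f x y u : continuous_C f ->
  sq f x y (2 * u) = (sq f x y u + sq f (x + u) y u + sq f x (y + u) u + sq f (x + u) (y + u) u)%C.
Proof.
  intros H. destruct (continuous_C_lines f H) as [A B]. unfold sq.
  replace (x + 2 * u) with (x + u + u) by ring. replace (y + 2 * u) with (y + u + u) by ring.
  rewrite <- (cint_Chasles (fun t => f (t, y)) x (x + u) (x + u + u)) by apply A.
  rewrite <- (cint_Chasles (fun t => f (t, y + u + u)%R) x (x + u) (x + u + u)) by apply A.
  rewrite <- (cint_Chasles (fun t => f (x + u + u, t)%R) y (y + u) (y + u + u)) by apply B.
  rewrite <- (cint_Chasles (fun t => f (x, t)) y (y + u) (y + u + u)) by apply B.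
  ring.
Qed.

(** An affine function has the primitive [P]; on vertical sides the parametrization has derivative
    [Ci], so [- Ci * P] takes its place. *)
Lemma sq_affine (c d : C) x y s : 0 <= s -> sq (fun z => c + d * z)%C x y s = RtoC 0.
Proof.
  intros Hs. unfold sq.
  set (P := fun z : C => (c * z + d / 2 * (z * z))%C).
  assert (Dh : forall b t, cder (fun t => (t, b) : C) t (RtoC 1)).
  { intros b t. split; simpl; auto_derive; auto. }
  assert (Dv : forall a t, cder (fun t => (a, t) : C) t Ci).
  { intros a t. split; simpl; auto_derive; auto. }
  assert (PH : forall b t, cder (fun t => P (t, b)) t (c + d * (t, b))%C).
  { intros b t. unfold P. eapply cder_eq.
    - apply cder_plus; apply cder_scal; [apply Dh|apply cder_mult; apply Dh].
    - assert (G : forall z : C, (c * 1 + d / 2 * (1 * z + z * 1))%C = (c + d * z)%C) by (intros z; field).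
      apply G. }
  assert (PV : forall a t, cder (fun t => (- Ci * P (a, t))%C) t (c + d * (a, t))%C).
  { intros a t. unfold P. eapply cder_eq.
    - apply cder_scal. apply cder_plus; apply cder_scal; [apply Dv|apply cder_mult; apply Dv].
    - assert (I2 : (Ci * Ci)%C = (- (1))%C) by (apply C_eq_parts; simpl; ring).
      assert (G : forall z : C, (- Ci * (c * Ci + d / 2 * (Ci * z + z * Ci)))%C = (c + d * z)%C).
      { intros z. transitivity (- (Ci * Ci) * (c + d * z))%C; [field|rewrite I2; ring]. }
      apply G. }
  assert (CH : forall b t, ccont (fun t => c + d * (t, b))%C t).
  { intros b t. apply ccont_plus; [apply ccont_const|]. apply ccont_mult; [apply ccont_const|].
    eapply cder_ccont, Dh. }
  assert (CV : forall b t, ccont (fun t => c + d * (b, t))%C t).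
  { intros b t. apply ccont_plus; [apply ccont_const|]. apply ccont_mult; [apply ccont_const|].
    eapply cder_ccont, Dv. }
  rewrite (cint_FTC (fun t => P (t, y)) _ x (x + s)) by (auto; lra).
  rewrite (cint_FTC (fun t => P (t, y + s)%R) _ x (x + s)) by (auto; lra).
  rewrite (cint_FTC (fun t => - Ci * P (x + s, t)%R)%C _ y (y + s)) by (auto; lra).
  rewrite (cint_FTC (fun t => - Ci * P (x, t))%C _ y (y + s)) by (auto; lra).
  assert (I2 : (Ci * Ci)%C = (- (1))%C) by (apply C_eq_parts; simpl; ring).
  set (p1 := P (x, y)). set (p2 := P (x + s, y)%R). set (p3 := P (x, y + s)%R). set (p4 := P (x + s, y + s)%R).
  transitivity ((p2 - p1) - (p4 - p3) - (Ci * Ci) * ((p4 - p2) - (p3 - p1)))%C; [ring|].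
  rewrite I2. ring.
Qed.

Lemma sq_child f x y u : continuous_C f -> exists x' y',
  (x' = x \/ x' = x + u) /\ (y' = y \/ y' = y + u) /\ Cmod (sq f x y (2 * u)) <= 4 * Cmod (sq f x' y' u).
Proof.
  intros H. pose proof (sq_split f x y u H) as E.
  set (S1 := sq f x y u) in *. set (S2 := sq f (x + u) y u) in *.
  set (S3 := sq f x (y + u) u) in *. set (S4 := sq f (x + u) (y + u) u) in *.
  assert (T : Cmod (sq f x y (2 * u)) <= Cmod S1 + Cmod S2 + Cmod S3 + Cmod S4).
  { rewrite E. eapply Rle_trans; [apply Cmod_triangle|]. apply Rplus_le_compat_r.
    eapply Rle_trans; [apply Cmod_triangle|]. apply Rplus_le_compat_r. apply Cmod_triangle. }
  destruct (Rle_dec (Cmod (sq f x y (2 * u))) (4 * Cmod S1)) as [h1|h1]; [exists x, y; auto|].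
  destruct (Rle_dec (Cmod (sq f x y (2 * u))) (4 * Cmod S2)) as [h2|h2]; [exists (x + u), y; auto|].
  destruct (Rle_dec (Cmod (sq f x y (2 * u))) (4 * Cmod S3)) as [h3|h3]; [exists x, (y + u); auto|].
  exists (x + u), (y + u). repeat split; auto. fold S4. lra.
Qed.

(** Bisection: some quarter carries at least a quarter of the integral, and the nested squares
    shrink to a point. There the affine part integrates to zero, and the remainder is small relative
    to the area. *)
Lemma goursat f x y s : 0 < s -> continuous_C f ->
  (forall a b, x <= a <= x + s -> y <= b <= y + s -> exists l, deriv_C f (a, b) l) ->
  sq f x y s = RtoC 0.
Proof.
  intros Hs Cf Hd.
  apply Cmod_eq_0. apply Rle_antisym; [|apply Cmod_ge_0]. apply Rnot_lt_le. intros Hk.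
  set (kappa := Cmod (sq f x y s)) in *.
  assert (nxt : forall pu : (R * R) * R, exists p' : R * R,
    (fst p' = fst (fst pu) \/ fst p' = fst (fst pu) + snd pu) /\
    (snd p' = snd (fst pu) \/ snd p' = snd (fst pu) + snd pu) /\
    Cmod (sq f (fst (fst pu)) (snd (fst pu)) (2 * snd pu)) <= 4 * Cmod (sq f (fst p') (snd p') (snd pu))).
  { intros [[a b] u]. destruct (sq_child f a b u Cf) as (x' & y' & H). exists (x', y'). exact H. }
  set (g := fun pu => proj1_sig (constructive_indefinite_description _ (nxt pu))).
  assert (Hg : forall p u,
    (fst (g (p, u)) = fst p \/ fst (g (p, u)) = fst p + u) /\
    (snd (g (p, u)) = snd p \/ snd (g (p, u)) = snd p + u) /\
    Cmod (sq f (fst p) (snd p) (2 * u)) <= 4 * Cmod (sq f (fst (g (p, u))) (snd (g (p, u))) u)).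
  { intros p u. exact (proj2_sig (constructive_indefinite_description _ (nxt (p, u)))). }
  set (p := fix p n : R * R := match n with O => (x, y) | S n => g (p n, s / 2 ^ S n) end).
  assert (P2 : forall n, 0 < 2 ^ n) by (intros; apply pow_lt; lra).
  assert (Ps : forall n, 0 < s / 2 ^ n) by (intros; apply Rdiv_lt_0_compat; auto).
  assert (Hh : forall n, s / 2 ^ n = 2 * (s / 2 ^ S n)).
  { intros n. pose proof (P2 n). simpl. field. lra. }
  assert (Step : forall n, (fst (p n) <= fst (p (S n)) /\ fst (p (S n)) + s / 2 ^ S n <= fst (p n) + s / 2 ^ n) /\
    (snd (p n) <= snd (p (S n)) /\ snd (p (S n)) + s / 2 ^ S n <= snd (p n) + s / 2 ^ n) /\
    Cmod (sq f (fst (p n)) (snd (p n)) (s / 2 ^ n)) <= 4 * Cmod (sq f (fst (p (S n))) (snd (p (S n))) (s / 2 ^ S n))).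
  { intros n. destruct (Hg (p n) (s / 2 ^ S n)) as (A & B & D). pose proof (Ps (S n)) as PS.
    rewrite (Hh n). change (p (S n)) with (g (p n, s / 2 ^ S n)).
    split; [destruct A as [A|A]; rewrite A; lra|]. split; [destruct B as [B|B]; rewrite B; lra|]. exact D. }
  assert (Mono : forall n k, (fst (p n) <= fst (p (n + k)%nat) /\ fst (p (n + k)%nat) + s / 2 ^ (n + k) <= fst (p n) + s / 2 ^ n) /\
    (snd (p n) <= snd (p (n + k)%nat) /\ snd (p (n + k)%nat) + s / 2 ^ (n + k) <= snd (p n) + s / 2 ^ n)).
  { intros n k. induction k as [|k IH]; [rewrite Nat.add_0_r; lra|].
    rewrite Nat.add_succ_r. destruct (Step (n + k)%nat) as (A & B & _). lra. }
  assert (Big : forall n, kappa <= 4 ^ n * Cmod (sq f (fst (p n)) (snd (p n)) (s / 2 ^ n))).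
  { induction n as [|n IH].
    - simpl. replace (s / 1) with s by field. unfold kappa. lra.
    - destruct (Step n) as (_ & _ & D). eapply Rle_trans; [exact IH|].
      replace (4 ^ S n) with (4 ^ n * 4) by (simpl; ring). rewrite Rmult_assoc.
      apply Rmult_le_compat_l; [apply pow_le; lra|exact D]. }
  set (zn := fun n => p n : C).
  destruct (ccv_exists zn) as [zs Hz].
  { intros eps He.
    destruct (geometric_cauchy (fun _ : unit => True) (fun n _ => zn n) (2 * s)) with (eps := eps) as [N HN]; auto.
    - intros n _ _. destruct (Step n) as (A & B & _). eapply Rle_trans; [apply Cmod_le_abs|].
      rewrite Re_minus, Im_minus.
      change (Re (zn (S n))) with (fst (p (S n))). change (Re (zn n)) with (fst (p n)).
      change (Im (zn (S n))) with (snd (p (S n))). change (Im (zn n)) with (snd (p n)).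
      pose proof (Ps (S n)). replace (2 * s / 2 ^ n) with (2 * (s / 2 ^ n)) by (field; pose proof (P2 n); lra).
      rewrite !Rabs_pos_eq by lra. lra.
    - exists N. intros n m Hn Hm. exact (HN n m tt Hn Hm Logic.I). }
  assert (In : forall n, (fst (p n) <= Re zs <= fst (p n) + s / 2 ^ n) /\ (snd (p n) <= Im zs <= snd (p n) + s / 2 ^ n)).
  { intros n.
    assert (Q : forall eps, 0 < eps -> exists k, Rabs (fst (p (n + k)%nat) - Re zs) < eps /\ Rabs (snd (p (n + k)%nat) - Im zs) < eps).
    { intros eps He. destruct (Hz eps He) as [N HN]. exists N.
      specialize (HN (n + N)%nat ltac:(lia)). split; (eapply Rle_lt_trans; [|exact HN]).
      - apply (re_le_Cmod (zn (n + N)%nat - zs)%C).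
      - apply (im_le_Cmod (zn (n + N)%nat - zs)%C). }
    repeat split; apply le_epsilon; intros eps He; destruct (Q eps He) as (k & K1 & K2);
      destruct (Mono n k) as [M1 M2]; pose proof (Ps (n + k)%nat);
      apply Rabs_lt_between in K1; apply Rabs_lt_between in K2; lra. }
  destruct (In 0%nat) as [I1 I2]. simpl in I1, I2. replace (s / 1) with s in * by field.
  destruct (Hd (Re zs) (Im zs) I1 I2) as [l Hl].
  replace (Re zs, Im zs) with zs in Hl by (destruct zs; reflexivity).
  (* On a square of side [u] the remainder contributes at most [8 * eps * u ^ 2], and
     [4 ^ N * u ^ 2 = s ^ 2]; this choice leaves [kappa / 2], a contradiction. *)
  set (eps := kappa / (16 * s ^ 2)). assert (Hs2 : 0 < s ^ 2) by (apply pow_lt; exact Hs).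
  assert (He : 0 < eps) by (apply Rdiv_lt_0_compat; lra).
  destruct (Hl eps He) as (d & Hd0 & K).
  destruct (pow_lt_1_zero (/ 2) ltac:(rewrite Rabs_pos_eq; lra) (d / (2 * s)) ltac:(apply Rdiv_lt_0_compat; lra)) as [N HN].
  specialize (HN N (Nat.le_refl N)). rewrite Rabs_pos_eq, pow_inv in HN by (apply pow_le; lra).
  apply Rlt_div_r in HN; [|lra].
  set (u := s / 2 ^ N). assert (Hu : 0 < u) by apply Ps.
  assert (Hu2 : 2 * u < d) by (unfold u, Rdiv; lra).
  destruct (In N) as [J1 J2]. fold u in J1, J2.
  set (a := fst (p N)) in *. set (b := snd (p N)) in *.
  set (r := fun z => (f z - (f zs - l * zs + l * z))%C).
  assert (Cl : continuous_C (fun z => f zs - l * zs + l * z)%C).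
  { intros z e Hee. pose proof (Cmod_ge_0 l).
    exists (e / (Cmod l + 1)). split; [apply Rdiv_lt_0_compat; lra|]. intros w Hw.
    replace (f zs - l * zs + l * w - (f zs - l * zs + l * z))%C with (l * (w - z))%C by ring.
    rewrite Cmod_mult. apply Rlt_div_r in Hw; [|lra]. pose proof (Cmod_ge_0 (w - z)). nra. }
  assert (Er : sq f a b u = sq r a b u).
  { unfold r. rewrite sq_minus by (apply continuous_edges; assumption).
    rewrite sq_affine by lra. ring. }
  assert (Cr : continuous_C r).
  { intros z e Hee. pose proof (Cmod_ge_0 l).
    destruct (Cf z (e / 2) ltac:(lra)) as (d1 & Hd1 & Q1).
    exists (Rmin d1 (e / 2 / (Cmod l + 1))). split; [apply Rmin_pos; [exact Hd1|apply Rdiv_lt_0_compat; lra]|].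
    intros w Hw. pose proof (Rmin_l d1 (e / 2 / (Cmod l + 1))). pose proof (Rmin_r d1 (e / 2 / (Cmod l + 1))).
    assert (Hw2 : Cmod (w - z) < e / 2 / (Cmod l + 1)) by lra. apply Rlt_div_r in Hw2; [|lra].
    unfold r. replace (f w - (f zs - l * zs + l * w) - (f z - (f zs - l * zs + l * z)))%C with
      ((f w - f z) - l * (w - z))%C by ring.
    eapply Rle_lt_trans; [apply Cmod_minus_le|]. rewrite Cmod_mult.
    specialize (Q1 w ltac:(lra)). pose proof (Cmod_ge_0 (w - z)). nra. }
  assert (Bd : Cmod (sq r a b u) <= 4 * (eps * (2 * u) * u)).
  { apply sq_bound; [lra|apply continuous_edges, Cr|].
    intros a' b' Ha' Hb' _. set (z := (a', b') : C).
    assert (Hz' : Cmod (z - zs) <= 2 * u).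
    { eapply Rle_trans; [apply Cmod_le_abs|]. rewrite Re_minus, Im_minus.
      change (Re z) with a'. change (Im z) with b'.
      assert (Rabs (a' - Re zs) <= u) by (apply Rabs_le; lra).
      assert (Rabs (b' - Im zs) <= u) by (apply Rabs_le; lra). lra. }
    specialize (K (z - zs)%C ltac:(lra)). replace (zs + (z - zs))%C with z in K by ring.
    unfold r. replace (f z - (f zs - l * zs + l * z))%C with (f z - f zs - l * (z - zs))%C by ring.
    eapply Rle_trans; [exact K|]. apply Rmult_le_compat_l; lra. }
  specialize (Big N). fold u a b in Big. rewrite Er in Big.
  assert (E4 : 4 ^ N * (u * u) = s ^ 2).
  { unfold u. replace 4 with (2 * 2) by ring. rewrite Rpow_mult_distr. field. pose proof (P2 N). lra. }
  assert (kappa <= 4 ^ N * (4 * (eps * (2 * u) * u))).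
  { eapply Rle_trans; [exact Big|]. apply Rmult_le_compat_l; [apply pow_le; lra|exact Bd]. }
  replace (4 ^ N * (4 * (eps * (2 * u) * u))) with (8 * eps * (4 ^ N * (u * u))) in H by ring.
  rewrite E4 in H. unfold eps in H.
  replace (8 * (kappa / (16 * s ^ 2)) * s ^ 2) with (kappa / 2) in H by (field; lra). lra.
Qed.

(** * Finite covers and complex neighborhoods *)

Lemma list_min_pos {X : Type} (g : X -> R) (L : list X) : (forall x, In x L -> 0 < g x) ->
  exists d, 0 < d /\ forall x, In x L -> d <= g x.
Proof.
  induction L as [|x L IH]; intros H.
  - exists 1. split; [lra|intros x []].
  - destruct IH as (d & Hd & K); [intros; apply H; right; assumption|].
    exists (Rmin d (g x)). split; [apply Rmin_pos; [exact Hd|apply H; left; reflexivity]|].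
    intros y [->|Hy]; [apply Rmin_r|]. eapply Rle_trans; [apply Rmin_l|apply K, Hy].
Qed.

Lemma list_max {X : Type} (g : X -> R) (L : list X) : exists K, 0 <= K /\ forall x, In x L -> g x <= K.
Proof.
  induction L as [|x L (K & HK & H)].
  - exists 0. split; [lra|intros x []].
  - exists (Rmax K (g x)). split; [eapply Rle_trans; [exact HK|apply Rmax_l]|].
    intros y [->|Hy]; [apply Rmax_r|]. eapply Rle_trans; [apply H, Hy|apply Rmax_l].
Qed.

(** [compactness_list] is a double negation, hence the classical step. It measures the two
    coordinates separately, so the radii are halved to control the modulus. *)
Lemma box_cover (a b a' b' : R) (delta : C -> R) : (forall z, 0 < delta z) ->
  exists L : list C, forall z : C, a <= Re z <= b -> a' <= Im z <= b' ->
    exists w, In w L /\ (a <= Re w <= b /\ a' <= Im w <= b') /\ Cmod (z - w) < delta w.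
Proof.
  intros Hd.
  assert (Hd2 : forall p : Compactness.Tn 2 R, 0 < delta (fst p, fst (snd p)) / 2).
  { intros p. specialize (Hd (fst p, fst (snd p))). lra. }
  apply NNPP. intros HC.
  apply (compactness_list 2 (a, (a', tt)) (b, (b', tt)) (fun p => mkposreal _ (Hd2 p))).
  intros [L HL]. apply HC.
  exists (map (fun p : Compactness.Tn 2 R => (fst p, fst (snd p)) : C) L).
  intros [x y] Hx Hy.
  destruct (HL (x, (y, tt))) as ([u [v []]] & H1 & H2 & H3).
  - simpl. auto.
  - exists (u, v). split; [apply in_map_iff; exists (u, (v, tt)); auto|].
    simpl in H2, H3. split; [simpl; tauto|].
    eapply Rle_lt_trans; [apply Cmod_le_abs|]. rewrite Re_minus, Im_minus. simpl. lra.
Qed.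

(** Neighborhoods by discs, as a filter, so that the rules for [flim] yield continuity of
    products. *)
Definition Cnear (z : C) (P : C -> Prop) : Prop :=
  exists d, 0 < d /\ forall w, Cmod (w - z) < d -> P w.

Global Instance Cnear_filter z : Filter (Cnear z).
Proof.
  constructor.
  - exists 1. split; [lra|auto].
  - intros P Q (d & Hd & H) (d' & Hd' & H'). exists (Rmin d d'). split; [apply Rmin_pos; assumption|].
    intros w Hw. pose proof (Rmin_l d d'). pose proof (Rmin_r d d'). split; [apply H|apply H']; lra.
  - intros P Q I (d & Hd & H). exists d. split; auto.
Qed.

Lemma continuous_C_mult f g : continuous_C f -> continuous_C g -> continuous_C (fun z => f z * g z)%C.
Proof. intros Hf Hg z. exact (flim_mult (Cnear z) f g (f z) (g z) (Hf z) (Hg z)). Qed.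

Lemma continuous_C_affine_comp f a b : continuous_C f -> Cmod b = 1 ->
  continuous_C (fun z => f (a + b * z)%C).
Proof.
  intros H Hb z eps He. destruct (H (a + b * z)%C eps He) as (d & Hd & K). exists d. split; [exact Hd|].
  intros w Hw. apply K. replace (a + b * w - (a + b * z))%C with (b * (w - z))%C by ring.
  rewrite Cmod_mult, Hb. lra.
Qed.

(* The 4 x 4 grid of squares: the 12 outer ones avoid the origin. *)
Lemma sq_shrink f u rho : 0 < u -> 2 * u <= rho -> continuous_C f ->
  (forall a b, - rho <= a <= rho -> - rho <= b <= rho -> (a, b) <> RtoC 0 -> exists l, deriv_C f (a, b) l) ->
  sq f (- (2 * u)) (- (2 * u)) (2 * (2 * u)) = sq f (- u) (- u) (2 * u).
Proof.
  intros Hu Hr Cf Hd.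
  assert (Z : forall x y, - rho <= x -> x + u <= rho -> - rho <= y -> y + u <= rho ->
     (0 < x \/ x + u < 0 \/ 0 < y \/ y + u < 0) -> sq f x y u = RtoC 0).
  { intros x y Hx1 Hx2 Hy1 Hy2 H0. apply goursat; auto. intros a b Ha Hb. apply Hd; try lra.
    intros E. injection E; intros; lra. }
  rewrite (sq_split f _ _ (2 * u) Cf), (sq_split f (- u) (- u) u Cf).
  replace (- (2 * u) + 2 * u) with 0 by ring. replace (- u + u) with 0 by ring.
  rewrite !(sq_split f _ _ u Cf).
  replace (- (2 * u) + u) with (- u) by ring. replace (0 + u) with u by ring.
  rewrite (Z (- (2 * u)) (- (2 * u))), (Z (- u) (- (2 * u))), (Z 0 (- (2 * u))), (Z u (- (2 * u))),
    (Z (- (2 * u)) (- u)), (Z u (- u)), (Z (- (2 * u)) 0), (Z u 0),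
    (Z (- (2 * u)) u), (Z (- u) u), (Z 0 u), (Z u u) by lra.
  ring.
Qed.

(** By [sq_shrink] the integral is unchanged when the square is halved about the origin; continuity
    at the origin bounds the integrand there, so the common value is zero. *)
Lemma goursat_punctured f rho : 0 < rho -> continuous_C f ->
  (forall a b, - rho <= a <= rho -> - rho <= b <= rho -> (a, b) <> RtoC 0 -> exists l, deriv_C f (a, b) l) ->
  sq f (- rho) (- rho) (2 * rho) = RtoC 0.
Proof.
  intros Hr Cf Hd.
  assert (P2 : forall n, 0 < 2 ^ n) by (intros; apply pow_lt; lra).
  assert (Hn : forall n, sq f (- rho) (- rho) (2 * rho) = sq f (- (rho / 2 ^ n)) (- (rho / 2 ^ n)) (2 * (rho / 2 ^ n))).
  { induction n as [|n IH].
    - simpl. replace (rho / 1) with rho by field. reflexivity.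
    - rewrite IH. pose proof (P2 n) as Pn.
      replace (rho / 2 ^ n) with (2 * (rho / 2 ^ S n)) by (simpl; field; lra).
      apply (sq_shrink f _ rho); auto.
      + apply Rdiv_lt_0_compat; auto.
      + replace (2 * (rho / 2 ^ S n)) with (rho / 2 ^ n) by (simpl; field; lra).
        apply Rle_div_l; [exact Pn|]. assert (1 <= 2 ^ n) by (apply pow_R1_Rle; lra). nra. }
  apply Cmod_eq_0. apply Rle_antisym; [|apply Cmod_ge_0]. apply le_epsilon. intros eps He.
  destruct (Cf (RtoC 0) 1 Rlt_0_1) as (d & Hd0 & K).
  set (m := Cmod (f (RtoC 0)) + 1). assert (Hm : 0 < m) by (unfold m; pose proof (Cmod_ge_0 (f (RtoC 0))); lra).
  set (e := Rmin (d / (2 * rho)) (eps / (8 * m * rho))).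
  assert (Hmr : 0 < 8 * m * rho) by (apply Rmult_lt_0_compat; lra).
  assert (He0 : 0 < e) by (apply Rmin_pos; apply Rdiv_lt_0_compat; lra).
  destruct (pow_lt_1_zero (/ 2) ltac:(rewrite Rabs_pos_eq; lra) e He0) as [N HN].
  specialize (HN N (Nat.le_refl N)). rewrite Rabs_pos_eq, pow_inv in HN by (apply pow_le; lra).
  pose proof (Rmin_l (d / (2 * rho)) (eps / (8 * m * rho))) as E1.
  pose proof (Rmin_r (d / (2 * rho)) (eps / (8 * m * rho))) as E2. fold e in E1, E2.
  assert (F1 : / 2 ^ N < d / (2 * rho)) by lra. assert (F2 : / 2 ^ N < eps / (8 * m * rho)) by lra.
  apply Rlt_div_r in F1; [|lra]. apply Rlt_div_r in F2; [|exact Hmr].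
  rewrite (Hn N). set (u := rho / 2 ^ N). assert (Hu : 0 < u) by (apply Rdiv_lt_0_compat; auto).
  assert (G1 : 2 * u < d) by (unfold u, Rdiv; lra).
  assert (G2 : 8 * m * u < eps) by (unfold u, Rdiv; lra).
  eapply Rle_trans.
  - apply (sq_bound f _ _ _ m); [lra|apply continuous_edges, Cf|].
    intros a b Ha Hb _. unfold m.
    assert (Hz : Cmod ((a, b) - RtoC 0)%C < d).
    { eapply Rle_lt_trans; [apply Cmod_le_abs|]. rewrite Re_minus, Im_minus. simpl.
      assert (Rabs (a - 0) <= u) by (apply Rabs_le; lra). assert (Rabs (b - 0) <= u) by (apply Rabs_le; lra). lra. }
    specialize (K _ Hz). pose proof (Cmod_reverse_triangle (f (a, b)) (f (RtoC 0))). lra.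
  - lra.
Qed.

Lemma deriv_C_minus_const f z l c : deriv_C f z l -> deriv_C (fun w => f w - c)%C z l.
Proof.
  intros H eps He. destruct (H eps He) as (d & Hd & K). exists d. split; [exact Hd|].
  intros h Hh. specialize (K h Hh).
  replace (f (z + h)%C - c - (f z - c) - l * h)%C with (f (z + h)%C - f z - l * h)%C by ring. exact K.
Qed.

Lemma ccont_div (p : R -> C) t : ccont p t -> p t <> RtoC 0 -> ccont (fun u => / p u)%C t.
Proof.
  intros [A B] H.
  assert (N : Re (p t) ^ 2 + Im (p t) ^ 2 <> 0).
  { rewrite <- Cmod2_alt. apply Cmod_gt_0 in H. pose proof (pow_lt _ 2 H). lra. }
  assert (D : continuous (fun u => / (Re (p u) ^ 2 + Im (p u) ^ 2)) t).
  { apply cont_inv; [apply cont_plus; apply cont_pow; assumption|exact N]. }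
  split.
  - apply (cont_mult (fun u => Re (p u)) (fun u => / (Re (p u) ^ 2 + Im (p u) ^ 2)) t A D).
  - apply (cont_mult (fun u => - Im (p u)) (fun u => / (Re (p u) ^ 2 + Im (p u) ^ 2)) t (cont_opp _ _ B) D).
Qed.

Lemma ccont_horizontal (b t : R) : ccont (fun u => (u, b) : C) t.
Proof. split; simpl; [apply cont_id|apply cont_const]. Qed.

Lemma ccont_vertical (a t : R) : ccont (fun u => (a, u) : C) t.
Proof. split; simpl; [apply cont_const|apply cont_id]. Qed.

Lemma edges_inv rho : 0 < rho -> edges Cinv (- rho) (- rho) (2 * rho).
Proof.
  intros Hr. split; [|split; [|split]]; intros t.
  - apply ccont_div; [apply ccont_horizontal|]. intros E; injection E; intros; lra.
  - apply ccont_div; [apply ccont_horizontal|]. intros E; injection E; intros; lra.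
  - apply ccont_div; [apply ccont_vertical|]. intros E; injection E; intros; lra.
  - apply ccont_div; [apply ccont_vertical|]. intros E; injection E; intros; lra.
Qed.

(** The exact value is [2 pi i]. Each side has length [2 rho] and contributes an integrand
    [rho / (t^2 + rho^2)], at least [1 / (2 rho)], hence at least 1. *)
Lemma sq_inv_lower rho : 0 < rho -> 4 <= Im (sq Cinv (- rho) (- rho) (2 * rho)).
Proof.
  intros Hr. destruct (edges_inv rho Hr) as (E1 & E2 & E3 & E4). unfold sq.
  replace (- rho + 2 * rho) with rho in * by ring.
  assert (Q : forall t, - rho < t < rho -> / (2 * rho) <= rho / (t ^ 2 + rho ^ 2)).
  { intros t Ht. apply Rle_div_r; [nra|]. apply Rmult_le_reg_l with (2 * rho); [lra|].
    replace (2 * rho * (/ (2 * rho) * (t ^ 2 + rho ^ 2))) with (t ^ 2 + rho ^ 2) by (field; lra). nra. }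
  assert (One : RInt (fun _ => / (2 * rho)) (- rho) rho = 1).
  { rewrite RInt_const_R. assert (X : (rho - - rho) * / (2 * rho) = 1) by (field; lra). exact X. }
  assert (Lo : forall g : R -> R, (forall t, continuous g t) ->
     (forall t, - rho < t < rho -> / (2 * rho) <= g t) -> 1 <= RInt g (- rho) rho).
  { intros g Cg Hg. rewrite <- One. apply RInt_le; try lra; try (apply ex_RInt_cont; auto).
    - intros; apply cont_const.
    - exact Hg. }
  assert (Up : forall g : R -> R, (forall t, continuous g t) ->
     (forall t, - rho < t < rho -> g t <= - / (2 * rho)) -> RInt g (- rho) rho <= - 1).
  { intros g Cg Hg. pose proof (Lo (fun t => - g t) (fun t => cont_opp g t (Cg t))) as K.
    rewrite (RInt_opp (V := R_CompleteNormedModule) g) in K by (apply ex_RInt_cont, Cg).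
    unfold opp in K; simpl in K. assert (1 <= - RInt g (- rho) rho); [apply K|lra].
    intros t Ht. specialize (Hg t Ht). lra. }
  assert (B1 : 1 <= Im (cint (fun t => / (t, (- rho)%R))%C (- rho) rho)).
  { apply Lo; [intros t; exact (proj2 (E1 t))|]. intros t Ht. eapply Rle_trans; [apply Q, Ht|].
    simpl. right. field. nra. }
  assert (B2 : Im (cint (fun t => / (t, rho))%C (- rho) rho) <= - 1).
  { apply Up; [intros t; exact (proj2 (E2 t))|]. intros t Ht. specialize (Q t Ht).
    simpl. replace (- rho / (t * (t * 1) + rho * (rho * 1))) with (- (rho / (t ^ 2 + rho ^ 2))) by (field; nra). lra. }
  assert (B3 : 1 <= Re (cint (fun t => / (rho, t))%C (- rho) rho)).
  { apply Lo; [intros t; exact (proj1 (E3 t))|]. intros t Ht. eapply Rle_trans; [apply Q, Ht|].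
    simpl. right. field. nra. }
  assert (B4 : Re (cint (fun t => / ((- rho)%R, t))%C (- rho) rho) <= - 1).
  { apply Up; [intros t; exact (proj1 (E4 t))|]. intros t Ht. specialize (Q t Ht).
    simpl. replace (- rho / (- rho * (- rho * 1) + t * (t * 1))) with (- (rho / (t ^ 2 + rho ^ 2))) by (field; nra). lra. }
  assert (ImCi : forall z : C, Im (Ci * z)%C = Re z) by (intros z; unfold Re, Im; simpl; ring).
  rewrite Im_plus, Im_minus, ImCi, Re_minus. lra.
Qed.

Lemma sq_scal c f x y s : edges f x y s -> sq (fun z => c * f z)%C x y s = (c * sq f x y s)%C.
Proof.
  intros (F1 & F2 & F3 & F4).
  assert (S : forall g a b, (forall t, ccont g t) -> cint (fun t => c * g t)%C a b = (c * cint g a b)%C).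
  { intros g a b Cg.
    assert (Cr : forall t, continuous (fun t => Re (g t)) t) by (intros t; exact (proj1 (Cg t))).
    assert (Ci' : forall t, continuous (fun t => Im (g t)) t) by (intros t; exact (proj2 (Cg t))).
    apply C_eq_parts.
    - transitivity (RInt (fun t => Re c * Re (g t) + - Im c * Im (g t)) a b).
      + apply (RInt_ext (V := R_CompleteNormedModule)). intros t _. simpl. unfold Re, Im. ring_simplify. reflexivity.
      + rewrite RInt_plus_cont, !RInt_scal_cont; auto; try (intros t; apply cont_mult; auto using cont_const).
        simpl. unfold Re, Im. ring.
    - transitivity (RInt (fun t => Re c * Im (g t) + Im c * Re (g t)) a b).
      + apply (RInt_ext (V := R_CompleteNormedModule)). intros t _. simpl. unfold Re, Im. reflexivity.
      + rewrite RInt_plus_cont, !RInt_scal_cont; auto; try (intros t; apply cont_mult; auto using cont_const). }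
  unfold sq.
  rewrite (S (fun t => f (t, y))), (S (fun t => f (t, y + s)%R)), (S (fun t => f (x + s, t)%R)), (S (fun t => f (x, t)))
    by assumption.
  ring.
Qed.

Lemma sq_ext f g x y s : (forall t, f (t, y) = g (t, y)) -> (forall t, f (t, y + s)%R = g (t, y + s)%R) ->
  (forall t, f (x + s, t)%R = g (x + s, t)%R) -> (forall t, f (x, t) = g (x, t)) -> sq f x y s = sq g x y s.
Proof.
  intros H1 H2 H3 H4. unfold sq.
  rewrite (cint_ext _ _ x (x + s) H1), (cint_ext _ _ x (x + s) H2), (cint_ext _ _ y (y + s) H3), (cint_ext _ _ y (y + s) H4).
  reflexivity.
Qed.

Lemma edges_mult f g x y s : edges f x y s -> edges g x y s -> edges (fun z => f z * g z)%C x y s.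
Proof.
  intros (F1 & F2 & F3 & F4) (G1 & G2 & G3 & G4).
  split; [|split; [|split]]; intros t; apply ccont_mult; auto.
Qed.

Lemma Cmod_boundary_ge rho a b : 0 < rho -> (a = - rho \/ a = rho \/ b = - rho \/ b = rho) -> rho <= Cmod (a, b).
Proof.
  intros Hr H. pose proof (re_le_Cmod (a, b)) as H1. pose proof (im_le_Cmod (a, b)) as H2.
  simpl in H1, H2.
  assert (rho <= Rabs a \/ rho <= Rabs b); [|destruct H0; lra].
  destruct H as [->|[->|[->| ->]]]; try rewrite Rabs_Ropp; rewrite (Rabs_pos_eq rho) by lra; lra.
Qed.

(* Cauchy's formula at the center of a square, with [|int dz/z| >= 4] in place of [2 pi]. *)
Lemma cauchy_center_bound F rho m : 0 < rho -> continuous_C F ->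
  (forall a b, - rho <= a <= rho -> - rho <= b <= rho -> exists l, deriv_C F (a, b) l) ->
  (forall a b, - rho <= a <= rho -> - rho <= b <= rho ->
     (a = - rho \/ a = rho \/ b = - rho \/ b = rho) -> Cmod (F (a, b)) <= m) ->
  Cmod (F (RtoC 0)) <= 2 * m.
Proof.
  intros Hr CF Hd Hm.
  destruct (Hd 0 0 ltac:(lra) ltac:(lra)) as [l0 Hl0]. change (0, 0) with (RtoC 0) in Hl0.
  set (F0 := F (RtoC 0)).
  (* The difference quotient of [F] at the center, completed by the derivative there: continuous
     everywhere and differentiable on the punctured square, so its contour integral vanishes. *)
  set (G := fun z => if excluded_middle_informative (z = RtoC 0) then l0 else ((F z - F0) * / z)%C).
  assert (G0 : G (RtoC 0) = l0).
  { unfold G. destruct (excluded_middle_informative _); [reflexivity|tauto]. }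
  assert (G1 : forall z, z <> RtoC 0 -> G z = ((F z - F0) * / z)%C).
  { intros z Hz. unfold G. destruct (excluded_middle_informative _); [tauto|reflexivity]. }
  assert (Gloc : forall z, z <> RtoC 0 -> forall w, Cmod (w - z) < Cmod z -> G w = ((F w - F0) * / w)%C).
  { intros z Hz w Hw. apply G1. intros ->. rewrite Cmod_sub_sym in Hw.
    replace (z - 0)%C with z in Hw by ring. lra. }
  assert (CG : continuous_C G).
  { intros z. destruct (excluded_middle_informative (z = RtoC 0)) as [->|Hz].
    - intros eps He. destruct (Hl0 (eps / 2) ltac:(lra)) as (d & Hd0 & K).
      exists d. split; [exact Hd0|]. intros w Hw. replace (w - 0)%C with w in Hw by ring.
      rewrite G0. destruct (excluded_middle_informative (w = RtoC 0)) as [->|Hw0].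
      + rewrite G0. replace (l0 - l0)%C with (RtoC 0) by ring. rewrite Cmod_0. exact He.
      + rewrite (G1 w Hw0). specialize (K w Hw). rewrite Cplus_0_l in K. fold F0 in K.
        pose proof (proj1 (Cmod_gt_0 w) Hw0) as Hp.
        replace ((F w - F0) * / w - l0)%C with ((F w - F0 - l0 * w) * / w)%C by (field; exact Hw0).
        rewrite Cmod_mult, Cmod_inv by exact Hw0.
        apply Rle_lt_trans with (eps / 2); [|lra]. apply Rle_div_l; lra.
    - pose proof (proj1 (Cmod_gt_0 z) Hz) as Hp.
      assert (L : flim (Cnear z) (fun w => (F w - F0) * / w)%C ((F z - F0) * / z)%C).
      { apply flim_mult; filter_tc.
        - apply flim_minus; filter_tc; [exact (CF z)|apply flim_const; filter_tc].
        - exact (deriv_C_continuous _ _ _ (deriv_C_inv z Hz)). }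
      intros eps He. destruct (L eps He) as (d & Hd0 & K).
      exists (Rmin d (Cmod z)). split; [apply Rmin_pos; assumption|]. intros w Hw.
      pose proof (Rmin_l d (Cmod z)). pose proof (Rmin_r d (Cmod z)).
      rewrite (Gloc z Hz w) by lra. rewrite (G1 z Hz). apply K. lra. }
  assert (DG : sq G (- rho) (- rho) (2 * rho) = RtoC 0).
  { apply goursat_punctured; auto. intros a b Ha Hb Hz. destruct (Hd a b Ha Hb) as [l Hl].
    eexists. apply (deriv_C_ext_loc (fun w => (F w - F0) * / w)%C G (a, b) _ (Cmod (a, b))).
    - apply Cmod_gt_0. exact Hz.
    - intros w Hw. symmetry. apply (Gloc (a, b) Hz w Hw).
    - apply deriv_C_mult; [apply deriv_C_minus_const, Hl|apply deriv_C_inv, Hz]. }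
  pose proof (edges_inv rho Hr) as Ei.
  pose proof (continuous_edges F (- rho) (- rho) (2 * rho) CF) as EF.
  assert (EFi := edges_mult _ _ _ _ _ EF Ei).
  assert (Ei' : edges (fun z => F0 * / z)%C (- rho) (- rho) (2 * rho)).
  { apply (edges_mult (fun _ => F0)); [|exact Ei]. repeat split; apply cont_const. }
  assert (E : sq G (- rho) (- rho) (2 * rho) = (sq (fun z => F z * / z)%C (- rho) (- rho) (2 * rho) - F0 * sq Cinv (- rho) (- rho) (2 * rho))%C).
  { rewrite <- (sq_scal F0 Cinv) by exact Ei. rewrite <- sq_minus by assumption.
    apply sq_ext; intros t; rewrite G1; try ring; intros Q; injection Q; intros; lra. }
  rewrite DG in E.
  assert (E' : (F0 * sq Cinv (- rho) (- rho) (2 * rho))%C = sq (fun z => F z * / z)%C (- rho) (- rho) (2 * rho)).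
  { transitivity (sq (fun z => F z * / z)%C (- rho) (- rho) (2 * rho) - (sq (fun z => F z * / z)%C (- rho) (- rho) (2 * rho) - F0 * sq Cinv (- rho) (- rho) (2 * rho)))%C; [ring|].
    rewrite <- E. ring. }
  (* On the boundary the integrand is at most [m / rho], and the perimeter is [8 rho]; dividing the
     resulting [8 m] by 4 gives the bound. *)
  assert (B : Cmod (sq (fun z => F z * / z)%C (- rho) (- rho) (2 * rho)) <= 4 * (m / rho * (2 * rho))).
  { apply sq_bound; [lra|exact EFi|]. intros a b Ha Hb Hab.
    replace (- rho + 2 * rho) with rho in * by ring.
    assert (Hab' : a = - rho \/ a = rho \/ b = - rho \/ b = rho) by exact Hab.
    pose proof (Cmod_boundary_ge rho a b Hr Hab') as Hge.
    assert (Hz : (a, b) <> RtoC 0) by (apply Cmod_gt_0; lra).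
    rewrite Cmod_mult, Cmod_inv by exact Hz.
    apply Rmult_le_compat; [apply Cmod_ge_0|left; apply Rinv_0_lt_compat; lra|apply Hm; assumption|].
    apply Rinv_le_contravar; assumption. }
  rewrite <- E', Cmod_mult in B.
  pose proof (sq_inv_lower rho Hr) as K.
  pose proof (im_le_Cmod (sq Cinv (- rho) (- rho) (2 * rho))) as K2.
  pose proof (Rle_abs (Im (sq Cinv (- rho) (- rho) (2 * rho)))) as K3.
  replace (4 * (m / rho * (2 * rho))) with (8 * m) in B by (field; lra).
  pose proof (Cmod_ge_0 F0). fold F0. nra.
Qed.

(* The product of the four quarter-turns of [f] about [z0] is small on the boundary of a
   square centered at [z0] whose sides approach the rotated real lines. *)
Lemma boundary_uniqueness (f : C -> C) :
  (forall z, Im z <= 0 -> forall eps, 0 < eps -> exists d, 0 < d /\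
     forall w, Im w <= 0 -> Cmod (w - z) < d -> Cmod (f w - f z) < eps) ->
  (forall z, Im z < 0 -> exists l, deriv_C f z l) ->
  (forall x : R, f (RtoC x) = RtoC 0) ->
  forall z, Im z < 0 -> f z = RtoC 0.
Proof.
  intros Cf Df Zf z0 Hz0.
  (* Extension by zero is continuous across the real line because [f] vanishes on it. *)
  set (g := fun z => if Rle_dec (Im z) 0 then f z else RtoC 0).
  assert (gl : forall z, Im z <= 0 -> g z = f z) by (intros z Hz; unfold g; destruct (Rle_dec (Im z) 0); tauto).
  assert (gu : forall z, 0 < Im z -> g z = RtoC 0).
  { intros z Hz; unfold g; destruct (Rle_dec (Im z) 0); [lra|reflexivity]. }
  assert (gr : forall x, g (x, 0) = RtoC 0).
  { intros x. rewrite gl by (simpl; lra). apply Zf. }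
  assert (ImD : forall w z : C, Rabs (Im w - Im z) <= Cmod (w - z)).
  { intros w z. rewrite <- Im_minus. apply im_le_Cmod. }
  assert (Cg : continuous_C g).
  { intros z eps He. destruct (Rtotal_order (Im z) 0) as [h|[h|h]].
    - destruct (Cf z ltac:(lra) eps He) as (d & Hd & K).
      exists (Rmin d (- Im z)). split; [apply Rmin_pos; lra|]. intros w Hw.
      pose proof (Rmin_l d (- Im z)). pose proof (Rmin_r d (- Im z)).
      pose proof (ImD w z) as Q. apply Rabs_le_between in Q.
      rewrite !gl by lra. apply K; lra.
    - destruct (Cf z ltac:(lra) eps He) as (d & Hd & K).
      exists d. split; [exact Hd|]. intros w Hw. rewrite (gl z) by lra.
      destruct (Rle_dec (Im w) 0) as [hw|hw]; [rewrite gl by exact hw; apply K; assumption|].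
      rewrite gu by lra. replace z with (RtoC (Re z)) by (destruct z; simpl in *; subst; reflexivity).
      rewrite Zf. replace (0 - 0)%C with (RtoC 0) by ring. rewrite Cmod_0. exact He.
    - exists (Im z). split; [lra|]. intros w Hw. pose proof (ImD w z) as Q. apply Rabs_le_between in Q.
      rewrite !gu by lra. replace (0 - 0)%C with (RtoC 0) by ring. rewrite Cmod_0. exact He. }
  set (eta := - Im z0). assert (Heta : 0 < eta) by (unfold eta; lra).
  set (x0 := Re z0).
  (* All quarter-turns of a square of half-side at most [eta] about [z0] stay in this box. *)
  assert (KB : exists K, 0 <= K /\ forall z, x0 - eta <= Re z <= x0 + eta -> - (2 * eta) <= Im z <= 0 -> Cmod (g z) <= K).
  { assert (H1 : forall z, exists d, 0 < d /\ forall w, Cmod (w - z) < d -> Cmod (g w - g z) < 1) by (intros z; apply Cg; lra).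
    set (dl := fun z => proj1_sig (constructive_indefinite_description _ (H1 z))).
    assert (Hdl : forall z, 0 < dl z /\ forall w, Cmod (w - z) < dl z -> Cmod (g w - g z) < 1).
    { intros z. exact (proj2_sig (constructive_indefinite_description _ (H1 z))). }
    destruct (box_cover (x0 - eta) (x0 + eta) (- (2 * eta)) 0 dl (fun z => proj1 (Hdl z))) as [L HL].
    destruct (list_max (fun z => Cmod (g z) + 1) L) as (K & HK & HKL).
    exists K. split; [exact HK|]. intros z Hx Hy. destruct (HL z Hx Hy) as (w & Hw & _ & Hzw).
    pose proof (proj2 (Hdl w) z Hzw). pose proof (HKL w Hw). pose proof (Cmod_reverse_triangle (g z) (g w)). simpl in *. lra. }
  destruct KB as (K & HK & BK).
  (* Only a segment of the real line is covered, and [g] is zero there. Halving the radii leaves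
     room to move below the line by a uniform amount. *)
  assert (SM : forall eps, 0 < eps -> exists d, 0 < d /\ forall x t, x0 - eta <= x <= x0 + eta -> 0 <= t <= d -> Cmod (g (x, (- t)%R)) <= eps).
  { intros eps He.
    assert (H1 : forall z, exists d, 0 < d /\ forall w, Cmod (w - z) < d -> Cmod (g w - g z) < eps) by (intros z; apply Cg; lra).
    set (dl := fun z => proj1_sig (constructive_indefinite_description _ (H1 z))).
    assert (Hdl : forall z, 0 < dl z /\ forall w, Cmod (w - z) < dl z -> Cmod (g w - g z) < eps).
    { intros z. exact (proj2_sig (constructive_indefinite_description _ (H1 z))). }
    assert (Hdl2 : forall z, 0 < dl z / 2) by (intros z; destruct (Hdl z); lra).
    destruct (box_cover (x0 - eta) (x0 + eta) 0 0 (fun z => dl z / 2) Hdl2) as [L HL].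
    destruct (list_min_pos (fun z => dl z / 2) L (fun z _ => Hdl2 z)) as (d & Hd & HdL).
    exists (d / 2). split; [lra|]. intros x t Hx Ht.
    destruct (HL (x, 0)) as (w & Hw & (_ & Hw2) & Hzw); [simpl; lra|simpl; lra|].
    pose proof (HdL w Hw) as Hdw. simpl in Hdw.
    assert (Q : Cmod ((x, (- t)%R) - w)%C < dl w).
    { replace ((x, (- t)%R) - w)%C with (((x, 0) - w) + - (Ci * RtoC t))%C by (apply C_eq_parts; destruct w; simpl; ring).
      eapply Rle_lt_trans; [apply Cmod_triangle|]. rewrite Cmod_opp, Cmod_mult, Cmod_Ci, Cmod_R, Rabs_pos_eq by lra. lra. }
    pose proof (proj2 (Hdl w) _ Q) as R1.
    assert (Gw : g w = RtoC 0) by (destruct w as [p r]; simpl in Hw2; replace r with 0 by lra; apply gr).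
    rewrite Gw in R1. replace (g (x, (- t)%R) - 0)%C with (g (x, (- t)%R)) in R1 by ring. lra. }
  set (i1 := RtoC 1). set (i2 := Ci). set (i3 := (- (1))%C). set (i4 := (- Ci)%C).
  assert (M1 : Cmod i1 = 1) by apply Cmod_1. assert (M2 : Cmod i2 = 1) by apply Cmod_Ci.
  assert (M3 : Cmod i3 = 1) by apply Cmod_m1.
  assert (M4 : Cmod i4 = 1) by (unfold i4; rewrite Cmod_opp; apply Cmod_Ci).
  set (F := fun z => ((g (z0 + i1 * z) * g (z0 + i2 * z)) * (g (z0 + i3 * z) * g (z0 + i4 * z)))%C).
  assert (CF : continuous_C F).
  { repeat apply continuous_C_mult; apply continuous_C_affine_comp; assumption. }
  assert (Coord : forall a b, (z0 + i1 * (a, b))%C = (x0 + a, - (eta - b)) /\ (z0 + i2 * (a, b))%C = (x0 - b, - (eta - a)) /\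
    (z0 + i3 * (a, b))%C = (x0 - a, - (eta + b)) /\ (z0 + i4 * (a, b))%C = (x0 + b, - (eta + a))).
  { intros a b. unfold x0, eta, i1, i2, i3, i4. destruct z0 as [p r].
    repeat split; apply C_eq_parts; simpl; ring. }
  assert (Dg : forall z, Im z < 0 -> exists l, deriv_C g z l).
  { intros z Hz. destruct (Df z Hz) as [l Hl]. exists l.
    apply (deriv_C_ext_loc f g z l (- Im z)); [lra| |exact Hl].
    intros w Hw. symmetry. apply gl. pose proof (ImD w z) as Q. apply Rabs_le_between in Q. lra. }
  assert (main : forall eps, 0 < eps -> Cmod (F (RtoC 0)) <= 2 * (eps * K * (K * K))).
  { intros eps He. destruct (SM eps He) as (d & Hd & SMd).
    (* Less than [eta], so the square stays in the open half-plane where [f] is differentiable, yet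
       within [d] of it, so the rotated sides reach the zone where [g] is small. *)
    set (rho := Rmax (eta / 2) (eta - d)).
    assert (Hrho : 0 < rho < eta /\ eta - rho <= d).
    { unfold rho. pose proof (Rmax_l (eta / 2) (eta - d)). pose proof (Rmax_r (eta / 2) (eta - d)).
      split; [split; [lra|apply Rmax_lub_lt; lra]|lra]. }
    apply (cauchy_center_bound F rho); [lra|exact CF| |].
    - intros a b Ha Hb. destruct (Coord a b) as (E1 & E2 & E3 & E4).
      destruct (Dg (z0 + i1 * (a, b))%C) as [l1 D1]; [rewrite E1; simpl; lra|].
      destruct (Dg (z0 + i2 * (a, b))%C) as [l2 D2]; [rewrite E2; simpl; lra|].
      destruct (Dg (z0 + i3 * (a, b))%C) as [l3 D3]; [rewrite E3; simpl; lra|].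
      destruct (Dg (z0 + i4 * (a, b))%C) as [l4 D4]; [rewrite E4; simpl; lra|].
      eexists. repeat apply deriv_C_mult; apply deriv_C_affine_comp; eassumption.
    - intros a b Ha Hb Hab. destruct (Coord a b) as (E1 & E2 & E3 & E4).
      unfold F. rewrite E1, E2, E3, E4, !Cmod_mult.
      assert (B1 : Cmod (g (x0 + a, - (eta - b))) <= K) by (apply BK; simpl; lra).
      assert (B2 : Cmod (g (x0 - b, - (eta - a))) <= K) by (apply BK; simpl; lra).
      assert (B3 : Cmod (g (x0 - a, - (eta + b))) <= K) by (apply BK; simpl; lra).
      assert (B4 : Cmod (g (x0 + b, - (eta + a))) <= K) by (apply BK; simpl; lra).
      pose proof (Cmod_ge_0 (g (x0 + a, - (eta - b)))) as N1.
      pose proof (Cmod_ge_0 (g (x0 - b, - (eta - a)))) as N2.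
      pose proof (Cmod_ge_0 (g (x0 - a, - (eta + b)))) as N3.
      pose proof (Cmod_ge_0 (g (x0 + b, - (eta + a)))) as N4.
      (* On every side one of the rotated points lies at depth [eta - rho]; its factor is at most
         [eps] and the other three are at most [K]. *)
      destruct Hab as [->|[->|[->| ->]]].
      + assert (S : Cmod (g (x0 + b, - (eta + - rho))) <= eps) by (apply SMd; lra).
        replace (eps * K * (K * K)) with ((K * K) * (K * eps)) by ring.
        repeat apply Rmult_le_compat; try assumption; apply Rmult_le_pos; assumption.
      + assert (S : Cmod (g (x0 - b, - (eta - rho))) <= eps) by (apply SMd; lra).
        replace (eps * K * (K * K)) with ((K * eps) * (K * K)) by ring.
        repeat apply Rmult_le_compat; try assumption; apply Rmult_le_pos; assumption.
      + assert (S : Cmod (g (x0 - a, - (eta + - rho))) <= eps) by (apply SMd; lra).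
        replace (eps * K * (K * K)) with ((K * K) * (eps * K)) by ring.
        repeat apply Rmult_le_compat; try assumption; apply Rmult_le_pos; assumption.
      + assert (S : Cmod (g (x0 + a, - (eta - rho))) <= eps) by (apply SMd; lra).
        repeat apply Rmult_le_compat; try assumption; apply Rmult_le_pos; assumption. }
  assert (F0 : F (RtoC 0) = RtoC 0).
  { apply Cmod_eq_0. apply Rle_antisym; [|apply Cmod_ge_0]. apply le_epsilon. intros eps He.
    set (c := 2 * (K * (K * K)) + 1). assert (Hc : 0 < c).
    { unfold c. assert (0 <= K * (K * K)) by (repeat apply Rmult_le_pos; exact HK). lra. }
    specialize (main (eps / c) ltac:(apply Rdiv_lt_0_compat; lra)).
    assert (E : eps = c * (eps / c)) by (field; lra). unfold c in E at 1.
    assert (0 < eps / c) by (apply Rdiv_lt_0_compat; lra). nra. }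
  (* At the center all four rotated points coincide with [z0], so the product is the fourth power of
     [g z0]. *)
  assert (G : g z0 = RtoC 0).
  { unfold F in F0. rewrite !Cmult_0_r, !Cplus_0_r in F0.
    apply Cmod_eq_0. apply (f_equal Cmod) in F0. rewrite !Cmod_mult, Cmod_0 in F0.
    pose proof (Cmod_ge_0 (g z0)) as [h|h]; [|lra]. exfalso.
    assert (0 < Cmod (g z0) * Cmod (g z0)) by (apply Rmult_lt_0_compat; exact h). nra. }
  rewrite <- gl by lra. exact G.
Qed.

(** * Persistence of simple zeros *)

Definition continuous_lower (A : C -> C) : Prop :=
  forall l, lower l -> forall eps, 0 < eps -> exists d, 0 < d /\
    forall m, lower m -> Cmod (m - l) < d -> Cmod (A m - A l) < eps.

(* On the ball, [z |-> z - A z / a] is a contraction with constant 1/2. *)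
Definition nearly_linear (A : C -> C) (z0 a : C) (rho : R) : Prop :=
  forall z w, Cmod (z - z0) <= rho -> Cmod (w - z0) <= rho ->
    Cmod (A z - A w - a * (z - w)) <= / 2 * Cmod a * Cmod (z - w).

(** Banach's iteration from [z0]: the first step is at most [rho / 8] and the ratio is 1/2, so the
    iterates never leave the disc of radius [rho / 4]. *)
Lemma nearly_linear_zero A z0 a rho : 0 < rho -> a <> RtoC 0 -> nearly_linear A z0 a rho ->
  Cmod (A z0) <= Cmod a * rho / 8 -> exists z, Cmod (z - z0) < rho /\ A z = RtoC 0.
Proof.
  intros Hr Ha HL H0. pose proof (proj1 (Cmod_gt_0 a) Ha) as Pa.
  set (T := fun z => (z - A z / a)%C).
  assert (HT : forall z w, Cmod (z - z0) <= rho -> Cmod (w - z0) <= rho -> Cmod (T z - T w) <= / 2 * Cmod (z - w)).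
  { intros z w Hz Hw. specialize (HL z w Hz Hw).
    apply Rmult_le_reg_l with (Cmod a); [exact Pa|]. rewrite <- Cmod_mult.
    replace (a * (T z - T w))%C with (- (A z - A w - a * (z - w)))%C by (unfold T; field; exact Ha).
    rewrite Cmod_opp. lra. }
  set (u := fix u n := match n with O => z0 | S n => T (u n) end).
  assert (P2 : forall n, 0 < 2 ^ n) by (intros; apply pow_lt; lra).
  assert (Hu : forall n, Cmod (u (S n) - u n) <= rho / 8 / 2 ^ n /\ Cmod (u n - z0) <= rho / 4 - rho / 4 / 2 ^ n).
  { induction n as [|n [IH1 IH2]].
    - simpl. replace (z0 - z0)%C with (RtoC 0) by ring. rewrite Cmod_0. split; [|lra].
      unfold T. replace (z0 - A z0 / a - z0)%C with (- (A z0 / a))%C by ring.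
      rewrite Cmod_opp, Cmod_div by exact Ha. rewrite Rdiv_1_r. apply Rle_div_l; [exact Pa|]. lra.
    - assert (Q : Cmod (u (S n) - z0) <= rho / 4 - rho / 4 / 2 ^ S n).
      { eapply Rle_trans; [apply (Cmod_sub_triangle _ (u n))|].
        replace (rho / 4 / 2 ^ S n) with (rho / 8 / 2 ^ n) by (simpl; field; specialize (P2 n); lra).
        replace (rho / 4 / 2 ^ n) with (rho / 8 / 2 ^ n + rho / 8 / 2 ^ n) in IH2 by (field; specialize (P2 n); lra). lra. }
      split; [|exact Q].
      assert (B1 : 0 < rho / 4 / 2 ^ n) by (apply Rdiv_lt_0_compat; [lra|auto]).
      assert (B2 : 0 < rho / 4 / 2 ^ S n) by (apply Rdiv_lt_0_compat; [lra|auto]).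
      change (u (S (S n))) with (T (u (S n))). change (u (S n)) with (T (u n)) at 2.
      eapply Rle_trans; [apply HT; lra|].
      replace (rho / 8 / 2 ^ S n) with (/ 2 * (rho / 8 / 2 ^ n)) by (simpl; field; specialize (P2 n); lra). lra. }
  destruct (ccv_exists u) as [z Hz].
  { intros eps He.
    destruct (geometric_cauchy (fun _ : unit => True) (fun n _ => u n) (rho / 8)) with (eps := eps) as [N HN]; auto.
    - intros n _ _. apply Hu.
    - exists N. intros n m Hn Hm. exact (HN n m tt Hn Hm Logic.I). }
  assert (Bz : Cmod (z - z0) <= rho / 4).
  { apply (ccv_Cmod_le _ _ _ _ Hz). exists 0%nat. intros n _. destruct (Hu n) as [_ Q].
    assert (0 < rho / 4 / 2 ^ n) by (apply Rdiv_lt_0_compat; [lra|auto]). lra. }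
  exists z. split; [lra|].
  assert (E : T z = z).
  { apply (ccv_unique (fun n => u (S n))).
    - intros eps He. destruct (Hz eps He) as [N HN]. exists N. intros n Hn.
      change (u (S n)) with (T (u n)). destruct (Hu n) as [_ Q].
      assert (0 < rho / 4 / 2 ^ n) by (apply Rdiv_lt_0_compat; [lra|auto]).
      eapply Rle_lt_trans; [apply HT; lra|]. specialize (HN n Hn). pose proof (Cmod_ge_0 (u n - z)). lra.
    - intros eps He. destruct (Hz eps He) as [N HN]. exists N. intros n Hn. apply HN. lia. }
  unfold T in E.
  assert (E2 : (A z / a)%C = RtoC 0).
  { replace (A z / a)%C with (z - (z - A z / a))%C by ring. rewrite E. ring. }
  replace (A z) with (A z / a * a)%C by (field; exact Ha). rewrite E2. ring.
Qed.

Lemma nearly_linear_unique A z0 a rho z w : a <> RtoC 0 -> nearly_linear A z0 a rho ->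
  Cmod (z - z0) <= rho -> Cmod (w - z0) <= rho -> A z = RtoC 0 -> A w = RtoC 0 -> z = w.
Proof.
  intros Ha HL Hz Hw Ez Ew. specialize (HL z w Hz Hw). rewrite Ez, Ew in HL.
  replace (0 - 0 - a * (z - w))%C with (- (a * (z - w)))%C in HL by ring.
  rewrite Cmod_opp, Cmod_mult in HL. pose proof (proj1 (Cmod_gt_0 a) Ha) as Pa.
  assert (Q : Cmod (z - w) = 0) by (pose proof (Cmod_ge_0 (z - w)); nra).
  apply Cmod_eq_0 in Q. replace z with ((z - w) + w)%C by ring. rewrite Q. ring.
Qed.

(** All difference quotients at [z] stay within [|a| / 2] of [a]; a small real increment already
    contradicts a vanishing derivative. *)
Lemma nearly_linear_simple A z0 a rho z l : a <> RtoC 0 -> nearly_linear A z0 a rho ->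
  Cmod (z - z0) < rho -> deriv_C A z l -> l <> RtoC 0.
Proof.
  intros Ha HL Hz Hl E. subst l. pose proof (proj1 (Cmod_gt_0 a) Ha) as Pa.
  destruct (Hl (Cmod a / 4) ltac:(lra)) as (d & Hd & K).
  set (h := Rmin (d / 2) (rho - Cmod (z - z0))).
  assert (Hh : 0 < h) by (apply Rmin_pos; lra).
  pose proof (Rmin_l (d / 2) (rho - Cmod (z - z0))) as M1.
  pose proof (Rmin_r (d / 2) (rho - Cmod (z - z0))) as M2. fold h in M1, M2.
  assert (Ch : Cmod (RtoC h) = h) by (rewrite Cmod_R, Rabs_pos_eq; lra).
  specialize (K (RtoC h) ltac:(rewrite Ch; lra)).
  assert (Q1 : Cmod (z + RtoC h - z0) <= rho).
  { replace (z + RtoC h - z0)%C with ((z - z0) + RtoC h)%C by ring.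
    eapply Rle_trans; [apply Cmod_triangle|]. rewrite Ch. lra. }
  specialize (HL (z + RtoC h)%C z Q1 ltac:(lra)).
  replace (z + RtoC h - z)%C with (RtoC h) in HL by ring. rewrite Ch in *.
  replace (A (z + RtoC h)%C - A z - 0 * RtoC h)%C with (A (z + RtoC h)%C - A z)%C in K by ring.
  pose proof (Cmod_reverse_triangle (a * RtoC h) (A (z + RtoC h)%C - A z)) as R1.
  rewrite (Cmod_sub_sym (a * RtoC h)), Cmod_mult, Ch in R1. nra.
Qed.

(* Difference quotients with the fixed increment [k] compare [A] with [A0] near [z0]. *)
Lemma nearly_linear_perturbation A0 z0 a K :
  continuous_lower A0 -> Im z0 < 0 -> deriv_C A0 z0 a -> a <> RtoC 0 ->
  exists rho0, 0 < rho0 /\ (forall z, Cmod (z - z0) < rho0 -> Im z < 0) /\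
    forall rho, 0 < rho <= rho0 -> exists eps, 0 < eps /\
      forall A, second_difference_bound A K -> (forall z, lower z -> Cmod (A z - A0 z) <= eps) ->
      nearly_linear A z0 a rho.
Proof.
  intros CA Hz Hd Ha. pose proof (proj1 (Cmod_gt_0 a) Ha) as Pa.
  set (eta := - Im z0 / 2). assert (He : 0 < eta) by (unfold eta; lra).
  set (B := Rabs (K / eta ^ 2) + 1).
  assert (HB : 0 < B /\ K / eta ^ 2 <= B).
  { unfold B. pose proof (Rabs_pos (K / eta ^ 2)). pose proof (Rle_abs (K / eta ^ 2)). lra. }
  (* The error budget [|a| / 2] is [6 m]: [2 m] from the second difference and [4 m] from moving the
     quotient with increment [k] from [A] at [w] to [A0] at [z0] and then to [a]. *)
  set (m := Cmod a / 12). assert (Hm : 0 < m) by (unfold m; lra).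
  assert (Hin : forall h, Cmod h <= eta -> Im (z0 + h)%C <= - eta).
  { intros h Hh. pose proof (Im_plus_le z0 h). unfold eta in *. lra. }
  destruct (Hd m Hm) as (d0 & Hd0 & D0).
  set (k := Rmin (Rmin (eta / 2) (d0 / 2)) (m / B)).
  assert (Hk : 0 < k) by (repeat apply Rmin_pos; try lra; apply Rdiv_lt_0_compat; lra).
  assert (Bk : k <= eta / 2 /\ k <= d0 / 2 /\ B * k <= m).
  { pose proof (Rmin_l (Rmin (eta / 2) (d0 / 2)) (m / B)) as Q1.
    pose proof (Rmin_r (Rmin (eta / 2) (d0 / 2)) (m / B)) as Q. fold k in Q1, Q.
    pose proof (Rmin_l (eta / 2) (d0 / 2)). pose proof (Rmin_r (eta / 2) (d0 / 2)).
    apply Rle_div_r in Q; [|lra]. split; [lra|split; lra]. }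
  destruct Bk as (Bk1 & Bk2 & Bk3).
  assert (Ck : Cmod (RtoC k) = k) by (rewrite Cmod_R, Rabs_pos_eq; lra).
  specialize (D0 (RtoC k) ltac:(rewrite Ck; lra)). rewrite Ck in D0.
  assert (Lz0 : lower z0) by (unfold lower; lra).
  assert (Lz1 : lower (z0 + RtoC k)%C) by (unfold lower; pose proof (Hin (RtoC k) ltac:(rewrite Ck; lra)); lra).
  assert (Hmk : 0 < m * k) by (apply Rmult_lt_0_compat; assumption).
  destruct (CA z0 Lz0 (m * k) Hmk) as (d1 & Hd1 & C1).
  destruct (CA (z0 + RtoC k)%C Lz1 (m * k) Hmk) as (d2 & Hd2 & C2).
  set (rho0 := Rmin (Rmin (eta / 2) (m / (2 * B))) (Rmin (d1 / 2) (d2 / 2))).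
  assert (Hr0 : 0 < rho0) by (repeat apply Rmin_pos; try lra; apply Rdiv_lt_0_compat; lra).
  assert (Br : rho0 <= eta / 2 /\ B * (2 * rho0) <= m /\ rho0 < d1 /\ rho0 < d2).
  { pose proof (Rmin_l (Rmin (eta / 2) (m / (2 * B))) (Rmin (d1 / 2) (d2 / 2))) as T1.
    pose proof (Rmin_r (Rmin (eta / 2) (m / (2 * B))) (Rmin (d1 / 2) (d2 / 2))) as T2.
    fold rho0 in T1, T2.
    pose proof (Rmin_l (eta / 2) (m / (2 * B))). pose proof (Rmin_r (eta / 2) (m / (2 * B))) as Q.
    pose proof (Rmin_l (d1 / 2) (d2 / 2)). pose proof (Rmin_r (d1 / 2) (d2 / 2)).
    assert (Q' : rho0 <= m / (2 * B)) by lra. apply Rle_div_r in Q'; [|lra]. repeat split; lra. }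
  destruct Br as (Br1 & Br2 & Br3 & Br4).
  exists rho0. split; [exact Hr0|]. split.
  { intros z Hzz. replace z with (z0 + (z - z0))%C by ring. pose proof (Hin (z - z0)%C ltac:(lra)). lra. }
  intros rho [Hr Hrr]. exists (m * k / 2). split; [lra|].
  intros A SD Close z w Hzr Hwr.
  set (h := (z - w)%C).
  assert (Hh : Cmod h <= 2 * rho).
  { unfold h. eapply Rle_trans; [apply (Cmod_sub_triangle _ z0)|]. rewrite (Cmod_sub_sym z0). lra. }
  assert (Iw : Im w <= - eta) by (replace w with (z0 + (w - z0))%C by ring; apply Hin; lra).
  assert (Iz : Im (w + h)%C <= - eta).
  { replace (w + h)%C with (z0 + (z - z0))%C by (unfold h; ring). apply Hin; lra. }
  assert (Ik : Im (w + RtoC k)%C <= - eta).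
  { rewrite Im_plus. simpl. lra. }
  pose proof (SD eta w h (RtoC k) He Iw Iz Ik) as S.
  replace (w + h)%C with z in S by (unfold h; ring). rewrite Ck in S.
  pose proof (Cmod_ge_0 h) as H0.
  assert (S' : Cmod (RtoC k * (A z - A w) - h * (A (w + RtoC k)%C - A w)) <= 2 * m * (k * Cmod h)).
  { eapply Rle_trans; [exact S|].
    pose proof (Cmod_minus_le h (RtoC k)) as T. rewrite Ck in T.
    apply Rle_trans with (B * (Cmod h * k * Cmod (h - RtoC k))).
    - apply Rmult_le_compat_r; [|lra]. repeat apply Rmult_le_pos; try apply Cmod_ge_0; lra.
    - assert (B * Cmod (h - RtoC k) <= 2 * m).
      { apply Rle_trans with (B * (2 * rho0 + k)); [apply Rmult_le_compat_l; lra|lra]. }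
      replace (B * (Cmod h * k * Cmod (h - RtoC k))) with ((B * Cmod (h - RtoC k)) * (k * Cmod h)) by ring.
      apply Rmult_le_compat_r; [apply Rmult_le_pos; lra|lra]. }
  assert (Q1 : Cmod (A (w + RtoC k)%C - A w - a * RtoC k) <= 4 * (m * k)).
  { replace (A (w + RtoC k)%C - A w - a * RtoC k)%C with
      ((A (w + RtoC k)%C - A0 (w + RtoC k)%C) - (A w - A0 w) + ((A0 (w + RtoC k)%C - A0 (z0 + RtoC k)%C)
       - (A0 w - A0 z0)) + (A0 (z0 + RtoC k)%C - A0 z0 - a * RtoC k))%C by ring.
    pose proof (Close (w + RtoC k)%C ltac:(unfold lower; lra)) as E1.
    pose proof (Close w ltac:(unfold lower; lra)) as E2.
    pose proof (C1 w ltac:(unfold lower; lra) ltac:(lra)) as E3.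
    pose proof (C2 (w + RtoC k)%C ltac:(unfold lower; lra)
      ltac:(replace (w + RtoC k - (z0 + RtoC k))%C with (w - z0)%C by ring; lra)) as E4.
    eapply Rle_trans; [apply Cmod_triangle|]. eapply Rle_trans; [apply Rplus_le_compat_r, Cmod_triangle|].
    pose proof (Cmod_minus_le (A (w + RtoC k)%C - A0 (w + RtoC k)%C) (A w - A0 w)).
    pose proof (Cmod_minus_le (A0 (w + RtoC k)%C - A0 (z0 + RtoC k)%C) (A0 w - A0 z0)). lra. }
  apply Rmult_le_reg_l with k; [exact Hk|].
  rewrite <- Ck at 1. rewrite <- Cmod_mult.
  replace (RtoC k * (A z - A w - a * h))%C with
    ((RtoC k * (A z - A w) - h * (A (w + RtoC k)%C - A w)) + h * (A (w + RtoC k)%C - A w - a * RtoC k))%C by ring.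
  eapply Rle_trans; [apply Cmod_triangle|]. rewrite Cmod_mult.
  assert (Cmod h * Cmod (A (w + RtoC k)%C - A w - a * RtoC k) <= Cmod h * (4 * (m * k))) by (apply Rmult_le_compat_l; lra).
  replace (k * (/ 2 * Cmod a * Cmod h)) with (6 * m * (k * Cmod h)) by (unfold m; field). lra.
Qed.

Lemma simple_zero_deriv a z : is_simple_zero a z <-> a z = RtoC 0 /\ exists l, deriv_C a z l /\ l <> RtoC 0.
Proof.
  unfold is_simple_zero. split; intros [H (l & D & N)]; (split; [exact H|]); exists l; split; auto.
  - exact (proj1 (is_derive_C_eps a z l) D).
  - exact (proj2 (is_derive_C_eps a z l) D).
Qed.

Lemma has_n_simple_zeros_lower_ext n a b : (forall z, lower z -> a z = b z) ->
  has_n_simple_zeros n a -> has_n_simple_zeros n b.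
Proof.
  intros E ((s & Hs1 & Hs2 & Hs3) & H2 & H3).
  assert (E' : forall z, Im z < 0 -> a z = b z) by (intros z Hz; apply E; unfold lower; lra).
  split; [|split].
  - exists s. split; [exact Hs1|split; [exact Hs2|]]. intros z. rewrite Hs3.
    split; intros [Hz Q]; (split; [exact Hz|]); [rewrite <- E'|rewrite E']; assumption.
  - intros z Hz Q. rewrite <- E' in Q by exact Hz.
    apply simple_zero_deriv. destruct (proj1 (simple_zero_deriv a z) (H2 z Hz Q)) as (Q1 & l & D & N).
    split; [rewrite <- E' by exact Hz; exact Q1|]. exists l. split; [|exact N].
    apply (deriv_C_ext_loc a b z l (- Im z)); [lra| |exact D].
    intros w Hw. apply E'. pose proof (im_le_Cmod (w - z)) as R1. rewrite Im_minus in R1.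
    apply Rabs_le_between in R1. lra.
  - intros l. rewrite <- E by (unfold lower; simpl; lra). apply H3.
Qed.

(** Every zero of a perturbed function is shown to fall into a disc of radius [rho] about an old
    zero, and each such disc contains exactly one. The resulting map on the list [s] is injective
    because the discs are disjoint, so the count is preserved. *)
Lemma simple_zeros_stable (A0 : C -> C) K B n :
  continuous_lower A0 -> (forall l, lower l -> B <= Cmod l -> Cmod (A0 l - 1) < / 2) ->
  has_n_simple_zeros n A0 ->
  exists eps, 0 < eps /\ forall A, second_difference_bound A K ->
    (forall z, lower z -> Cmod (A z - A0 z) <= eps) -> has_n_simple_zeros n A.
Proof.
  intros CA Inf ((s & Hs1 & Hs2 & Hs3) & H2 & H3).
  assert (P1 : forall z, exists ar : C * R, In z s -> fst ar <> RtoC 0 /\ 0 < snd ar /\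
     (forall w, Cmod (w - z) < snd ar -> Im w < 0) /\
     forall rho, 0 < rho <= snd ar -> exists eps, 0 < eps /\
      forall A, second_difference_bound A K -> (forall z, lower z -> Cmod (A z - A0 z) <= eps) ->
      nearly_linear A z (fst ar) rho).
  { intros z. destruct (classic (In z s)) as [h|h]; [|exists (RtoC 0, 0); tauto].
    destruct (proj1 (Hs3 z) h) as [Hz Z].
    destruct (proj1 (simple_zero_deriv A0 z) (H2 z Hz Z)) as (_ & a & D & N).
    destruct (nearly_linear_perturbation A0 z a K CA Hz D N) as (rho0 & R1 & R2 & R3).
    exists (a, rho0). intros _. auto. }
  set (ar := fun z => proj1_sig (constructive_indefinite_description _ (P1 z))).
  assert (Har : forall z, In z s -> fst (ar z) <> RtoC 0 /\ 0 < snd (ar z) /\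
     (forall w, Cmod (w - z) < snd (ar z) -> Im w < 0) /\
     forall rho, 0 < rho <= snd (ar z) -> exists eps, 0 < eps /\
      forall A, second_difference_bound A K -> (forall z, lower z -> Cmod (A z - A0 z) <= eps) ->
      nearly_linear A z (fst (ar z)) rho).
  { intros z. exact (proj2_sig (constructive_indefinite_description _ (P1 z))). }
  clearbody ar. clear P1.
  destruct (list_min_pos (fun z => snd (ar z)) s) as (r1 & Hr1 & Lr1); [intros z Hz; apply Har, Hz|].
  (* Half the distance between distinct zeros; the value 1 on the diagonal only keeps the minimum
     positive. *)
  set (sep := fun p : C * C => if excluded_middle_informative (fst p = snd p) then 1 else Cmod (fst p - snd p) / 2).
  destruct (list_min_pos sep (list_prod s s)) as (r2 & Hr2 & Lr2).
  { intros [z w] _. unfold sep; simpl. destruct (excluded_middle_informative (z = w)) as [h|h]; [lra|].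
    assert (0 < Cmod (z - w)); [|lra]. apply Cmod_gt_0. intros E. apply h.
    replace z with ((z - w) + w)%C by ring. rewrite E. ring. }
  set (rho := Rmin r1 r2). assert (Hrho : 0 < rho) by (apply Rmin_pos; assumption).
  pose proof (Rmin_l r1 r2) as Rl. pose proof (Rmin_r r1 r2) as Rr. fold rho in Rl, Rr.
  assert (Sep : forall z w, In z s -> In w s -> Cmod (z - w) < 2 * rho -> z = w).
  { intros z w Hz Hw Hzw. specialize (Lr2 (z, w) (in_prod s s z w Hz Hw)). unfold sep in Lr2; simpl in Lr2.
    destruct (excluded_middle_informative (z = w)) as [h|h]; [exact h|lra]. }
  assert (P2 : forall z, exists e, 0 < e /\ (In z s ->
      forall A, second_difference_bound A K -> (forall w, lower w -> Cmod (A w - A0 w) <= e) ->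
      nearly_linear A z (fst (ar z)) rho)).
  { intros z. destruct (classic (In z s)) as [h|h]; [|exists 1; split; [lra|tauto]].
    destruct (Har z h) as (_ & _ & _ & R3). destruct (R3 rho) as (e & He & Q).
    - split; [exact Hrho|]. specialize (Lr1 z h). simpl in Lr1. lra.
    - exists e. auto. }
  set (el := fun z => proj1_sig (constructive_indefinite_description _ (P2 z))).
  assert (Hel : forall z, 0 < el z /\ (In z s ->
      forall A, second_difference_bound A K -> (forall w, lower w -> Cmod (A w - A0 w) <= el z) ->
      nearly_linear A z (fst (ar z)) rho)).
  { intros z. exact (proj2_sig (constructive_indefinite_description _ (P2 z))). }
  clearbody el. clear P2.
  destruct (list_min_pos el s (fun z _ => proj1 (Hel z))) as (e1 & He1 & Le1).
  destruct (list_min_pos (fun z => Cmod (fst (ar z)) * rho / 8) s) as (e2 & He2 & Le2).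
  { intros z Hz. destruct (Har z Hz) as (N & _). pose proof (proj1 (Cmod_gt_0 _) N).
    assert (0 < Cmod (fst (ar z)) * rho) by (apply Rmult_lt_0_compat; assumption). lra. }
  (* The covering radius is forced to be [rho] at zeros of [A0], so that a covering disc centered at
     a zero is one of the discs of uniqueness; on the others [A0] stays above half its central
     modulus. *)
  assert (P3 : forall z, exists d, 0 < d /\ (lower z -> A0 z = RtoC 0 -> d = rho) /\
     (lower z -> A0 z <> RtoC 0 -> forall w, lower w -> Cmod (w - z) < d -> Cmod (A0 z) / 2 < Cmod (A0 w))).
  { intros z. destruct (classic (lower z)) as [hl|hl]; [|exists 1; split; [lra|tauto]].
    destruct (classic (A0 z = RtoC 0)) as [h|h]; [exists rho; split; [exact Hrho|tauto]|].
    pose proof (proj1 (Cmod_gt_0 _) h) as Pz.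
    destruct (CA z hl (Cmod (A0 z) / 2)) as (d & Hd & Q); [lra|].
    exists d. split; [exact Hd|]. split; [tauto|]. intros _ _ w Hw Hwd. specialize (Q w Hw Hwd).
    pose proof (Cmod_reverse_triangle (A0 z) (A0 w)) as T. rewrite Cmod_sub_sym in T. lra. }
  set (dl := fun z => proj1_sig (constructive_indefinite_description _ (P3 z))).
  assert (Hdl : forall z, 0 < dl z /\ (lower z -> A0 z = RtoC 0 -> dl z = rho) /\
     (lower z -> A0 z <> RtoC 0 -> forall w, lower w -> Cmod (w - z) < dl z -> Cmod (A0 z) / 2 < Cmod (A0 w))).
  { intros z. exact (proj2_sig (constructive_indefinite_description _ (P3 z))). }
  clearbody dl. clear P3.
  destruct (box_cover (- B) B (- B) 0 dl (fun z => proj1 (Hdl z))) as [L HL].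
  set (val := fun z => if excluded_middle_informative (A0 z = RtoC 0) then 1 else Cmod (A0 z) / 2).
  destruct (list_min_pos val L) as (e3 & He3 & Le3).
  { intros z _. unfold val. destruct (excluded_middle_informative (A0 z = RtoC 0)) as [h|h]; [lra|].
    apply Cmod_gt_0 in h. lra. }
  (* [e1] secures near linearity, [e2] the size of the first Newton step, [e3] the absence of zeros
     in the remaining covering discs, and 1/4 their absence outside the box, where [A0] is within
     1/2 of 1. *)
  exists (Rmin (Rmin e1 e2) (Rmin e3 (/ 4))). split; [repeat apply Rmin_pos; lra|].
  intros A SD Close.
  assert (Cl : forall z, lower z -> Cmod (A z - A0 z) <= e1 /\ Cmod (A z - A0 z) <= e2 /\
     Cmod (A z - A0 z) <= e3 /\ Cmod (A z - A0 z) <= / 4).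
  { intros z Hz. specialize (Close z Hz).
    pose proof (Rmin_l (Rmin e1 e2) (Rmin e3 (/ 4))). pose proof (Rmin_r (Rmin e1 e2) (Rmin e3 (/ 4))).
    pose proof (Rmin_l e1 e2). pose proof (Rmin_r e1 e2). pose proof (Rmin_l e3 (/ 4)). pose proof (Rmin_r e3 (/ 4)).
    repeat split; lra. }
  assert (NL : forall z, In z s -> nearly_linear A z (fst (ar z)) rho).
  { intros z Hz. apply (proj2 (Hel z) Hz A SD). intros w Hw. specialize (Le1 z Hz). destruct (Cl w Hw). lra. }
  assert (Loc : forall z, lower z -> A z = RtoC 0 -> exists w, In w s /\ Cmod (z - w) < rho).
  { intros z Hz EA. destruct (Cl z Hz) as (_ & _ & C3 & C4).
    rewrite EA in C3, C4. replace (0 - A0 z)%C with (- A0 z)%C in * by ring. rewrite Cmod_opp in C3, C4.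
    assert (HzB : Cmod z < B).
    { apply Rnot_le_lt. intros hB. pose proof (Inf z Hz hB) as Q.
      pose proof (Cmod_reverse_triangle 1 (A0 z)) as T. rewrite Cmod_1, Cmod_sub_sym in T. lra. }
    pose proof (re_le_Cmod z) as T1. pose proof (im_le_Cmod z) as T2.
    apply Rabs_le_between in T1. apply Rabs_le_between in T2.
    destruct (HL z) as (w & Hw & (_ & Hw2) & Hzw); [lra|unfold lower in Hz; lra|].
    assert (lw : lower w) by (unfold lower; lra).
    destruct (classic (A0 w = RtoC 0)) as [h|h].
    - exists w. rewrite (proj1 (proj2 (Hdl w)) lw h) in Hzw. split; [|exact Hzw].
      (* A center on the real line is excluded because [A0] has no real zeros. *)
      apply Hs3. split; [|exact h]. destruct lw as [q|q]; [exact q|]. exfalso.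
      apply (H3 (Re w)). replace (RtoC (Re w)) with w; [exact h|]. apply C_eq_parts; [reflexivity|exact q].
    - exfalso. pose proof (proj2 (proj2 (Hdl w)) lw h z Hz Hzw) as Q.
      specialize (Le3 w Hw). unfold val in Le3. destruct (excluded_middle_informative (A0 w = RtoC 0)); [tauto|]. lra. }
  assert (P4 : forall z, exists x, In z s -> Cmod (x - z) < rho /\ A x = RtoC 0).
  { intros z. destruct (classic (In z s)) as [h|h]; [|exists z; tauto].
    destruct (Har z h) as (N & _). destruct (proj1 (Hs3 z) h) as [Hz Z].
    destruct (nearly_linear_zero A z (fst (ar z)) rho Hrho N (NL z h)) as (x & X1 & X2).
    - destruct (Cl z ltac:(unfold lower; lra)) as (_ & C2 & _). rewrite Z in C2.
      replace (A z - 0)%C with (A z) in C2 by ring. specialize (Le2 z h). simpl in Le2. lra.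
    - exists x. auto. }
  set (zt := fun z => proj1_sig (constructive_indefinite_description _ (P4 z))).
  assert (Hzt : forall z, In z s -> Cmod (zt z - z) < rho /\ A (zt z) = RtoC 0).
  { intros z. exact (proj2_sig (constructive_indefinite_description _ (P4 z))). }
  clearbody zt. clear P4.
  assert (Neg : forall z w, In w s -> Cmod (z - w) < rho -> Im z < 0).
  { intros z w Hw Hzw. destruct (Har w Hw) as (_ & _ & R2 & _). apply R2.
    specialize (Lr1 w Hw). simpl in Lr1. lra. }
  split; [|split].
  - exists (map zt s). split; [|split].
    + clear Hs2 Hs3 L HL Le3. 
      assert (G : forall t, NoDup t -> (forall z, In z t -> In z s) -> NoDup (map zt t)).
      { induction t as [|z t IH]; intros ND Sub; simpl; [constructor|].
        inversion ND as [|? ? N1 N2]; subst. constructor.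
        - intros Q. apply in_map_iff in Q. destruct Q as (w & Ew & Hw). apply N1.
          replace z with w; [exact Hw|].
          apply (Sep w z); [apply Sub; right; exact Hw|apply Sub; left; reflexivity|].
          destruct (Hzt z) as [B1 _]; [apply Sub; left; reflexivity|].
          destruct (Hzt w) as [B2 _]; [apply Sub; right; exact Hw|].
          pose proof (Cmod_sub_triangle_l w (zt w) z) as T. rewrite Ew in T at 2. lra.
        - apply IH; [exact N2|]. intros w Hw. apply Sub. right. exact Hw. }
      apply G; auto.
    + rewrite length_map. exact Hs2.
    + intros z. split.
      * intros Q. apply in_map_iff in Q. destruct Q as (w & Ew & Hw). subst z.
        destruct (Hzt w Hw) as [B1 B2]. split; [apply (Neg _ w Hw B1)|exact B2].
      * intros [Hz EA]. destruct (Loc z) as (w & Hw & Hzw); [unfold lower; lra|exact EA|].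
        apply in_map_iff. exists w. split; [|exact Hw]. destruct (Hzt w Hw) as [B1 B2].
        apply (nearly_linear_unique A w (fst (ar w)) rho); auto; try lra. apply Har, Hw.
  - intros z Hz EA. destruct (Loc z) as (w & Hw & Hzw); [unfold lower; lra|exact EA|].
    apply simple_zero_deriv. split; [exact EA|].
    destruct (second_difference_derivable A K SD z Hz) as [l Hl].
    pose proof (proj1 (is_derive_C_eps A z l) Hl) as Dl. clear Hl. rename Dl into Hl.
    exists l. split; [exact Hl|].
    apply (nearly_linear_simple A w (fst (ar w)) rho z l); auto. apply Har, Hw.
  - intros x EA. destruct (Loc (RtoC x)) as (w & Hw & Hzw); [unfold lower; simpl; lra|exact EA|].
    pose proof (Neg _ w Hw Hzw) as Q. simpl in Q. lra.
Qed.

(** * Potentials in H^{2,2} *)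

Lemma locally_outside M x : M < Rabs x -> locally x (fun t => M < Rabs t).
Proof.
  intros H. assert (He : 0 < Rabs x - M) by lra. exists (mkposreal _ He). intros t Ht.
  change (Rabs (t - x) < Rabs x - M) in Ht.
  pose proof (Rabs_triang_inv x t) as Q. rewrite Rabs_minus_sym in Q. lra.
Qed.

Lemma Derive_outside (g : R -> R) M : (forall t, M < Rabs t -> g t = 0) ->
  forall t, M < Rabs t -> Derive g t = 0.
Proof.
  intros H t Ht. rewrite (Derive_ext_loc g (fun _ => 0)); [apply Derive_const|].
  eapply filter_imp; [|apply (locally_outside M t Ht)]. exact H.
Qed.

Definition first_derivative (phi : R -> C) (x : R) : C :=
  (Derive (fun y => Re (phi y)) x, Derive (fun y => Im (phi y)) x).

Lemma test_function_admissible phi : is_test_function phi ->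
  exists M, admissible phi (first_derivative phi) (second_derivative phi) M.
Proof.
  intros [D [M HM]]. exists (Rmax 0 M).
  assert (Z : forall t, Rmax 0 M < Rabs t -> phi t = RtoC 0).
  { intros t Ht. apply HM. pose proof (Rmax_r 0 M). lra. }
  assert (Z0 : forall t, Rmax 0 M < Rabs t -> Re (phi t) = 0 /\ Im (phi t) = 0).
  { intros t Ht. rewrite Z by exact Ht. split; reflexivity. }
  pose proof (Derive_outside (fun y => Re (phi y)) _ (fun t Ht => proj1 (Z0 t Ht))) as R1.
  pose proof (Derive_outside (fun y => Im (phi y)) _ (fun t Ht => proj2 (Z0 t Ht))) as I1.
  pose proof (Derive_outside _ _ R1) as R2. pose proof (Derive_outside _ _ I1) as I2.
  split; [apply Rmax_l|]. split; [|split; [|split]].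
  - intros t. split; apply Derive_correct; [exact (proj1 (D 1%nat t))|exact (proj2 (D 1%nat t))].
  - intros t. split; apply Derive_correct; [exact (proj1 (D 2%nat t))|exact (proj2 (D 2%nat t))].
  - intros t. split.
    + exact (ex_derive_continuous _ _ (proj1 (D 3%nat t))).
    + exact (ex_derive_continuous _ _ (proj2 (D 3%nat t))).
  - intros t Ht. split; [exact (Z t Ht)|]. split.
    + apply C_eq_parts; [exact (R1 t Ht)|exact (I1 t Ht)].
    + apply C_eq_parts; [exact (R2 t Ht)|exact (I2 t Ht)].
Qed.

(** The norms converge to [r < d], so a tail of the Cauchy sequence has norms below [d]; the factor
    8 is that of [test_norm_w11]. *)
Lemma H22_approximates u r d : is_H22_norm u r -> r < d ->
  exists f f1 f2 Mn, approximates u f f1 f2 Mn (8 * d).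
Proof.
  intros (phi & T & Cau & L & N) Hr.
  assert (He : 0 < d - r) by lra.
  apply is_lim_seq_spec in N. destruct (N (mkposreal _ He)) as [N0 HN0]. simpl in HN0.
  destruct (choice_seq (fun n M => admissible (phi n) (first_derivative (phi n)) (second_derivative (phi n)) M)) as [Mn HM].
  { intros n. apply test_function_admissible, T. }
  exists (fun n => phi (n + N0)%nat), (fun n => first_derivative (phi (n + N0)%nat)),
    (fun n => second_derivative (phi (n + N0)%nat)), (fun n => Mn (n + N0)%nat).
  split; [|split; [|split]].
  - intros n. apply HM.
  - intros n. apply (test_norm_w11 _ _ _ _ _ (HM (n + N0)%nat)).
    specialize (HN0 (n + N0)%nat ltac:(lia)). apply Rabs_lt_between in HN0. lra.
  - intros eps Heps. assert (He8 : 0 < eps / 8) by lra.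
    destruct (Cau (mkposreal _ He8)) as [N1 HN1]. exists N1. intros n m Hn Hm.
    replace eps with (8 * (eps / 8)) by field.
    apply (test_norm_w11 _ _ _ _ _ (admissible_minus _ _ _ _ _ _ _ _ (HM (n + N0)%nat) (HM (m + N0)%nat))).
    apply (HN1 (n + N0)%nat (m + N0)%nat); lia.
  - intros x eps Heps. pose proof (proj2 (flim_filterlim eventually (fun n => phi n x) (u x)) (L x)) as Q.
    destruct (Q eps Heps) as [N1 HN1]. exists N1. intros n Hn. apply HN1. lia.
Qed.

Lemma approximates_mono q f f1 f2 Mn R0 R1 : R0 <= R1 ->
  approximates q f f1 f2 Mn R0 -> approximates q f f1 f2 Mn R1.
Proof.
  intros HR (A & B & D & E). split; [exact A|split; [|split; [exact D|exact E]]].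
  intros n. apply (w11_le_mono _ _ _ _ HR (B n)).
Qed.

Lemma approximates_plus u f f1 f2 Mn R0 v g g1 g2 Mn' R1 :
  approximates u f f1 f2 Mn R0 -> approximates v g g1 g2 Mn' R1 ->
  approximates (fun x => u x + v x)%C (fun n t => f n t + g n t)%C (fun n t => f1 n t + g1 n t)%C
    (fun n t => f2 n t + g2 n t)%C (fun n => Rmax (Mn n) (Mn' n)) (R0 + R1).
Proof.
  intros (A & B & D & E) (A' & B' & D' & E'). split; [|split; [|split]].
  - intros n. apply admissible_plus; auto.
  - intros n. apply (w11_le_plus _ _ _ _ _ _ _ _ _ _ (A n) (A' n) (B n) (B' n)).
  - intros eps He. assert (He2 : 0 < eps / 2) by lra.
    destruct (D _ He2) as [N HN]. destruct (D' _ He2) as [N' HN'].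
    exists (max N N'). intros n m Hn Hm. replace eps with (eps / 2 + eps / 2) by field.
    eapply w11_le_ext; [| |apply (w11_le_plus _ _ _ _ _ _ _ _ _ _
      (admissible_minus _ _ _ _ _ _ _ _ (A n) (A m)) (admissible_minus _ _ _ _ _ _ _ _ (A' n) (A' m)));
      [apply HN; lia|apply HN'; lia]]; intros t; simpl; ring.
  - intros x. apply flim_plus; filter_tc; auto.
Qed.

Lemma approximates_ext u v f f1 f2 Mn R0 : (forall x, u x = v x) ->
  approximates u f f1 f2 Mn R0 -> approximates v f f1 f2 Mn R0.
Proof.
  intros E (A & B & D & L). split; [exact A|split; [exact B|split; [exact D|]]].
  intros x. rewrite <- E. apply L.
Qed.

Lemma is_alpha_unique q a b : is_alpha q a -> is_alpha q b -> forall z, lower z -> a z = b z.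
Proof.
  intros (Ta & Ca & Da) (Tb & Cb & Db).
  assert (Er : forall x : R, a (RtoC x) = b (RtoC x)).
  { intros x. destruct (Ta x) as (T & HT & ->), (Tb x) as (T' & HT' & ->).
    apply (transition_entry_unique q x T T' HT HT'). }
  pose proof (proj1 (continuous_on_eps _ a) Ca) as Ka. pose proof (proj1 (continuous_on_eps _ b) Cb) as Kb.
  intros z [Hz|Hz].
  2:{ replace z with (RtoC (Re z)) by (apply C_eq_parts; [reflexivity|symmetry; exact Hz]). apply Er. }
  assert (Z : (a z - b z)%C = RtoC 0).
  { apply (boundary_uniqueness (fun w => a w - b w)%C); [| | |exact Hz].
    - intros w Hw eps He.
      destruct (Ka w Hw (eps / 2) ltac:(lra)) as (d1 & Hd1 & K1).
      destruct (Kb w Hw (eps / 2) ltac:(lra)) as (d2 & Hd2 & K2).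
      exists (Rmin d1 d2). split; [apply Rmin_pos; assumption|]. intros v Hv Hvw.
      pose proof (Rmin_l d1 d2). pose proof (Rmin_r d1 d2).
      replace (a v - b v - (a w - b w))%C with ((a v - a w) - (b v - b w))%C by ring.
      eapply Rle_lt_trans; [apply Cmod_minus_le|].
      specialize (K1 v Hv ltac:(lra)). specialize (K2 v Hv ltac:(lra)). lra.
    - intros w Hw. destruct (Da w Hw) as [l Hl], (Db w Hw) as [m Hm].
      pose proof (proj1 (is_derive_C_eps a w l) Hl) as Ql. pose proof (proj1 (is_derive_C_eps b w m) Hm) as Qm.
      exists (l - m)%C. intros eps He.
      destruct (Ql (eps / 2) ltac:(lra)) as (d1 & Hd1 & K1).
      destruct (Qm (eps / 2) ltac:(lra)) as (d2 & Hd2 & K2).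
      exists (Rmin d1 d2). split; [apply Rmin_pos; assumption|]. intros h Hh.
      pose proof (Rmin_l d1 d2). pose proof (Rmin_r d1 d2).
      replace (a (w + h)%C - b (w + h)%C - (a w - b w) - (l - m) * h)%C with
        ((a (w + h)%C - a w - l * h) - (b (w + h)%C - b w - m * h))%C by ring.
      eapply Rle_trans; [apply Cmod_minus_le|].
      specialize (K1 h ltac:(lra)). specialize (K2 h ltac:(lra)). lra.
    - intros x. rewrite Er. ring. }
  replace (a z) with ((a z - b z) + b z)%C by ring. rewrite Z. ring.
Qed.

(** The limit itself witnesses that the choice defining [alpha q] is not vacuous; uniqueness then
    makes the two agree. *)
Lemma alpha_limit (q : H22) f f1 f2 Mn R0 A :
  approximates q f f1 f2 Mn R0 -> ucv lower (alphas f f1 Mn) A -> forall z, lower z -> A z = alpha q z.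
Proof.
  intros Hap HA. pose proof (limit_is_alpha q f f1 f2 Mn R0 A Hap HA) as H.
  apply (is_alpha_unique q A (alpha q) H). unfold alpha. apply epsilon_spec. exists A. exact H.
Qed.

(** The perturbed potential is approximated by sums, so the difference of approximants is exactly
    the approximant of the perturbation, of size [s] for every [n]. *)
Lemma alphas_diff f f1 f2 Mn R0 u g g1 g2 Mn' v R1 s A A' z :
  approximates u f f1 f2 Mn R0 -> approximates v g g1 g2 Mn' s -> R0 + s <= R1 -> 0 < s ->
  ucv lower (alphas f f1 Mn) A ->
  ucv lower (alphas (fun n t => f n t + g n t)%C (fun n t => f1 n t + g1 n t)%C (fun n => Rmax (Mn n) (Mn' n))) A' ->
  lower z -> Cmod (A' z - A z) <= lip_const R1 * s.
Proof.
  intros Hu Hv HR Hs HA HA' Hz.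
  pose proof (approximates_mono _ _ _ _ _ _ _ HR (approximates_plus _ _ _ _ _ _ _ _ _ _ _ _ Hu Hv)) as Hp.
  assert (HR0 : R0 <= R1) by lra.
  pose proof (approximates_mono _ _ _ _ _ _ _ HR0 Hu) as Hu1.
  replace (A' z - A z)%C with ((A' z - A z) - 0)%C by ring.
  apply (ccv_Cmod_le _ _ _ _ (flim_minus eventually _ _ _ _ (ucv_ccv _ _ _ z HA' Hz) (ucv_ccv _ _ _ z HA Hz))).
  exists 0%nat. intros n _.
  match goal with |- Cmod (Cminus ?a _) <= _ => replace (a - 0)%C with a by ring end.
  apply (test_alpha_potential _ _ _ _ _ _ _ _ R1 s z (proj1 Hp n) (proj1 Hu n)
    (proj1 (proj2 Hp) n) (proj1 (proj2 Hu1) n) Hs); [|exact Hz].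
  eapply w11_le_ext; [| |exact (proj1 (proj2 Hv) n)]; intros t; simpl; ring.
Qed.

Theorem proposition3p10 (n : nat) (q0 : H22)
    (h : has_n_simple_zeros n (alpha q0)) :
  exists N : H22 -> Prop,
    H22_neighborhood q0 N /\
    (forall q : H22, N q -> has_n_simple_zeros n (alpha q)).
Proof.
  destruct (H22_mem q0) as [r0 Hr0].
  destruct (H22_approximates q0 r0 (r0 + 1) Hr0 ltac:(lra)) as (f & f1 & f2 & Mn & Hap).
  (* [R1] bounds every potential of the neighborhood to be chosen, so one second-difference constant
     serves them all. *)
  set (R0 := 8 * (r0 + 1)) in *. set (R1 := R0 + 1).
  destruct (ucv_exists lower _ (alphas_cauchy _ _ _ _ _ _ Hap)) as [A0 HA0].
  pose proof (alpha_limit q0 _ _ _ _ _ _ Hap HA0) as E0.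
  destruct (limit_alpha_at_infinity _ _ _ _ _ _ Hap A0 HA0 (/ 2) ltac:(lra)) as (B & _ & HB).
  destruct (simple_zeros_stable A0 (exp (2 * kap R1)) B n) as (eps & He & Stable).
  - intros l Hl. exact (limit_alpha_continuous _ _ _ _ _ _ Hap A0 HA0 l Hl).
  - exact HB.
  - apply (has_n_simple_zeros_lower_ext n (alpha q0)); [|exact h].
    intros z Hz. symmetry. apply E0, Hz.
  (* The first bound keeps [R0 + 8 * d] below [R1]; the second makes the Lipschitz estimate at most
     [eps]. *)
  - set (d := Rmin (/ 8) (eps / (8 * lip_const R1))).
    pose proof (lip_const_pos R1) as Hlip.
    assert (Hd : 0 < d) by (apply Rmin_pos; [lra|apply Rdiv_lt_0_compat; lra]).
    assert (Hd1 : d <= / 8) by apply Rmin_l.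
    assert (Hd2 : lip_const R1 * (8 * d) <= eps).
    { assert (Q : d <= eps / (8 * lip_const R1)) by apply Rmin_r. apply Rle_div_r in Q; lra. }
    exists (fun q => has_n_simple_zeros n (alpha q)). split; [|auto].
    exists (mkposreal d Hd). intros q r Hq Hr. simpl in Hr.
    destruct (H22_approximates _ r d Hq Hr) as (g & g1 & g2 & Mn' & Hg).
    assert (HR : R0 + 8 * d <= R1) by (unfold R1; lra).
    pose proof (approximates_mono _ _ _ _ _ _ _ HR (approximates_plus _ _ _ _ _ _ _ _ _ _ _ _ Hap Hg)) as Hs.
    apply (approximates_ext _ q) in Hs; [|intros x; ring].
    destruct (ucv_exists lower _ (alphas_cauchy _ _ _ _ _ _ Hs)) as [A HA].
    apply (has_n_simple_zeros_lower_ext n A); [exact (alpha_limit q _ _ _ _ _ _ Hs HA)|].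
    apply Stable.
    + intros eta l h0 k. exact (limit_alpha_second_difference _ _ _ _ _ _ Hs A HA eta l h0 k).
    + intros z Hz. eapply Rle_trans; [|exact Hd2].
      apply (alphas_diff _ _ _ _ _ _ _ _ _ _ _ R1 (8 * d) A0 A z Hap Hg HR ltac:(lra) HA0 HA Hz).
Qed.
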